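(* Let $n,r,d$ be integers such that $n\ge 2$, $d\ge 1$ is odd, and $1\le r\le n-1$. For $a=0,1,\dots,\lfloor rd/2\rfloor$ write $\alpha=\lfloor a/(n-r)\rfloor$ and $s=a\bmod (n-r)$, and let $K_a(\lambda)$ be any $n\times n$ complex symmetric matrix polynomial of degree exactly $d$ and rank exactly $r$ whose complete eigenstructure (with respect to grade $d$) consists of: $s$ left minimal indices equal to $\alpha+1$ and $n-r-s$ left minimal indices equal to $\alpha$; right minimal indices equal to the left minimal indices; and $rd-2a$ linear elementary divisors $(\lambda-\mu_1),\dots,(\lambda-\mu_{rd-2a})$ with pairwise distinct $\mu_i\in\mathbb C$ (and no infinite elementary divisors). Then: (i) For every $n\times n$ complex symmetric matrix polynomial $P$ of grade $d$ with rank at most $r$ and every $\epsilon>0$, there exists an $n\times n$ complex symmetric matrix polynomial $P_a\in\mathrm B^s(K_a)$, for some $0\le a\le\lfloor rd/2\rfloor$, such that $d(P,P_a)<\epsilon$. (ii) Let $0\le a\le\lfloor rd/2\rfloor$. Then, for every $n\times n$ complex symmetric matrix polynomial $P\in\mathrm B^s(K_a)$, there exists a number $\epsilon>0$ such that $$\mathcal B_r(P,\epsilon):=\{P' : P'\in\mathrm{POL}^s_{d,n\times n}(r)\text{ and } d(P,P')<\epsilon\}\subseteq \mathrm B^s(K_a).$$ Moreover, such set $\mathcal B_r(P,\epsilon)$ contains infinitely many elements.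
   Context: A matrix polynomial of grade $d$ is $P(\lambda)=\lambda^dA_d+\cdots+\lambda A_1+A_0$ with complex matrix coefficients, where $A_d$ may be zero (so the degree, i.e. the largest $i$ with $A_i\neq 0$, is at most $d$); it is symmetric if all $A_i^\top=A_i$. $\mathrm{POL}^s_{d,n\times n}$ is the space of $n\times n$ complex symmetric matrix polynomials of grade $d$, with distance $d(P,\widetilde P)=\big(\sum_{i=0}^d\|A_i-\widetilde A_i\|_F^2\big)^{1/2}$ (Frobenius norm). The rank of $P$ is its rank over the field $\mathbb C(\lambda)$, and $\mathrm{POL}^s_{d,n\times n}(r)$ is the subset of polynomials in $\mathrm{POL}^s_{d,n\times n}$ of rank at most $r$. Finite eigenvalues and finite elementary divisors $(\lambda-\mu)^{\delta}$ are those obtained from the Smith form of $P$ (prime-power factors of the invariant polynomials). $P$, regarded with grade $d$, has $\infty$ as an eigenvalue if $0$ is an eigenvalue of $\operatorname{rev}P(\lambda):=\lambda^dP(1/\lambda)$, and the infinite elementary divisors of $P$ are the elementary divisors of $\operatorname{rev}P$ at $0$. The right (left) minimal indices of $P$ are the degrees of the vectors in a minimal basis (polynomial basis with minimal sum of degrees) of the right (left) null-space of $P$ over $\mathbb C(\lambda)$; for symmetric $P$ the left and right minimal indices coincide. The complete eigenstructure of $P$ is the collection of all its elementary divisors (finite and infinite) and its left and right minimal indices. The symmetric bundle $\mathrm B^s(P)\subset\mathrm{POL}^s_{d,n\times n}$ of $P\in\mathrm{POL}^s_{d,n\times n}$ is the set of symmetric matrix polynomials with the same size, grade and complete eigenstructure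 as $P$, except that the values of the distinct eigenvalues (which may include $\infty$) are unspecified as long as they remain distinct. For each $a=0,1,\dots,\lfloor rd/2\rfloor$ and each choice of distinct $\mu_i$ a polynomial $K_a$ as described exists, and $\mathrm B^s(K_a)$ does not depend on the choice. *)

(* Defs.v *)
From HB Require Import structures.
From mathcomp Require Import all_boot all_order all_algebra fraction.
From mathcomp Require Import complex.
From mathcomp Require Import all_classical reals.

Set Implicit Arguments.
Unset Strict Implicit.
Unset Printing Implicit Defensive.

Import Order.TTheory GRing.Theory Num.Theory.

Local Open Scope classical_set_scope.
Local Open Scope ring_scope.

Definition mpcoef (F : closedFieldType) (m n i : nat)
    (P : 'M[{poly F}]_(m, n)) : 'M[F]_(m, n) :=
  map_mx (fun p : {poly F} => p`_i) P.

Definition has_grade (F : closedFieldType) (n d : nat)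
    (P : 'M[{poly F}]_n) : Prop :=
  forall i : nat, (d < i)%N -> mpcoef i P = 0.

Definition symmetric_mp (F : closedFieldType) (n : nat)
    (P : 'M[{poly F}]_n) : Prop :=
  forall i : nat, (mpcoef i P)^T = mpcoef i P.

Definition POLs (F : closedFieldType) (n d : nat) : set 'M[{poly F}]_n :=
  [set P | has_grade d P /\ symmetric_mp P].
Arguments POLs : clear implicits.

Definition mpfrac (F : closedFieldType) (m n : nat)
    (P : 'M[{poly F}]_(m, n)) : 'M[{fraction {poly F}}]_(m, n) :=
  map_mx (@tofrac {poly F}) P.

Definition mprank (F : closedFieldType) (n : nat) (P : 'M[{poly F}]_n) : nat :=
  \rank (mpfrac P).

Definition POLs_rank_le (F : closedFieldType) (n d r : nat) :
    set 'M[{poly F}]_n :=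
  [set P | POLs F n d P /\ (mprank P <= r)%N].
Arguments POLs_rank_le : clear implicits.

(* rev P (x) = x^d P(1/x), for P of grade d *)
Definition mprev (F : closedFieldType) (n d : nat) (P : 'M[{poly F}]_n) :
    'M[{poly F}]_n :=
  \matrix_(i, j) \poly_(k < d.+1) (P i j)`_(d - k).

(* [ps] lists the (nonzero, monic) invariant polynomials of P; the remaining *)
(* diagonal entries of the Smith form are 0.  [unitmx] over {poly F} is      *)
(* unimodularity.                                                            *)
Definition invariant_polynomials (F : closedFieldType) (n : nat)
    (P : 'M[{poly F}]_n) (ps : seq {poly F}) : Prop :=
  [/\ (size ps <= n)%N,
      all (fun p => p \is monic) ps,
      sorted (@dvdp F) ps
    & exists U V : 'M[{poly F}]_n,
        [/\ U \in unitmx, V \in unitmx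
          & U *m P *m V = \matrix_(i, j) (ps`_i *+ (i == j))]].

(* An elementary divisor is a pair of an eigenvalue in F u {oo}, with oo     *)
(* encoded by [None], and a positive exponent; since F is algebraically      *)
(* closed, ('X - mu%:P) ^+ k is a prime-power factor of the invariant        *)
(* polynomial p exactly when k = mup mu p > 0.                               *)
Definition elementary_divisors (F : closedFieldType) (n d : nat)
    (P : 'M[{poly F}]_n) (eds : seq (option F * nat)) : Prop :=
  exists ps qs : seq {poly F},
    [/\ invariant_polynomials P ps,
        invariant_polynomials (mprev d P) qs,
        (forall (mu : F) (k : nat), count_mem (Some mu, k) eds =
           if (0 < k)%N then count (fun p => mup mu p == k) ps else 0%N)
      & (forall k : nat, count_mem (None, k) eds =
           if (0 < k)%N then count (fun q => mup 0 q == k) qs else 0%N)].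

(* The rows of B are polynomial vectors forming a basis, over F(x), of the   *)
(* left null-space of P.                                                     *)
Definition left_polynomial_basis (F : closedFieldType) (n k : nat)
    (P : 'M[{poly F}]_n) (B : 'M[{poly F}]_(k, n)) : Prop :=
  row_free (mpfrac B) /\ (mpfrac B :=: kermx (mpfrac P))%MS.

Definition row_degree (F : closedFieldType) (k n : nat)
    (B : 'M[{poly F}]_(k, n)) (i : 'I_k) : nat :=
  \max_(j < n) (size (B i j)).-1.

Definition left_minimal_basis (F : closedFieldType) (n k : nat)
    (P : 'M[{poly F}]_n) (B : 'M[{poly F}]_(k, n)) : Prop :=
  left_polynomial_basis P B /\
  forall B' : 'M[{poly F}]_(k, n), left_polynomial_basis P B' ->
    (\sum_(i < k) row_degree B i <= \sum_(i < k) row_degree B' i)%N.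

Definition left_minimal_indices (F : closedFieldType) (n : nat)
    (P : 'M[{poly F}]_n) (s : seq nat) : Prop :=
  exists (k : nat) (B : 'M[{poly F}]_(k, n)),
    left_minimal_basis P B /\ perm_eq s [seq row_degree B i | i : 'I_k].

(* P x = 0 iff x^T P^T = 0 *)
Definition right_minimal_indices (F : closedFieldType) (n : nat)
    (P : 'M[{poly F}]_n) (s : seq nat) : Prop :=
  left_minimal_indices P^T s.

(* The three lists are multisets: they matter only up to permutation. *)
Record eigenstructure (F : closedFieldType) := Eigenstructure {
  es_divisors : seq (option F * nat);
  es_left : seq nat;
  es_right : seq nat
}.

Definition has_eigenstructure (F : closedFieldType) (n d : nat)
    (P : 'M[{poly F}]_n) (E : eigenstructure F) : Prop :=
  [/\ elementary_divisors d P (es_divisors E),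
      left_minimal_indices P (es_left E)
    & right_minimal_indices P (es_right E)].

(* [f] renames the eigenvalues of E1, oo included, keeping distinct ones     *)
(* distinct.                                                                 *)
Definition same_up_to_eigenvalues (F : closedFieldType)
    (E1 E2 : eigenstructure F) : Prop :=
  [/\ perm_eq (es_left E1) (es_left E2),
      perm_eq (es_right E1) (es_right E2)
    & exists f : option F -> option F,
        {in [seq e.1 | e <- es_divisors E1] &, injective f} /\
        perm_eq [seq (f e.1, e.2) | e <- es_divisors E1] (es_divisors E2)].

Definition symmetric_bundle (F : closedFieldType) (n d : nat)
    (P : 'M[{poly F}]_n) : set 'M[{poly F}]_n :=
  [set Q | POLs F n d Q /\
     exists E1 E2 : eigenstructure F,
       [/\ has_eigenstructure d P E1, has_eigenstructure d Q E2
         & same_up_to_eigenvalues E1 E2]].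

Definition frobenius_norm (R : realType) (m n : nat) (A : 'M[R[i]]_(m, n)) : R :=
  Num.sqrt (\sum_(i < m) \sum_(j < n) ComplexField.Normc.normc (A i j) ^+ 2).

Definition mpdist (R : realType) (n d : nat) (P Q : 'M[{poly R[i]}]_n) : R :=
  Num.sqrt (\sum_(i < d.+1) frobenius_norm (mpcoef i P - mpcoef i Q) ^+ 2).

Definition rank_ball (R : realType) (n d r : nat) (P : 'M[{poly R[i]}]_n)
    (eps : R) : set 'M[{poly R[i]}]_n :=
  [set P' | POLs_rank_le R[i] n d r P' /\ mpdist d P P' < eps].

(* No infinite elementary divisors: every entry of the list is [Some _].     *)
Definition is_K (F : closedFieldType) (n r d a : nat)
    (K : 'M[{poly F}]_n) : Prop :=
  let alpha := (a %/ (n - r))%N in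
  let s := (a %% (n - r))%N in
  let minidx := nseq s alpha.+1 ++ nseq (n - r - s) alpha in
  [/\ POLs F n d K,
      mpcoef d K != 0,
      mprank K = r
    & exists mu : seq F,
        [/\ size mu = (r * d - 2 * a)%N, uniq mu
          & has_eigenstructure d K
              (Eigenstructure [seq (Some x, 1%N) | x <- mu] minidx minidx)]].

(* Main.v *)
(* A symmetric P of rank at most r factors as P = V^T D V, where the r x n matrix V has row     *)
(* degrees at most v_i, D is symmetric with deg D_ij <= d - v_i - v_j, and det D <> 0: take for  *)
(* V a minimal basis of the row space of P, padded with zero rows.  As a form of degree          *)
(* r d - 2 (sum v_i), det D has exactly that many zeros on the projective line.                  *)
(*                                                                                               *)
(* (i) If (X - x0)^2 divides det D, there is an isotropic c in the kernel of D(x0); replacing    *)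
(* a basis vector by c / (X - x0) divides det D by (X - x0)^2 and raises sum v_i by one.  The    *)
(* same works at infinity after reversal, so det D may be assumed squarefree on the projective   *)
(* line.  Keeping D and perturbing V towards a "zigzag" matrix with the same row degrees makes V *)
(* left prime with a balanced kernel, whence a polynomial in the bundle of K_a, a = sum v_i.     *)
(*                                                                                               *)
(* (ii) For P' = V^T D V close to P, lower semicontinuity of the ranks of the Toeplitz           *)
(* (convolution) matrices of P gives sum v_i >= a.  A simple eigenvalue of P is a simple root of *)
(* det (W^T P W) for a constant W, and det (W^T P' W) = det D * det (V W)^2 has a simple root    *)
(* nearby, which must be a root of det D: hence r d - 2 a <= r d - 2 (sum v_i).  So sum v_i = a, *)
(* det D has only simple roots and the Toeplitz ranks of V are the generic ones.                 *)

Require Import Defs.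
From HB Require Import structures.
From mathcomp Require Import all_boot all_order all_algebra fraction.
From mathcomp Require Import perm generic_quotient.
From mathcomp Require Import complex zify ring lra.
From mathcomp Require Import all_classical reals.

Set Implicit Arguments.
Unset Strict Implicit.
Unset Printing Implicit Defensive.

Import Order.TTheory GRing.Theory Num.Theory.
Local Open Scope classical_set_scope.
Local Open Scope ring_scope.

(** * Reversal and symmetric factorizations *)

(** Everything is read off a factorization [P = V^T *m D *m V] ([sym_fact]) in which row i of V has
    degree at most v_i. Counted on the projective line, det D has exactly r d - 2 sum v_i zeros
    ([det_degree]). When V has a polynomial right inverse, det D agrees up to a unit with the
    product of the invariant polynomials of P ([smith_exists]), and x P = 0 is equivalent to x V^T =
    0 ([sym_fact_ker]). The minimal indices are then governed by the Toeplitz matrices [toep K v V]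
    of x |-> x V^T on vectors of degree < K: if [toep alpha] has independent rows and
    [toep alpha.+1] full column rank, all indices are alpha or alpha + 1 ([balanced_left_indices]).
    If moreover det D has as many distinct projective zeros as its degree allows, P has the
    eigenstructure of K_a with a = sum v_i, up to the values of the eigenvalues
    ([generic_eigenstructure]).

    Density. A minimal basis of the row space, padded to r rows, gives a factorization
    ([sym_fact_padded]). [sym_fact_squarefree] makes the zeros simple without changing P: each step
    trades a double zero of det D for an increase of sum v_i. The two rank conditions on V hold for
    the zigzag matrix of [balanced_pattern], and fail at only finitely many points of a line through
    it, so an arbitrarily small move of V achieves them while D stays fixed.

    Openness. A nearby P' has a factorization of its own, with degrees v_i that need not vary
    continuously; only P' itself is controlled. Semicontinuity of the Toeplitz ranks of P' gives sum
    v_i >= a ([sym_fact_near]). Simple eigenvalues persist as distinct zeros of det D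
    ([nearby_roots]), and counting them gives sum v_i <= a. Equality turns all the bounds into the
    hypotheses of [generic_eigenstructure]. *)

Lemma size_sum_le (A : nzRingType) (I : Type) (s : seq I) (Q : pred I)
    (G : I -> {poly A}) m :
  (forall i, Q i -> (size (G i) <= m)%N) ->
  (size (\sum_(i <- s | Q i) G i)%R <= m)%N.
Proof.
move=> hG; elim/big_ind: _ => [|p q hp hq|]; first by rewrite size_poly0.
  by rewrite (leq_trans (size_polyD _ _)) // geq_max hp.
exact: hG.
Qed.

Section Reversal.
Variable F : closedFieldType.
Implicit Types p q : {poly F}.

Lemma eq_poly_nz p q : (forall x, x != 0 -> p.[x] = q.[x]) -> p = q.
Proof.
move=> eq_pq; apply/eqP; rewrite -subr_eq0; apply/negPn/negP => nz.
have /closed_nonrootP[x]: (p - q) * 'X != 0 by rewrite mulf_neq0 ?polyX_eq0.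
rewrite rootM !rootE !hornerE subr_eq0 negb_or => /andP[+ x0].
by rewrite eq_pq ?eqxx.
Qed.

Definition hrevp N p : {poly F} := \poly_(k < N.+1) p`_(N - k).

Lemma horner_hrevp N p x :
  (size p <= N.+1)%N -> x != 0 -> (hrevp N p).[x] = x ^+ N * p.[x^-1].
Proof.
move=> szp x0; rewrite horner_poly (horner_coef_wide _ szp) mulr_sumr.
rewrite (reindex_inj rev_ord_inj) /=; apply: eq_bigr => i _.
rewrite subSS subKn -1?ltnS // exprVn mulrCA; congr (_ * _).
by rewrite expfB_cond // (negPf x0) /= leq_ord.
Qed.

Lemma size_hrevp N p : (size (hrevp N p) <= N.+1)%N.
Proof. exact: size_poly. Qed.

Lemma hrevpK N p : (size p <= N.+1)%N -> hrevp N (hrevp N p) = p.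
Proof.
move=> szp; apply/polyP => k; rewrite coef_poly; case: ltnP => [kN|kN].
  by rewrite coef_poly ltnS leq_subr subKn.
by rewrite nth_default ?(leq_trans szp).
Qed.

Lemma hrevp0 N : hrevp N 0 = 0.
Proof. by apply/polyP => k; rewrite coef_poly !coef0 if_same. Qed.

Lemma mul_dvdX n m p q :
  p != 0 -> ~~ root q 0 -> 'X^n * p = 'X^m * q -> (n + mup 0 p)%N = m.
Proof.
move=> p0 q0 e; have qn0 : q != 0 by apply: contraNneq q0 => ->; rewrite root0.
move/(congr1 (mup 0)): e.
have mX k : mup 0 ('X^k : {poly F}) = k.
  by move: (mup_XsubCX k (0:F) 0); rewrite subr0 eqxx.
have X0 k : ('X^k : {poly F}) != 0 by rewrite expf_neq0 ?polyX_eq0.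
by rewrite !mupM ?X0 // !mX (mupNroot q0) addn0.
Qed.

(** Reversing p at its exact degree yields a polynomial nonzero at 0, so comparing orders at 0
    counts zeros: deg p finite ones, and those of q at 0, which stand for zeros of p at infinity. *)
Lemma degree_mup0 N a p q : p != 0 -> q != 0 ->
  (forall x, x != 0 -> x ^+ a * q.[x] = x ^+ N * p.[x^-1]) ->
  ((size p).-1 + mup 0 q + a = N)%N.
Proof.
move=> p0 q0 e; pose D := (size p).-1.
have szp : size p = D.+1 by rewrite prednK ?size_poly_gt0.
have r0 : ~~ root (hrevp D p) 0.
  by rewrite rootE horner_coef0 coef_poly /= subn0 -lead_coefE lead_coef_eq0.
have : 'X^(a + D) * q = 'X^N * hrevp D p.
  apply: eq_poly_nz => x x0; rewrite !hornerE.
  rewrite horner_hrevp ?szp // mulrCA -(e _ x0) mulrA; congr (_ * _).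
  by rewrite -exprD addnC.
by move/(mul_dvdX q0 r0); rewrite -/D; lia.
Qed.

End Reversal.
Lemma size_mul3_le (A : nzRingType) (p q w : {poly A}) a b d :
  (size p <= a.+1)%N -> (size w <= b.+1)%N ->
  (q != 0 -> (size q + (a + b) <= d.+1)%N) ->
  (size (p * q * w)%R <= d.+1)%N.
Proof.
have [->|q0] := eqVneq q 0; first by rewrite mulr0 mul0r size_poly0.
move=> hp hw /(_ isT) hq; rewrite -size_poly_gt0 in q0.
have := size_polyMleq (p * q) w; have := size_polyMleq p q; lia.
Qed.

Section SymmetricFactorization.
Variables (F : closedFieldType) (d n r : nat).
Implicit Types (v : 'I_r -> nat) (V : 'M[{poly F}]_(r, n)) (D : 'M[{poly F}]_r).

Definition vrev v V := \matrix_(i, j) hrevp (v i) (V i j).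
(** Entry (i, j) is reversed relative to the grade d - v_i - v_j. Where this would be negative, a
    factorization has [D i j = 0]; the explicit 0 makes [size_drev] hold for every D. *)
Definition drev v D : 'M[{poly F}]_r := \matrix_(i, j)
  if (v i + v j <= d)%N then hrevp (d - (v i + v j)) (D i j) else 0.

(** The v_i are upper bounds for the row degrees, not necessarily attained. The bound on D says that
    [D i j] has grade d - v_i - v_j; written additively, it also forces [D i j = 0] when v_i + v_j >
    d. *)
Record sym_fact v V D (P : 'M[{poly F}]_n) : Prop := SymFact {
  sf_eq : P = V^T *m D *m V;
  sf_sym : D^T = D;
  sf_V : forall i j, (size (V i j) <= (v i).+1)%N;
  sf_D : forall i j, D i j != 0 -> (size (D i j) + (v i + v j) <= d.+1)%N;
  sf_det : \det D != 0
}.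

Lemma size_sym_fact v V D P : sym_fact v V D P ->
  forall i j, (size (P i j) <= d.+1)%N.
Proof.
case=> -> _ hV hD _ i j; rewrite !mxE.
apply: size_sum_le => l _; rewrite !mxE big_distrl /=.
apply: size_sum_le => k _; rewrite mxE.
exact: size_mul3_le (hV _ _) (hV _ _) (hD _ _).
Qed.

Lemma horner_drev v D i j (x : F) : x != 0 ->
  (D i j != 0 -> (size (D i j) + (v i + v j) <= d.+1)%N) ->
  x ^+ (v i) * (drev v D i j).[x] * x ^+ (v j) = x ^+ d * (D i j).[x^-1].
Proof.
move=> x0 hD; rewrite mxE.
have [D0|Dnz] := eqVneq (D i j) 0.
  by rewrite D0 hrevp0 if_same !hornerE.
have szD : (0 < size (D i j))%N by rewrite size_poly_gt0.
have := hD Dnz => {}hD.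
have le_d : (v i + v j <= d)%N by lia.
rewrite le_d horner_hrevp //; last by lia.
rewrite mulrA -exprD mulrAC -exprD; congr (_ ^+ _ * _); lia.
Qed.

(** With X = diag(x^(v_i)), entrywise X (drev D)(x) X = x^d D(1/x); take determinants. *)
Lemma det_drev v D (x : F) : x != 0 ->
  (forall i j, D i j != 0 -> (size (D i j) + (v i + v j) <= d.+1)%N) ->
  x ^+ (2 * \sum_i v i) * (\det (drev v D)).[x]
    = x ^+ (r * d) * (\det D).[x^-1].
Proof.
move=> x0 hD; rewrite -!horner_evalE -!det_map_mx.
pose X : 'M[F]_r := diag_mx (\row_i x ^+ v i).
have detX : \det X = x ^+ (\sum_i v i).
  rewrite det_diag -prodrXr; apply: eq_bigr => i _; exact: mxE.
rewrite mulSn mul1n exprD -!detX mulrAC -!det_mulmx mulnC exprM -detZ.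
congr (\det _); apply/matrixP => i j.
rewrite mul_mx_diag mul_diag_mx !mxE.
by have := horner_drev x0 (hD i j); rewrite mxE.
Qed.

Lemma size_vrev v V i j : (size (vrev v V i j) <= (v i).+1)%N.
Proof. by rewrite mxE size_hrevp. Qed.

Lemma size_drev v D i j : drev v D i j != 0 ->
  (size (drev v D i j) + (v i + v j) <= d.+1)%N.
Proof.
rewrite mxE; case: leqP => [le_d _|_]; last by rewrite eqxx.
have := size_hrevp (d - (v i + v j)) (D i j); lia.
Qed.

Lemma det_drev_neq0 v D :
  (forall i j, D i j != 0 -> (size (D i j) + (v i + v j) <= d.+1)%N) ->
  \det D != 0 -> \det (drev v D) != 0.
Proof.
move=> hD nz; have nzX : hrevp (size (\det D)) (\det D) * 'X != 0.
  rewrite mulf_neq0 ?polyX_eq0 //; apply: contraNneq nz => e0.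
  by rewrite -[X in X == 0](@hrevpK _ (size (\det D))) // e0 hrevp0.
have /closed_nonrootP[x] := nzX.
rewrite rootM !rootE !hornerE negb_or => /andP[nz1 x0].
move: nz1; rewrite horner_hrevp // mulf_eq0 expf_eq0 (negPf x0) andbF /=.
move=> nz1; apply: contraNneq nz1 => q0.
have := det_drev x0 hD; rewrite q0 horner0 mulr0 => /esym/eqP.
by rewrite mulf_eq0 expf_eq0 (negPf x0) andbF /=.
Qed.

(** det D behaves as a binary form of degree r d - 2 sum v_i: its finite zeros number deg(det D),
    and its zeros at infinity are those of the reversed determinant at 0. *)
Lemma det_degree v D :
  (forall i j, D i j != 0 -> (size (D i j) + (v i + v j) <= d.+1)%N) ->
  \det D != 0 ->
  ((size (\det D)).-1 + mup 0 (\det (drev v D)) + 2 * \sum_i v i = r * d)%N.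
Proof.
move=> hD nz; apply: degree_mup0 => // [|x x0]; first exact: det_drev_neq0.
exact: det_drev.
Qed.

Lemma sym_fact_rev v V D P : sym_fact v V D P ->
  sym_fact v (vrev v V) (drev v D) (mprev d P).
Proof.
move=> H; have szP := size_sym_fact H; case: H => eP symD hV hD nz.
split=> [||i j|i j|]; last 1 first.
- exact: det_drev_neq0.
- apply/matrixP => i j; apply: eq_poly_nz => x x0.
  rewrite mxE -/(hrevp d (P i j)) horner_hrevp // eP !mxE !horner_sum mulr_sumr.
  apply: eq_bigr => l _; rewrite !mxE !hornerM !horner_sum.
  rewrite mulr_suml mulr_suml mulr_sumr; apply: eq_bigr => k _.
  rewrite !mxE -/(vrev _ _ _ _) !hornerM !horner_hrevp //.
  have := horner_drev x0 (@hD k l); rewrite mxE => e.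
  transitivity ((V k i).[x^-1] * (x ^+ d * (D k l).[x^-1]) * (V l j).[x^-1]).
    by rewrite mulrA [_ * x ^+ d]mulrC !mulrA.
  by rewrite -e; ring.
- apply/matrixP => i j; rewrite !mxE addnC.
  by rewrite -[in LHS]symD mxE.
- exact: size_vrev.
- exact: size_drev.
Qed.

End SymmetricFactorization.

(** * Smith form over {poly F} *)

Section Smith.
Variable F : fieldType.
Notation PM n := 'M[{poly F}]_n.

Definition smith_diag n (ps : seq {poly F}) : PM n :=
  \matrix_(i, j) (ps`_i *+ (i == j)).

Definition equivmx n (A B : PM n) :=
  exists U V : PM n, [/\ U \in unitmx, V \in unitmx & U *m A *m V = B].

Lemma equivmx_refl n (A : PM n) : equivmx A A.
Proof. by exists 1%:M, 1%:M; rewrite !unitmx1 mul1mx mulmx1. Qed.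

Lemma equivmx_mul n (A B U V : PM n) : U \in unitmx -> V \in unitmx ->
  equivmx A B -> equivmx A (U *m B *m V).
Proof.
move=> uU uV [U' [V' [uU' uV' <-]]]; exists (U *m U'), (V' *m V).
by rewrite !unitmx_mul uU uU' uV uV' !mulmxA.
Qed.

Lemma equivmx_mull n (A B U : PM n) : U \in unitmx ->
  equivmx A B -> equivmx A (U *m B).
Proof. by move=> uU /(equivmx_mul uU (unitmx1 _ _)); rewrite mulmx1. Qed.

Lemma equivmx_mulr n (A B V : PM n) : V \in unitmx ->
  equivmx A B -> equivmx A (B *m V).
Proof. by move=> uV /(equivmx_mul (unitmx1 _ _) uV); rewrite mul1mx. Qed.

Lemma unitmx_ublock n1 n2 (A : PM n1) (B : 'M[{poly F}]_(n1, n2)) (C : PM n2) :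
  A \in unitmx -> C \in unitmx -> block_mx A B 0 C \in unitmx.
Proof. by rewrite !unitmxE det_ublock unitrM => -> ->. Qed.

Lemma unitmx_lblock n1 n2 (A : PM n1) (B : 'M[{poly F}]_(n2, n1)) (C : PM n2) :
  A \in unitmx -> C \in unitmx -> block_mx A 0 B C \in unitmx.
Proof. by rewrite !unitmxE det_lblock unitrM => -> ->. Qed.

Lemma modp_opp_mul (f p : {poly F}) : p * - (f %/ p) + f = f %% p.
Proof.
by apply: (addIr (f %/ p * p)); rewrite [RHS]addrC -divp_eq; ring.
Qed.

Section Pivot.
Variables (n : nat) (A : PM (1 + n)) (p : {poly F}).
Hypothesis p0 : p != 0.
Hypothesis p_min : forall B, equivmx A B ->
  forall i j, B i j != 0 -> (size p <= size (B i j)%R)%N.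

(** A column operation replaces an entry f of the pivot row by f %% p, which is smaller than p;
    minimality of p over all equivalent matrices forces it to be 0. *)
Lemma pivot_dvd_row u w C : equivmx A (block_mx p%:M u w C) ->
  forall j, p %| u 0 j.
Proof.
move=> e j; have uV : block_mx 1%:M (- map_mx (fun f => f %/ p) u) 0 1%:M \in unitmx.
  by apply: unitmx_ublock; apply: unitmx1.
have := equivmx_mulr uV e; rewrite mulmx_block => /p_min/(_ (lshift n 0) (rshift 1 j)).
rewrite block_mxEur mulmx1 mul_scalar_mx !mxE modp_opp_mul.
by rewrite /dvdp; case: eqVneq => // _ /(_ isT); rewrite leqNgt ltn_modp p0.
Qed.

Lemma pivot_dvd_col u w C : equivmx A (block_mx p%:M u w C) ->
  forall i, p %| w i 0.
Proof.
move=> e j; have uV : block_mx 1%:M 0 (- map_mx (fun f => f %/ p) w) 1%:M \in unitmx.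
  by apply: unitmx_lblock; apply: unitmx1.
have := equivmx_mull uV e; rewrite mulmx_block => /p_min/(_ (rshift 1 j) (lshift n 0)).
rewrite block_mxEdl mul1mx mul_mx_scalar !mxE modp_opp_mul.
by rewrite /dvdp; case: eqVneq => // _ /(_ isT); rewrite leqNgt ltn_modp p0.
Qed.

Lemma pivot_clear B : equivmx A B -> B 0 0 = p ->
  exists C : PM n, equivmx A (block_mx p%:M 0 0 (p *: C)).
Proof.
move=> e Bp; move: e; rewrite -[B](@submxK _ 1 n 1 n).
have -> : ulsubmx (B : 'M_(1 + n, 1 + n)) = p%:M.
  apply/matrixP => i j; rewrite !mxE !ord1 eqxx -Bp.
  by congr (B _ _); apply: val_inj.
set u := ursubmx _; set w := dlsubmx _; set C := drsubmx _ => e; clearbody u w C.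
have hu := pivot_dvd_row e; have hw := pivot_dvd_col e.
pose q := map_mx (fun f => f %/ p) u; pose q' := map_mx (fun f => f %/ p) w.
have eu : u = p *: q.
  by apply/matrixP => i j; rewrite !mxE ord1 mulrC divpK // hu.
have ew : w = p *: q'.
  by apply/matrixP => i j; rewrite !mxE ord1 mulrC divpK // hw.
have u1 : block_mx 1%:M (- q) 0 1%:M \in unitmx.
  by apply: unitmx_ublock; apply: unitmx1.
have u2 : block_mx 1%:M 0 (- q') 1%:M \in unitmx.
  by apply: unitmx_lblock; apply: unitmx1.
have {e}e := equivmx_mul u2 u1 e; move: e.
rewrite !mulmx_block !(mul1mx, mulmx1, mul0mx, mulmx0, addr0, add0r).
rewrite mulmxN mul_scalar_mx -eu addNr mulNmx mul_mx_scalar -ew addNr.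
rewrite mul0mx add0r; set E := (X in block_mx _ _ _ X) => e; clearbody E.
(* Adding row i of E to the pivot row puts its entries beside p, where minimality already gives
   divisibility. *)
have hE i j : p %| E i j.
  have u3 : block_mx 1%:M (delta_mx 0 i : 'M_(1, n)) 0 1%:M \in @unitmx {poly F} (1 + n).
    by apply: unitmx_ublock; apply: unitmx1.
  have := equivmx_mull u3 e; rewrite mulmx_block.
  rewrite !(mul1mx, mulmx1, mul0mx, mulmx0, addr0, add0r) -rowE.
  by move/pivot_dvd_row/(_ j); rewrite mxE.
exists (map_mx (fun f => f %/ p) E).
have -> : p *: map_mx (fun f => f %/ p) E = E.
  by apply/matrixP => i j; rewrite !mxE mulrC divpK.
exact: e.
Qed.
End Pivot.

Lemma smith_form n (A : PM n) : exists ps : seq {poly F},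
  [/\ (size ps <= n)%N, all (fun p => p \is monic) ps, sorted (@dvdp F) ps
    & equivmx A (smith_diag n ps)].
Proof.
elim: n A => [|n IH] A.
  exists [::]; split=> //; suff -> : smith_diag 0 [::] = A by apply: equivmx_refl.
  by apply/matrixP => - [].
have [->|Anz] := eqVneq A 0.
  exists [::]; split=> //; suff -> : smith_diag n.+1 [::] = 0 by apply: equivmx_refl.
  by apply/matrixP => i j; rewrite !mxE nth_nil mul0rn.
pose Q s := exists B, equivmx A B /\ exists i j, B i j != 0 /\ size (B i j) = s.
have exQ : exists s, `[< Q s >].
  have /matrix0Pn[i [j Aij]] := Anz.
  by exists (size (A i j)); apply/asboolP; exists A; split; [apply: equivmx_refl|exists i, j].
have [s /asboolP[B [eAB [i0 [j0 [Bnz szB]]]]] s_min] := find_ex_minn exQ.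
pose B1 := (lead_coef (B i0 j0))^-1%:P *: xrow i0 0 (xcol j0 0 B).
pose p := (lead_coef (B i0 j0))^-1 *: B i0 j0.
have lc0 : (lead_coef (B i0 j0))^-1 != 0 by rewrite invr_eq0 lead_coef_eq0.
have p0 : p != 0 by rewrite scaler_eq0 negb_or lc0.
have pmon : p \is monic by rewrite monicE lead_coefZ mulVf -1?invr_eq0.
have B1p : B1 0 0 = p by rewrite !mxE !tpermR mul_polyC.
have eB1 : equivmx A B1.
  rewrite /B1 xrowE xcolE -mul_scalar_mx.
  have uc : (lead_coef (B i0 j0))^-1%:P%:M \in @unitmx {poly F} n.+1.
    by rewrite unitmxE det_scalar unitrX // poly_unitE size_polyC lc0 coefC unitfE lc0.
  apply: equivmx_mull => //; apply: equivmx_mull; first exact: unitmx_perm.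
  by apply: equivmx_mulr => //; apply: unitmx_perm.
have p_min B' : equivmx A B' -> forall i j, B' i j != 0 -> (size p <= size (B' i j)%R)%N.
  move=> e i j nz; rewrite size_scale // szB; apply: s_min; apply/asboolP.
  by exists B'; split=> //; exists i, j.
have [C eC] := pivot_clear p0 p_min eB1 B1p.
have [ps [szps monps sortps [U [V [uU uV eUV]]]]] := IH C.
exists (p :: [seq p * q | q <- ps]); split=> /=.
- by rewrite size_map.
- by rewrite pmon all_map; apply: sub_all monps => q qm /=; rewrite monicMr.
- case: {szps monps eUV} ps sortps => //= q ps sortps; rewrite dvdp_mulr //=.
  by apply: homo_path sortps => x y; apply: dvdp_mul.
- have u1 : block_mx (1%:M : PM 1) 0 0 U \in unitmx by apply: unitmx_ublock; rewrite ?unitmx1.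
  have u2 : block_mx (1%:M : PM 1) 0 0 V \in unitmx by apply: unitmx_ublock; rewrite ?unitmx1.
  have := equivmx_mul u1 u2 eC; rewrite !mulmx_block.
  rewrite !(mul1mx, mulmx1, mul0mx, mulmx0, addr0, add0r) -scalemxAr -scalemxAl eUV.
  set X := block_mx _ _ _ _; suff -> : X = smith_diag n.+1 (p :: [seq p * q | q <- ps]) by [].
  apply/matrixP => i j; rewrite !mxE; case: splitP => i' ei; rewrite !mxE; case: splitP => j' ej; rewrite !mxE -?val_eqE /= ei ej ?ord1 //=.
  have [szi|szi] := ltnP i' (size ps).
    by rewrite (nth_map 0) // -mulrnAr.
  by rewrite !nth_default ?size_map // !mul0rn mulr0.
Qed.
End Smith.

(** * Invariant polynomials, rank and determinants *)

Section InvariantPolynomials.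
Variable F : closedFieldType.

Definition pinj (A : nzRingType) r n : 'M[A]_(r, n) :=
  \matrix_(i, j) ((i : nat) == j)%:R.

Lemma pinj_mul_tr (A : nzRingType) r n : (r <= n)%N ->
  @pinj A r n *m (@pinj A r n)^T = 1%:M.
Proof.
move=> rn; apply/matrixP => i j; rewrite !mxE.
rewrite (bigD1 (widen_ord rn i)) //= !mxE eqxx mul1r big1 ?addr0 => [|k].
  by rewrite -val_eqE /= eq_sym.
by rewrite !mxE -val_eqE /= eq_sym => /negPf->; rewrite mul0r.
Qed.

Lemma smith_diagE n (ps : seq {poly F}) : (size ps <= n)%N ->
  smith_diag n ps = (pinj _ (size ps) n)^T *m
    diag_mx (\row_i ps`_i) *m pinj _ (size ps) n.
Proof.
move=> szn; apply/matrixP => i j; rewrite mxE [RHS]mxE.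
have [lti|gei] := ltnP i (size ps).
  rewrite (bigD1 (Ordinal lti)) //= big1 ?addr0 => [|k].
    by rewrite mul_mx_diag !mxE -val_eqE eqxx mul1r mulr_natr.
  by rewrite mul_mx_diag !mxE -val_eqE => /negPf->; rewrite !mul0r.
rewrite nth_default // mul0rn big1 // => k _.
rewrite mul_mx_diag !mxE; case: eqP => [ki|]; last by rewrite !mul0r.
by move: (ltn_ord k); rewrite ki ltnNge gei.
Qed.

(** The Smith form factors through its [size ps] nonzero diagonal entries, so every minor of that
    size of an equivalent matrix is visibly a multiple of their product, with no need for the
    Cauchy-Binet formula. *)
Lemma det_through_smith n (ps : seq {poly F}) (A : 'M[{poly F}]_(size ps, n)) B :
  (size ps <= n)%N ->
  \det (A *m smith_diag n ps *m B) =
    \det (A *m (pinj _ (size ps) n)^T) * (\prod_(p <- ps) p)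
     * \det (pinj _ (size ps) n *m B).
Proof.
move=> szn; rewrite smith_diagE // !mulmxA -mulmxA !det_mulmx det_diag.
congr (_ * _ * _); rewrite (big_nth 0) big_mkord.
by apply: eq_bigr => i _; rewrite mxE.
Qed.

Lemma det_smith_minor n (ps : seq {poly F}) : (size ps <= n)%N ->
  \det (pinj _ (size ps) n *m smith_diag n ps *m (pinj _ (size ps) n)^T)
    = \prod_(p <- ps) p.
Proof.
by move=> szn; rewrite det_through_smith // pinj_mul_tr // det1 mul1r mulr1.
Qed.

Lemma rank_smith_diag (K : fieldType) (f : {rmorphism {poly F} -> K}) n ps :
  (size ps <= n)%N -> {in ps, forall p, f p != 0} ->
  \rank (map_mx f (smith_diag n ps)) = size ps.
Proof.
move=> szn nz; apply/eqP; rewrite eqn_leq; apply/andP; split.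
  rewrite smith_diagE // !map_mxM.
  by rewrite (leq_trans (mxrankM_maxr _ _)) ?rank_leq_row.
have u : map_mx f (pinj _ (size ps) n) *m map_mx f (smith_diag n ps) *m
    map_mx f (pinj _ (size ps) n)^T \in unitmx.
  rewrite -!map_mxM unitmxE det_map_mx det_smith_minor // unitfE rmorph_prod.
  by rewrite prodf_seq_neq0; apply/allP => p /nz.
rewrite -{1}(mxrank_unit u) (leq_trans (mxrankM_maxl _ _)) //.
exact: mxrankM_maxr.
Qed.

Lemma monics_neq0 (ps : seq {poly F}) :
  all (fun p => p \is monic) ps -> {in ps, forall p, p != 0}.
Proof. by move=> /allP monps p /monps/monic_neq0. Qed.

Lemma rank_map_smith (K : fieldType) (f : {rmorphism {poly F} -> K}) n
    (P : 'M[{poly F}]_n) ps : invariant_polynomials P ps ->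
  {in ps, forall p, f p != 0} -> \rank (map_mx f P) = size ps.
Proof.
case=> szn _ _ [U [V [uU uV eP]]] nz; rewrite -(rank_smith_diag szn nz).
have uf (W : 'M_n) : W \in unitmx -> map_mx f W \in unitmx.
  by rewrite !unitmxE det_map_mx => /(rmorph_unit f).
rewrite /smith_diag -eP !map_mxM mxrankMfree ?row_free_unit ?uf //.
have fU : row_full (map_mx f U) by rewrite row_full_unit uf.
by rewrite (eqmxMfull _ fU).
Qed.

Lemma monic_prod_seq (ps : seq {poly F}) :
  all (fun p => p \is monic) ps -> \prod_(p <- ps) p \is monic.
Proof. by move/allP => h; rewrite big_seq; apply: monic_prod. Qed.

Lemma mprank_smith n (P : 'M[{poly F}]_n) ps :
  invariant_polynomials P ps -> mprank P = size ps.
Proof.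
move=> h; apply: rank_map_smith (h) _ => p pps.
by rewrite tofrac_eq0 (monics_neq0 _ pps) //; case: h.
Qed.

(** At a generic x both evaluations attain the rank, and rev P(x) = x^d P(1/x). *)
Lemma size_smith_rev n d (P : 'M[{poly F}]_n) ps qs :
  (forall i j, (size (P i j) <= d.+1)%N) ->
  invariant_polynomials P ps -> invariant_polynomials (mprev d P) qs ->
  size qs = size ps.
Proof.
move=> szP hp hq.
have pnz : \prod_(p <- ps) p != 0.
  by rewrite prodf_seq_neq0; apply/allP/monics_neq0; case: hp.
have qnz : \prod_(p <- qs) p != 0.
  by rewrite prodf_seq_neq0; apply/allP/monics_neq0; case: hq.
set p := \prod_(p <- ps) p in pnz; set q := \prod_(p <- qs) p in qnz.
have /closed_nonrootP[x] : hrevp (size p) p * q * 'X != 0.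
  rewrite !mulf_neq0 ?polyX_eq0 //; apply: contraNneq pnz => e0.
  by rewrite -[X in X == 0](@hrevpK _ (size p)) // e0 hrevp0.
rewrite !rootM !negb_or !rootE hornerX => /andP[/andP[+ q0] x0].
rewrite horner_hrevp // mulf_eq0 expf_eq0 (negPf x0) andbF /= => p0.
rewrite -(@rank_map_smith _ (horner_eval x) _ _ _ hq); last first.
  move: q0; rewrite horner_prod prodf_seq_neq0 => /allP h r /h; exact.
rewrite -(@rank_map_smith _ (horner_eval x^-1) _ _ _ hp); last first.
  move: p0; rewrite horner_prod prodf_seq_neq0 => /allP h r /h; exact.
suff -> : map_mx (horner_eval x) (mprev d P) = x ^+ d *: map_mx (horner_eval x^-1) P.
  by rewrite (eqmx_scale _ (expf_neq0 d x0)).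
by apply/matrixP => i j; rewrite !mxE /horner_eval -horner_hrevp.
Qed.

(** The product for [ps'] is a minor of a matrix equivalent to [smith_diag n ps]. Uniqueness is
    needed only for the product of the invariant polynomials: for simple eigenvalues it determines
    the elementary divisors. *)
Lemma smith_prod_dvd n (P : 'M[{poly F}]_n) ps ps' :
  invariant_polynomials P ps -> invariant_polynomials P ps' ->
  \prod_(p <- ps) p %| \prod_(p <- ps') p.
Proof.
move=> h h'; have := mprank_smith h; rewrite (mprank_smith h').
case: h h' => szn _ _ [U [V [uU uV eP]]] [szn' _ _ [U' [V' [uU' uV' eP']]]] sz.
rewrite -(det_smith_minor szn').
have -> : smith_diag n ps' = (U' *m invmx U) *m smith_diag n ps *m (invmx V *m V').
  by rewrite /smith_diag -eP -eP' !mulmxA mulmxKV // -!mulmxA mulKVmx // !mulmxA.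
move: (pinj _ _ _) => E; clear -sz szn; move: E; rewrite sz => E.
have -> : E *m (U' *m invmx U *m smith_diag n ps *m (invmx V *m V')) *m E^T
  = E *m (U' *m invmx U) *m smith_diag n ps *m (invmx V *m V' *m E^T).
  by rewrite !mulmxA.
rewrite det_through_smith // dvdp_mulr // dvdp_mull //.
Qed.

Lemma smith_prod_eq n (P : 'M[{poly F}]_n) ps ps' :
  invariant_polynomials P ps -> invariant_polynomials P ps' ->
  \prod_(p <- ps) p = \prod_(p <- ps') p.
Proof.
move=> h h'; apply/eqP; rewrite -eqp_monic.
- by rewrite /eqp (smith_prod_dvd h h') (smith_prod_dvd h' h).
- by apply: monic_prod_seq; case: h.
- by apply: monic_prod_seq; case: h'.
Qed.

(** The product is an r x r minor of U P W, which passes through D. If V has a polynomial right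
    inverse, D is itself a compression of P and the converse divisibility holds
    ([smith_prod_dvd_det]). *)
Lemma det_dvd_smith_prod n (P : 'M[{poly F}]_n) ps
    r (V : 'M[{poly F}]_(r, n)) (D : 'M[{poly F}]_r) :
  P = V^T *m D *m V -> size ps = r -> invariant_polynomials P ps ->
  \det D %| \prod_(p <- ps) p.
Proof.
move=> eP sz [szn _ _ [U [W [uU uW e]]]].
rewrite -(det_smith_minor szn) /smith_diag -e eP.
move: (pinj _ _ _) => E; move: E; rewrite sz => E.
have -> : E *m (U *m (V^T *m D *m V) *m W) *m E^T
    = (E *m U *m V^T) *m D *m (V *m W *m E^T) by rewrite !mulmxA.
by rewrite !det_mulmx dvdp_mulr // dvdp_mull.
Qed.

Lemma smith_prod_dvd_det n (P : 'M[{poly F}]_n) ps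
    r (V L : 'M[{poly F}]_(r, n)) (D : 'M[{poly F}]_r) :
  P = V^T *m D *m V -> V *m L^T = 1%:M -> size ps = r ->
  invariant_polynomials P ps -> \prod_(p <- ps) p %| \det D.
Proof.
move=> eP VL sz [szn _ _ [U [W [uU uW e]]]].
have -> : D = L *m P *m L^T.
  have LV : L *m V^T = 1%:M by rewrite -[L]trmxK -trmx_mul VL trmx1.
  by rewrite eP !mulmxA LV mul1mx -mulmxA VL mulmx1.
have -> : P = invmx U *m smith_diag n ps *m invmx W.
  by rewrite /smith_diag -e !mulmxA mulVmx // mul1mx mulmxK.
subst r.
have -> : L *m (invmx U *m smith_diag n ps *m invmx W) *m L^T =
  (L *m invmx U) *m smith_diag n ps *m (invmx W *m L^T) by rewrite !mulmxA.
by rewrite det_through_smith // dvdp_mulr // dvdp_mull.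
Qed.

End InvariantPolynomials.

(** * Elementary divisors *)

Section ElementaryDivisors.
Variable F : closedFieldType.

(** When the exponents of an eigenvalue in the invariant polynomials sum to at most 1, at most one
    of them is nonzero. This reads elementary divisors off the product; [sum_count] is the converse
    direction. *)
Lemma count_sum_le1 (T : Type) (g : T -> nat) (s : seq T) k :
  (\sum_(x <- s) g x <= 1)%N -> (0 < k)%N ->
  count (fun x => g x == k) s = (k == 1%N) && (\sum_(x <- s) g x == 1%N) :> nat.
Proof.
move=> + k0; elim: s => [|x s IH] /=; first by rewrite big_nil andbF.
rewrite big_cons => le1; have {}IH := IH (leq_trans (leq_addl _ _) le1).
rewrite IH; case: (g x) le1 => [|[|//]] le1.
  by rewrite add0n; case: k k0 {IH}.
have -> : (\sum_(x <- s) g x = 0)%N by lia.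
by rewrite !addn0 !andbF andbT addn0 eq_sym.
Qed.

Lemma sum_count (T : Type) (g : T -> nat) (s : seq T) c :
  (forall k, (0 < k)%N -> count (fun x => g x == k) s = (k == 1%N) * c)%N ->
  (\sum_(x <- s) g x = c)%N.
Proof.
elim: s c => [|x s IH] c /= h; first by have := h 1%N isT; rewrite mul1n big_nil.
rewrite big_cons; case E: (g x) => [|[|m]].
- by rewrite add0n (IH c) // => k k0; rewrite -h // E; case: k k0.
- have := h 1%N isT; rewrite E eqxx mul1n => ec.
  rewrite (IH (count (fun x => g x == 1%N) s)) // => k k0.
  have := h k k0; rewrite E eq_sym; case: eqP => [-> _|_ /=]; first by rewrite mul1n.
  by rewrite !mul0n.
- by have := h m.+2 isT; rewrite E eqxx.
Qed.

Lemma mup_prod_monic (ps : seq {poly F}) mu :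
  all (fun p => p \is monic) ps ->
  (mup mu (\prod_(p <- ps) p)%R = \sum_(p <- ps) mup mu p)%N.
Proof.
elim: ps => [_|p ps IH] /=.
  by rewrite !big_nil mupNroot // root1.
case/andP=> pm psm; rewrite !big_cons mupM ?IH // monic_neq0 //.
exact: monic_prod_seq.
Qed.

Definition simple_divisors (zs : seq F) (b : bool) : seq (option F * nat) :=
  [seq (Some z, 1%N) | z <- zs] ++ nseq b (None, 1%N).

Lemma count_simple_divisors zs b mu k : uniq zs ->
  (count_mem (Some mu, k) (simple_divisors zs b) = (k == 1) && (mu \in zs))%N.
Proof.
move=> uz; rewrite count_cat count_nseq /= mul0n addn0 count_map /=.
have [->|k1] := eqVneq k 1%N; rewrite /= -?count_uniq_mem //.
  by apply: eq_count => z /=; rewrite !xpair_eqE andbT.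
rewrite (@eq_count _ _ pred0) ?count_pred0 // => z /=.
by rewrite xpair_eqE [1%N == k]eq_sym (negPf k1) andbF.
Qed.

Lemma count_simple_divisors_oo zs b k :
  (count_mem (None, k) (simple_divisors zs b) = (k == 1) && b)%N.
Proof.
rewrite count_cat count_nseq /= count_map.
rewrite (@eq_count _ _ pred0) ?count_pred0 // add0n xpair_eqE /= eq_sym.
by case: (k == 1%N); case: b.
Qed.

Variables (n d : nat).
Implicit Types (P : 'M[{poly F}]_n) (ps qs : seq {poly F}).

Lemma simple_elementary_divisors P ps qs zs (b : bool) :
  invariant_polynomials P ps -> invariant_polynomials (mprev d P) qs ->
  uniq zs -> (forall mu, mup mu (\prod_(p <- ps) p) = (mu \in zs)) ->
  mup 0 (\prod_(q <- qs) q) = b ->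
  elementary_divisors d P (simple_divisors zs b).
Proof.
move=> hp hq uz ep eq; exists ps, qs; split=> // [mu k|k].
  rewrite count_simple_divisors //; case: posnP => [->//|k0].
  have := ep mu; rewrite mup_prod_monic; last by case: hp.
  by move=> e; rewrite (count_sum_le1 (g := mup mu)) // e ?eqb1 //; case: (_ \in _).
rewrite count_simple_divisors_oo; case: posnP => [->//|k0].
have := eq; rewrite mup_prod_monic; last by case: hq.
by move=> e; rewrite (count_sum_le1 (g := mup 0)) // e ?eqb1 //; case: (b).
Qed.

Definition simple_eds (eds : seq (option F * nat)) :=
  uniq eds && all (fun e => e.2 == 1%N) eds.

Lemma count_simple_eds eds x k : simple_eds eds ->
  (count_mem (x, k) eds = (k == 1) * ((x, 1) \in eds))%N.
Proof.
case/andP=> uz /allP h; rewrite count_uniq_mem //.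
have [->|k1] := eqVneq k 1%N; first by rewrite mul1n.
rewrite mul0n; suff -> : ((x, k) \in eds) = false by [].
by apply: contraNF k1 => /h.
Qed.

Lemma mup_simple_eds P ps qs eds : elementary_divisors d P eds ->
  simple_eds eds ->
  invariant_polynomials P ps -> invariant_polynomials (mprev d P) qs ->
  (forall mu, mup mu (\prod_(p <- ps) p) = ((Some mu, 1%N) \in eds)) /\
  mup 0 (\prod_(q <- qs) q) = ((None, 1%N) \in eds).
Proof.
case=> [ps' [qs' [hp' hq' ep eq]]] seds hp hq.
rewrite (smith_prod_eq hp hp') (smith_prod_eq hq hq'); split=> [mu|].
  rewrite mup_prod_monic; last by case: hp'.
  apply: sum_count => k k0; have := ep mu k.
  by rewrite k0 count_simple_eds // => ->.
rewrite mup_prod_monic; last by case: hq'.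
apply: sum_count => k k0; have := eq k.
by rewrite k0 count_simple_eds // => ->.
Qed.

Lemma simple_eds_unique P eds1 eds2 : simple_eds eds1 ->
  elementary_divisors d P eds1 -> elementary_divisors d P eds2 ->
  perm_eq eds1 eds2.
Proof.
move=> s1 h1 [ps [qs [hp hq ep eq]]].
have [mp mq] := mup_simple_eds h1 s1 hp hq.
have hpm : all (fun p => p \is monic) ps by case: hp.
have hqm : all (fun p => p \is monic) qs by case: hq.
rewrite mup_prod_monic // in mq.
apply/allP => -[[mu|] k] _ /=; rewrite count_simple_eds //.
  rewrite ep; case: posnP => [->//|k0].
  have := mp mu; rewrite mup_prod_monic // => e.
  rewrite (count_sum_le1 (g := mup mu)) // e; last by case: (_ \in _).
  by rewrite eqb1; case: (k == 1%N); case: (_ \in _).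
rewrite eq; case: posnP => [->//|k0].
rewrite (count_sum_le1 (g := mup 0)) // mq; last by case: (_ \in _).
by rewrite eqb1; case: (k == 1%N); case: (_ \in _).
Qed.

End ElementaryDivisors.

(** * Minimal bases *)

Section MinimalBases.
Variable F : closedFieldType.
Notation K := {fraction {poly F}}.

Lemma fracP (x : K) : exists a b : {poly F},
  b != 0 /\ tofrac b * x = tofrac a.
Proof.
elim/quotW: x => x; exists (\n_x)%R, (\d_x)%R; split; first exact: denom_ratioP.
unlock tofrac; rewrite -[LHS]FracField.pi_mul /FracField.mulf.
rewrite !numden_Ratio ?oner_neq0 ?denom_ratioP // mul1r.
apply/eqmodP; rewrite /= FracField.equivfE !numden_Ratio ?oner_neq0 ?denom_ratioP //.
by rewrite mulr1 mulrC.

Qed.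

Lemma clear_denominators m n (A : 'M[K]_(m, n)) :
  exists (q : {poly F}) (N : 'M[{poly F}]_(m, n)),
    q != 0 /\ tofrac q *: A = mpfrac N.
Proof.
have /fin_all_exists[b hb] : forall ij : 'I_m * 'I_n, exists b : {poly F},
    exists a, b != 0 /\ tofrac b * A ij.1 ij.2 = tofrac a.
  by move=> [i j]; have [a [b h]] := fracP (A i j); exists b, a.
have {hb}/fin_all_exists[a hab] := hb.
exists (\prod_ij b ij), (\matrix_(i, j) (a (i, j) * \prod_(ij | ij != (i, j)) b ij)).
split; first by apply/prodf_neq0 => ij _; case: (hab ij).
apply/matrixP => i j; rewrite !mxE (bigD1 (i, j)) //= !rmorphM /= mulrAC.
by case: (hab (i, j)) => _ ->.
Qed.

Definition poly_basis n m k (A : 'M[K]_(m, n)) (B : 'M[{poly F}]_(k, n)) : Prop :=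
  row_free (mpfrac B) /\ (mpfrac B :=: A)%MS.

(** Relative to an arbitrary row space A, so as to serve both the left null space of P, where it is
    [left_minimal_basis], and the row space of P. *)
Definition min_basis n m k (A : 'M[K]_(m, n)) (B : 'M[{poly F}]_(k, n)) : Prop :=
  poly_basis A B /\
  forall B' : 'M[{poly F}]_(k, n), poly_basis A B' ->
    (\sum_(i < k) row_degree B i <= \sum_(i < k) row_degree B' i)%N.

Lemma row_degree_le k n (B : 'M[{poly F}]_(k, n)) i t :
  (row_degree B i <= t)%N = [forall j, size (B i j) <= t.+1]%N.
Proof.
apply/bigmax_leqP/forallP => h j; first by have := h j isT; lia.
by move=> _; have := h j; lia.
Qed.

Lemma size_row_degree k n (B : 'M[{poly F}]_(k, n)) i j :
  (size (B i j) <= (row_degree B i).+1)%N.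
Proof. by have := leqnn (row_degree B i); rewrite row_degree_le => /forallP. Qed.

Lemma poly_basis_rank n m k (A : 'M[K]_(m, n)) (B : 'M[{poly F}]_(k, n)) :
  poly_basis A B -> k = \rank A.
Proof. by case=> /eqP rB eB; rewrite -eB rB. Qed.

Lemma min_basis_exists n m (A : 'M[K]_(m, n)) :
  exists B : 'M[{poly F}]_(\rank A, n), min_basis A B.
Proof.
pose Q s := exists B : 'M[{poly F}]_(\rank A, n), poly_basis A B /\
  (\sum_i row_degree B i)%N = s.
have exQ : exists s, `[< Q s >].
  have [q [N [q0 eN]]] := clear_denominators (row_base A).
  exists (\sum_i row_degree N i)%N; apply/asboolP; exists N; split=> //.
  have q0' : tofrac q != 0 :> K by rewrite tofrac_eq0.
  split; rewrite -eN; last exact: eqmx_trans (eqmx_scale _ q0') (eq_row_base A).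
  by rewrite -row_leq_rank (eqmx_scale _ q0') row_leq_rank row_base_free.
have [s /asboolP[B [bB <-]] s_min] := find_ex_minn exQ.
exists B; split=> // B' bB'; apply: s_min; apply/asboolP; by exists B'.
Qed.

(** A polynomial vector y in the space with nonzero coefficient on row i can replace that row;
    minimality of the total degree then forces deg y to be at least the degree of row i. The
    properties of minimal bases below all rest on this. *)
Lemma exchange n m k (A : 'M[K]_(m, n)) (B : 'M[{poly F}]_(k, n))
    (y : 'rV[{poly F}]_n) (c : 'rV[K]_k) i :
  min_basis A B -> mpfrac y = c *m mpfrac B -> c 0 i != 0 ->
  exists j, (row_degree B i < size (y 0 j)%R)%N.
Proof.
move=> [[fB eB] mB] ey ci; apply/existsP; apply: contraT => /existsPn ylt.
pose B' : 'M[{poly F}]_(k, n) := \matrix_(i', j) if i' == i then y 0 j else B i' j.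
have rB' i' : row i' (mpfrac B') = if i' == i then mpfrac y else row i' (mpfrac B).
  by case: eqP => e; apply/rowP => j; rewrite !mxE ?(introT eqP e) ?(introF eqP e).
have y0 : mpfrac y != 0.
  apply: contra_neq ci => y0; have := ey; rewrite y0 => /esym/eqP.
  by rewrite mulmx_free_eq0 // => /eqP ->; rewrite mxE.
have le1 : (mpfrac B' <= mpfrac B)%MS.
  apply/row_subP => i'; rewrite rB'; case: eqP => _; last exact: row_sub.
  by rewrite ey submxMl.
have le2 : (mpfrac B <= mpfrac B')%MS.
  have rsub i' : i' != i -> (row i' (mpfrac B) <= mpfrac B')%MS.
    by move=> /negPf ne; have := row_sub i' (mpfrac B'); rewrite rB' ne.
  apply/row_subP => i'; have [->|] := eqVneq i' i; last exact: rsub.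
  have -> : row i (mpfrac B) = (c 0 i)^-1 *: (mpfrac y - \sum_(i' | i' != i) c 0 i' *: row i' (mpfrac B)).
    rewrite ey mulmx_sum_row (bigD1 i) //= addrK scalerA mulVf // scale1r //.
  apply: scalemx_sub; apply: addmx_sub.
    by have := row_sub i (mpfrac B'); rewrite rB' eqxx.
  rewrite eqmx_opp; apply: summx_sub => i'' /rsub; exact: scalemx_sub.
have eB' : (mpfrac B' :=: mpfrac B)%MS by apply/eqmxP; rewrite le1.
have : poly_basis A B'.
  split; last exact: eqmx_trans eB' eB.
  by rewrite -row_leq_rank eB' row_leq_rank.
move/mB; rewrite leqNgt => /negP[].
have szy j : (size (y 0 j)%R <= row_degree B i)%N by rewrite leqNgt ylt.
have di : (row_degree B' i < row_degree B i)%N.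
  have [j yj] : exists j, y 0 j != 0.
    by have /rV0Pn[j] := y0; rewrite mxE tofrac_eq0; exists j.
  have := szy j; have : (0 < size (y 0 j)%R)%N by rewrite size_poly_gt0.
  case E : (row_degree B i) => [|t]; first by lia.
  move=> _ _; rewrite ltnS row_degree_le; apply/forallP => j'.
  by rewrite mxE eqxx -E szy.
rewrite (bigD1 i) //= [X in (_ < X)%N](bigD1 i) //= -addSn leq_add //.
apply: leq_sum => i' /negPf ne; rewrite row_degree_le; apply/forallP => j.
by rewrite mxE ne size_row_degree.
Qed.

Lemma row_free_rowsub (L : fieldType) m k n (g : 'I_m -> 'I_k) (A : 'M[L]_(k, n)) :
  injective g -> row_free A -> row_free (rowsub g A).
Proof.
move=> inj_g fA; rewrite rowsubE.
have fg : row_free (rowsub g (1%:M : 'M[L]_k)).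
  apply/row_freeP; exists (rowsub g 1%:M)^T.
  apply/matrixP => i j; rewrite !mxE (bigD1 (g i)) //= !mxE eqxx mul1r.
  rewrite (inj_eq inj_g) eq_sym big1 ?addr0 // => l ne.
  by rewrite !mxE eq_sym (negPf ne) mul0r.
by rewrite /row_free mxrankMfree.
Qed.

(* Any basis vector of degree <= t is, by exchange, a combination of those    *)
(* minimal basis vectors that have degree <= t.                               *)
Lemma count_degrees_le n m k k' (A : 'M[K]_(m, n)) (B : 'M[{poly F}]_(k, n))
    (B' : 'M[{poly F}]_(k', n)) t : min_basis A B ->
  row_free (mpfrac B') -> (mpfrac B' <= A)%MS ->
  (#|[pred i | row_degree B' i <= t]| <= #|[pred i | row_degree B i <= t]|)%N.
Proof.
move=> mB fB' sB'.
pose I' := [pred i | row_degree B' i <= t]%N; pose I := [pred i | row_degree B i <= t]%N.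
pose g' : 'I_#|I'| -> 'I_k' := enum_val; pose g : 'I_#|I| -> 'I_k := enum_val.
have /eqP <- : row_free (rowsub g' (mpfrac B')).
  by apply: row_free_rowsub fB'; apply: enum_val_inj.
suff : (rowsub g' (mpfrac B') <= rowsub g (mpfrac B))%MS.
  by move=> /mxrankS h; rewrite (leq_trans h) ?rank_leq_row.
apply/row_subP => u; rewrite row_rowsub.
have degu : (row_degree B' (g' u) <= t)%N := enum_valP u.
have [[_ eB] _] := mB.
have /submxP[c ec] : (row (g' u) (mpfrac B') <= mpfrac B)%MS.
  by rewrite eB (submx_trans (row_sub _ _)).
have c0 i : i \notin I -> c 0 i = 0.
  move=> iI; apply/eqP; apply: contraNT iI => ci; rewrite inE.
  have [|j] := @exchange _ _ _ A B (row (g' u) B') c i mB _ ci.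
    by rewrite -ec; apply/rowP => j; rewrite !mxE.
  rewrite mxE => lt; rewrite -ltnS (leq_trans lt) //.
  by rewrite (leq_trans (size_row_degree _ _ _)).
rewrite ec mulmx_sum_row (bigID (mem I)) /= [X in _ + X]big1 ?addr0; last first.
  by move=> i /c0->; rewrite scale0r.
apply: summx_sub => i iI; apply: scalemx_sub.
have -> : row i (mpfrac B) = row (enum_rank_in iI i) (rowsub g (mpfrac B)).
  by rewrite row_rowsub /g enum_rankK_in.
exact: row_sub.
Qed.

Lemma perm_eq_count_le (s1 s2 : seq nat) :
  (forall t, count (fun x => x <= t)%N s1 = count (fun x => x <= t)%N s2) ->
  perm_eq s1 s2.
Proof.
move=> h; apply/allP => t _ /=; apply/eqP.
have cnt s : count (fun x => x <= t)%N s = (count (fun x => x < t)%N s + count_mem t s)%N.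
  elim: s => //= x s ->; case: ltngtP => //=; lia.
have e : count (fun x => x < t)%N s1 = count (fun x => x < t)%N s2.
  by case: t {cnt} => [|t]; [rewrite !(eq_count (a2 := pred0)) ?count_pred0|apply: h].
by have := h t; rewrite !cnt e => /addnI.
Qed.

Lemma count_codom (k : nat) (g : 'I_k -> nat) (a : pred nat) :
  count a [seq g i | i : 'I_k] = #|[pred i | a (g i)]|.
Proof. by rewrite -sum1_count big_map big_enum_cond -sum1_card; apply: eq_bigl => i; rewrite inE. Qed.

Lemma left_minimal_indices_unique n (P : 'M[{poly F}]_n) s1 s2 :
  left_minimal_indices P s1 -> left_minimal_indices P s2 -> perm_eq s1 s2.
Proof.
move=> [k1 [B1 [m1 e1]]] [k2 [B2 [m2 e2]]].
rewrite (perm_trans e1) // perm_sym (perm_trans e2) // perm_sym.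
apply: perm_eq_count_le => t; rewrite !count_codom; apply/eqP; rewrite eqn_leq.
have [[f1 sB1] _] := m1; have [[f2 sB2] _] := m2.
by rewrite (count_degrees_le _ m2) ?(count_degrees_le _ m1) // ?sB1 ?sB2.
Qed.

(** If a constant combination of the rows vanishes at x0, dividing it by X - x0 gives a vector of
    degree below the largest degree involved, against [exchange] for a row of that largest
    degree. *)
Lemma min_basis_eval n m k (A : 'M[K]_(m, n)) (B : 'M[{poly F}]_(k, n)) x0 :
  min_basis A B -> row_free (map_mx (horner_eval x0) B).
Proof.
move=> mB; rewrite -kermx_eq0; apply: contraT => /rowV0Pn[g /sub_kermxP gB g0].
have /rV0Pn[i1 gi1] := g0.
have [i gi imax] := @arg_maxnP _ i1 (fun i => g 0 i != 0) (row_degree B) gi1.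
pose x := map_mx polyC g *m B.
have dvdx j : 'X - x0%:P %| x 0 j.
  rewrite dvdp_XsubCl rootE !mxE horner_sum.
  move/rowP/(_ j): gB; rewrite !mxE => e; rewrite -[X in _ == X]e.
  by apply/eqP; apply: eq_bigr => l _; rewrite !mxE hornerM hornerC.
pose y := map_mx (fun p => p %/ ('X - x0%:P)) x.
have exy : x = ('X - x0%:P) *: y.
  by apply/rowP => j; rewrite [RHS]mxE [y 0 j]mxE mulrC divpK.
have X0 : tofrac ('X - x0%:P) != 0 :> K by rewrite tofrac_eq0 polyXsubC_eq0.
pose c := (tofrac ('X - x0%:P))^-1 *: map_mx (@tofrac _) (map_mx polyC g) : 'rV[K]_k.
have [||j] := @exchange _ _ _ A B y c i mB.
- rewrite /c -scalemxAl -map_mxM -/x exy map_mxZ scalerA mulVf // scale1r //.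
- rewrite mxE mulf_eq0 invr_eq0 (negPf X0) 2!mxE.
  by rewrite tofrac_eq0 polyC_eq0.
apply: contraTT => _; rewrite -leqNgt.
have szx : (size (x 0 j)%R <= (row_degree B i).+1)%N.
  rewrite mxE; apply: size_sum_le => l _; rewrite mxE.
  have [->|gl] := eqVneq (g 0 l) 0; first by rewrite mul0r size_poly0.
  by rewrite size_Cmul // (leq_trans (size_row_degree _ _ _)) // ltnS; apply: imax.
have [->|ynz] := eqVneq (y 0 j) 0; first by rewrite size_poly0.
by move: szx; rewrite exy mxE mulrC size_Mmonic ?monicXsubC // size_XsubC addn2.
Qed.

Definition lead_rows k n (B : 'M[{poly F}]_(k, n)) : 'M[F]_(k, n) :=
  \matrix_(i, j) (B i j)`_(row_degree B i).

(** A relation among leading rows, homogenized by powers of X, cancels the top coefficient and again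
    contradicts [exchange] at a row of largest degree. *)
Lemma min_basis_lead n m k (A : 'M[K]_(m, n)) (B : 'M[{poly F}]_(k, n)) :
  min_basis A B -> row_free (lead_rows B).
Proof.
move=> mB; rewrite -kermx_eq0; apply: contraT => /rowV0Pn[g /sub_kermxP gB g0].
have /rV0Pn[i1 gi1] := g0.
have [i gi imax] := @arg_maxnP _ i1 (fun i => g 0 i != 0) (row_degree B) gi1.
pose c : 'rV[{poly F}]_k := \row_l ((g 0 l)%:P * 'X^(row_degree B i - row_degree B l)).
have [||j] := @exchange _ _ _ A B (c *m B) (mpfrac c) i mB.
- by rewrite /mpfrac map_mxM.
- rewrite 2!mxE tofrac_eq0 mulf_neq0 ?polyC_eq0 //.
  by rewrite expf_neq0 ?polyX_eq0.
apply: contraTT => _; rewrite -leqNgt; apply/leq_sizeP => t.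
rewrite mxE coef_sum leq_eqVlt => /orP[/eqP <-|lt].
  move/rowP/(_ j): gB; rewrite !mxE => e; rewrite -[RHS]e.
  apply: eq_bigr => l _; rewrite !mxE -mulrA coefCM.
  have [->|gl] := eqVneq (g 0 l) 0; first by rewrite !mul0r.
  by rewrite coefXnM ltnNge leq_subr subKn //; apply: imax.
apply: big1 => l _; rewrite !mxE -mulrA coefCM.
have [->|gl] := eqVneq (g 0 l) 0; first by rewrite !mul0r.
rewrite coefXnM; case: ifP => _; rewrite ?mulr0 // nth_default ?mulr0 //.
rewrite (leq_trans (size_row_degree _ _ _)) //; have := imax l gl; lia.
Qed.

End MinimalBases.

(** * Existence of symmetric factorizations *)

Section Factorization.
Variable F : closedFieldType.
Notation K := {fraction {poly F}}.

Lemma mpfrac_inj m n : injective (@mpfrac F m n).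
Proof.
move=> A B e; apply/matrixP => i j; apply/eqP; rewrite -tofrac_eq.
by move/matrixP/(_ i j): e; rewrite !mxE => ->.
Qed.

Lemma congr_inj (L : fieldType) k n (V : 'M[L]_(k, n)) (D D' : 'M[L]_k) :
  row_free V -> V^T *m D *m V = V^T *m D' *m V -> D = D'.
Proof.
move=> /row_freeP[W VW] e.
have WV : W^T *m V^T = 1%:M by rewrite -trmx_mul VW trmx1.
move/(congr1 (fun M => W^T *m M *m W)): e.
by rewrite !mulmxA WV !mul1mx -!mulmxA VW !mulmx1.
Qed.

(** The denominator q is removed one root at a time: at a root x, V(x)^T N(x) V(x) = 0, and full row
    rank of V(x) forces N(x) = 0. *)
Lemma congr_divide n k (P : 'M[{poly F}]_n) (V : 'M[{poly F}]_(k, n)) q N :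
  (forall x, row_free (map_mx (horner_eval x) V)) -> q != 0 ->
  q *: P = V^T *m N *m V -> exists D, P = V^T *m D *m V.
Proof.
move=> fV; have [s] := ubnP (size q); elim: s q N => // s IH q N lts q0 e.
have [/eqP/size_poly1P[c c0 eq]|/closed_rootP[x qx]] := eqVneq (size q) 1%N.
  exists (c^-1%:P *: N); rewrite -scalemxAr -scalemxAl -e eq scalerA -polyCM.
  by rewrite mulVf // scale1r.
have Nx : map_mx (horner_eval x) N = 0.
  apply: (congr_inj (fV x)); rewrite mulmx0 mul0mx map_trmx -!map_mxM -e.
  by apply/matrixP => i j; rewrite !mxE /= /horner_eval hornerM (rootP qx) mul0r.
have eN : N = ('X - x%:P) *: map_mx (fun p => p %/ ('X - x%:P)) N.
  apply/matrixP => i j; rewrite !mxE mulrC divpK // dvdp_XsubCl rootE.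
  by move/matrixP/(_ i j): Nx; rewrite !mxE /horner_eval => ->.
have eq : q = (q %/ ('X - x%:P)) * ('X - x%:P) by rewrite divpK // dvdp_XsubCl.
have q'0 : q %/ ('X - x%:P) != 0 by apply: contraNneq q0 => e0; rewrite eq e0 mul0r.
apply: (IH (q %/ ('X - x%:P)) (map_mx (fun p => p %/ ('X - x%:P)) N)) => //.
  move: lts; rewrite {1}eq size_Mmonic ?monicXsubC // size_XsubC; lia.
have X0 : 'X - x%:P != 0 :> {poly F} by rewrite polyXsubC_eq0.
move: e; rewrite {1}eq mulrC -scalerA {1}eN -scalemxAr -scalemxAl.
move/matrixP => e; apply/matrixP => i j; apply: (mulfI X0).
by have := e i j; rewrite [LHS]mxE [RHS]mxE.
Qed.

Lemma coef_mul_top (p q : {poly F}) a b :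
  (size p <= a.+1)%N -> (size q <= b.+1)%N -> (p * q)`_(a + b) = p`_a * q`_b.
Proof.
move=> hp hq; rewrite coefM.
have lta : (a < (a + b).+1)%N by rewrite ltnS leq_addr.
rewrite (bigD1 (Ordinal lta)) //= addKn big1 ?addr0 // => i.
rewrite -val_eqE /= neq_ltn => /orP[lt|lt].
  by rewrite [q`__]nth_default ?mulr0 // (leq_trans hq) //; lia.
by rewrite nth_default ?mul0r // (leq_trans hp).
Qed.

(** A two-sided form of the predictable degree property: since the leading rows of V are
    independent, the top-degree part of V^T D V cannot cancel. *)
Lemma congr_degree_bound n k d (P : 'M[{poly F}]_n) (V : 'M[{poly F}]_(k, n))
    (D : 'M[{poly F}]_k) :
  row_free (lead_rows V) -> (forall i j, (size (P i j) <= d.+1)%N) ->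
  P = V^T *m D *m V -> forall i j, D i j != 0 ->
  (size (D i j) + (row_degree V i + row_degree V j) <= d.+1)%N.
Proof.
move=> fV szP eP i1 j1 D1.
pose g (ij : 'I_k * 'I_k) :=
  (size (D ij.1 ij.2) + (row_degree V ij.1 + row_degree V ij.2))%N.
have [[i j] /= Dij gmax] :=
  @arg_maxnP _ (i1, j1) (fun ij => D ij.1 ij.2 != 0) g D1.
have le_g : (g (i1, j1) <= g (i, j))%N by apply: gmax.
rewrite (leq_trans le_g) // leqNgt; apply/negP => gt_d.
(* [g] counts sizes, so t is the largest expected degree v_i + deg D_ij + v_j; the coefficient of P
   at X^t is L^T N L with L the leading rows. *)
pose t := (g (i, j)).-1.
pose v i := row_degree V i.
have le_t a b : D a b != 0 -> (size (D a b) + (v a + v b) <= t.+1)%N.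
  by move=> Dab; apply: leq_trans (leqSpred _); apply: (gmax (a, b)).
pose N : 'M[F]_k := \matrix_(a, b)
  if (v a + v b <= t)%N then (D a b)`_(t - (v a + v b)) else 0.
have : (lead_rows V)^T *m N *m lead_rows V = (lead_rows V)^T *m 0 *m lead_rows V.
  rewrite mulmx0 mul0mx; apply/matrixP => a b; rewrite [RHS]mxE.
  have ltt : (d.+1 <= t)%N by rewrite /t -ltnS prednK // (leq_trans _ gt_d).
  have : (P a b)`_t = 0 by rewrite nth_default // (leq_trans (szP a b)).
  rewrite eP !mxE coef_sum => eP0; rewrite -[RHS]eP0; apply: eq_bigr => l _.
  rewrite !mxE !big_distrl /= coef_sum; apply: eq_bigr => m _; rewrite !mxE.
  have szV := size_row_degree V.
  have [->|Dml] := eqVneq (D m l) 0.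
    by rewrite coef0 if_same !(mulr0, mul0r) coef0.
  have := le_t _ _ Dml; have : (0 < size (D m l))%N by rewrite size_poly_gt0.
  rewrite /v => sz1 sz2; have le_vt : (row_degree V m + row_degree V l <= t)%N by lia.
  rewrite le_vt.
  have et : t = (row_degree V m + (t - (row_degree V m + row_degree V l)) + row_degree V l)%N by lia.
  rewrite [in RHS]et.
  rewrite coef_mul_top ?coef_mul_top //; first by lia.
  rewrite (leq_trans (size_polyMleq _ _)) //.
  by have := szV m a; lia.
move/(congr_inj fV)/matrixP/(_ i j); rewrite !mxE.
have := le_t _ _ Dij; have : (0 < size (D i j))%N by rewrite size_poly_gt0.
move=> sz1 sz2; have -> : (v i + v j <= t)%N by lia.
have -> : (t - (v i + v j))%N = (size (D i j)).-1 by rewrite /t /g /= /v; lia.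
by move/eqP; rewrite -lead_coefE lead_coef_eq0 (negPf Dij).
Qed.

(** Here V is a minimal basis of the row space of P, not of its null space. Over F(x), D is W^T P W
    for a right inverse W of V; being polynomial and of bounded degree comes from the two preceding
    lemmas. *)
Lemma min_basis_sym_fact n d k (P : 'M[{poly F}]_n) (V : 'M[{poly F}]_(k, n)) :
  P^T = P -> (forall i j, (size (P i j) <= d.+1)%N) -> min_basis (mpfrac P) V ->
  exists D, sym_fact d (row_degree V) V D P.
Proof.
move=> symP szP mV; have [bV _] := mV; have rk := poly_basis_rank bV.
have [fV eV] := bV.

have /submxP[A eA] : (mpfrac P <= mpfrac V)%MS by rewrite eV.
have /row_freeP[W VW] := fV.
have symPf : (mpfrac P)^T = mpfrac P by rewrite /mpfrac map_trmx symP.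
have e1 : mpfrac P *m W *m mpfrac V = mpfrac P.
  by rewrite {1}eA -(mulmxA A) VW mulmx1 -eA.
have e2 : (mpfrac V)^T *m W^T *m mpfrac P = mpfrac P.
  by rewrite -{1}symPf -!trmx_mul mulmxA e1 symPf.
pose DK := W^T *m mpfrac P *m W.
have eDK : (mpfrac V)^T *m DK *m mpfrac V = mpfrac P.
  by rewrite /DK -!mulmxA (mulmxA (mpfrac P)) e1 mulmxA e2.
have [q [N [q0 eN]]] := clear_denominators DK.
have eqP : q *: P = V^T *m N *m V.
  apply: (@mpfrac_inj n n); rewrite /mpfrac map_mxZ !map_mxM -map_trmx.
  by rewrite -/(mpfrac N) -eN -scalemxAr -scalemxAl eDK.
have [D eD] := congr_divide (fun x => min_basis_eval x mV) q0 eqP.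
exists D; split=> //.
- apply: (@mpfrac_inj _ _); apply: (congr_inj fV).
  rewrite /mpfrac map_trmx -!map_mxM -eD -[in RHS]symP eD !trmx_mul trmxK mulmxA.
  by [].
- exact: size_row_degree.
- exact: congr_degree_bound (min_basis_lead mV) szP eD.
- have : (k <= \rank (mpfrac D))%N.
    rewrite [X in (X <= _)%N]rk eD /mpfrac !map_mxM.
    by rewrite (leq_trans (mxrankM_maxl _ _)) // mxrankM_maxr.
  rewrite row_leq_rank row_free_unit unitmxE.
  by rewrite /mpfrac det_map_mx unitfE tofrac_eq0.
Qed.

Theorem sym_fact_exists n d (P : 'M[{poly F}]_n) :
  P^T = P -> (forall i j, (size (P i j) <= d.+1)%N) ->
  exists (V : 'M[{poly F}]_(mprank P, n)) D,
    sym_fact d (row_degree V) V D P.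
Proof.
move=> symP szP; have [V mV] := min_basis_exists (mpfrac P).
by exists V; apply: min_basis_sym_fact.
Qed.

End Factorization.

(** * Squarefree discriminants *)

Notation cmx A := (map_mx polyC A).

Section Improvement.
Variable F : closedFieldType.


(** Exactly what is needed for the form D to stay polynomial when a basis vector is replaced by c /
    (X - x0). *)
Definition isotropic_at k (D : 'M[{poly F}]_k) x0 (c : 'rV[F]_k) : Prop :=
  [/\ c != 0, forall j, 'X - x0%:P %| ((cmx c) *m D) 0 j
    & ('X - x0%:P) ^+ 2 %| ((cmx c) *m D *m ((cmx c))^T) 0 0].

Lemma dvd_eval_mx m k (A : 'M[{poly F}]_(m, k)) x0 :
  (forall i j, 'X - x0%:P %| A i j) <-> map_mx (horner_eval x0) A = 0.
Proof.
split=> [h|h i j]; last first.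
  by rewrite dvdp_XsubCl rootE; move/matrixP/(_ i j): h; rewrite !mxE => <-.
apply/matrixP => i j; rewrite !mxE; apply/eqP.
by have := h i j; rewrite dvdp_XsubCl.
Qed.

Lemma eval_polyC_mx m k (A : 'M[F]_(m, k)) x0 : map_mx (horner_eval x0) (cmx A) = A.
Proof. by apply/matrixP => i j; rewrite !mxE /horner_eval hornerC. Qed.

Lemma isotropic_congr k (D : 'M[{poly F}]_k) x0 (T S : 'M[F]_k) g :
  T *m S = 1%:M -> isotropic_at ((cmx T) *m D *m ((cmx T))^T) x0 g ->
  isotropic_at D x0 (g *m T).
Proof.
move=> TS [g0 gG gGg]; split.
- by apply: contraNneq g0 => e; rewrite -[g]mulmx1 -TS mulmxA e mul0mx.
- suff h : forall (i : 'I_1) j, 'X - x0%:P %| ((cmx (g *m T)) *m D) i j by move=> j; apply: h.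
  apply/dvd_eval_mx.
  have /dvd_eval_mx : forall (i : 'I_1) j, 'X - x0%:P %| ((cmx g) *m ((cmx T) *m D *m ((cmx T))^T)) i j.
    by move=> i j; rewrite ord1.
  rewrite !mulmxA map_mxM -map_trmx eval_polyC_mx => e.
  have := congr1 (mulmx^~ S^T) e; rewrite /= mul0mx.
  rewrite -(mulmxA _ T^T) -trmx_mul.
  by rewrite (mulmx1C TS) trmx1 mulmx1 [cmx (g *m T)]map_mxM.
- by move: gGg; rewrite [cmx (g *m T)]map_mxM trmx_mul !mulmxA.
Qed.

Section Shear.
Variables (k : nat) (c : 'rV[F]_k) (i0 : 'I_k).
Hypothesis c1 : c 0 i0 = 1.

(* [shear 1] is the identity with row i0 replaced by c; its inverse is [shear (-1)]. *)
Definition shear (b : F) : 'M[F]_k := 1%:M + b *: (delta_mx i0 0 *m (c - delta_mx 0 i0)).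

Lemma shear_inv b : shear b *m shear (- b) = 1%:M.
Proof.
rewrite /shear; set w := c - _; set E := delta_mx _ _ *m _.
have EE : E *m E = 0.
  rewrite /E mulmxA -[delta_mx i0 0 *m w *m _]mulmxA.
  suff -> : w *m delta_mx i0 0 = 0 :> 'M_1 by rewrite mulmx0 mul0mx.
  rewrite -colE; apply/matrixP => i j; rewrite !mxE !ord1 c1 !eqxx subrr //.
rewrite mulmxDl mul1mx mulmxDr mulmx1 -scalemxAl -scalemxAr EE !scaler0 addr0.
by rewrite scaleNr addrNK.
Qed.

Lemma shearE b i j :
  shear b i j = (i == j)%:R + b * (i == i0)%:R * (c 0 j - (j == i0)%:R).
Proof. by rewrite !mxE big_ord1 !mxE andbT eqxx /= mulrA. Qed.

End Shear.

Lemma isotropic_exists k (D : 'M[{poly F}]_k) x0 :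
  D^T = D -> ('X - x0%:P) ^+ 2 %| \det D -> exists c, isotropic_at D x0 c.
Proof.
move=> symD dvd2; pose pi := 'X - x0%:P.
have : \det (map_mx (horner_eval x0) D) == 0.
  rewrite det_map_mx -[_ == 0]/(root _ x0) -dvdp_XsubCl (dvdp_trans _ dvd2) //.
  exact: dvdp_exp.
case/det0P => c0 c0nz c0D; have /rV0Pn[i0 ci0] := c0nz.
pose c := (c0 0 i0)^-1 *: c0.
have c1 : c 0 i0 = 1 by rewrite mxE mulVf.
have cD : c *m map_mx (horner_eval x0) D = 0 by rewrite -scalemxAl c0D scaler0.
have TS := shear_inv c1 1; set T := shear c i0 1 in TS.
have [G eG] : exists G, G = cmx T *m D *m (cmx T)^T by eexists.
have symG : G^T = G by rewrite eG !trmx_mul trmxK symD mulmxA.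
pose G0 := map_mx (horner_eval x0) G.
have G0E : G0 = T *m map_mx (horner_eval x0) D *m T^T.
  by rewrite /G0 eG !map_mxM -map_trmx eval_polyC_mx.
have rowT : row i0 T = c.
  by apply/rowP => j; rewrite mxE shearE eqxx mulr1 mul1r eq_sym addrCA subrr addr0.
have rowG0 : row i0 G0 = 0 by rewrite G0E !row_mul rowT cD mul0mx.
have G0i j : G0 i0 j = 0 by move/rowP/(_ j): rowG0; rewrite !mxE.
have symG0 : G0^T = G0 by rewrite /G0 map_trmx symG.
have G0j j : G0 j i0 = 0 by rewrite -symG0 mxE.
have dG j : pi %| G i0 j by rewrite dvdp_XsubCl; apply/eqP; have := G0i j; rewrite mxE.
suff [g hg] : exists g, isotropic_at G x0 g.
  by exists (g *m T); apply: isotropic_congr TS _; rewrite -eG.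
have row_e0 : (cmx (delta_mx 0 i0)) *m G = row i0 G.
  rewrite rowE; congr (_ *m _); apply/matrixP => i j; rewrite !mxE; by case: andP.
(* In the new basis e_i0 spans a line in the kernel of G0. If the complementary minor is nonzero at
   x0, expansion of det G along row i0 gives G_i0i0 times a unit modulo (X - x0)^2, so e_i0 itself
   is isotropic. *)
have [cof0|cof_nz] := eqVneq (\det (row' i0 (col' i0 G0))) 0; last first.
  exists (delta_mx 0 i0); split.
  - by apply/rV0Pn; exists i0; rewrite mxE !eqxx oner_eq0.
  - by move=> j; rewrite row_e0 mxE.
  rewrite row_e0.
  have -> : (row i0 G *m ((cmx ((delta_mx 0 i0 : 'rV[F]_k))))^T) 0 0 = G i0 i0.
    rewrite mxE (bigD1 i0) //= big1 => [|j ne].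
      by rewrite !mxE !eqxx polyC1 mulr1 addr0.
    by rewrite !mxE (negPf ne) andbF polyC0 mulr0.
  have : pi ^+ 2 %| \det G by rewrite eG !det_mulmx dvdp_mulr // dvdp_mull.
  rewrite (expand_det_row _ i0) (bigD1 i0) //= dvdp_addl; last first.
    apply: (big_ind (fun p => pi ^+ 2 %| p)) => [|p q|j ne]; [exact: dvdp0|exact: dvdp_add|].
    rewrite expr2; apply: dvdp_mul => //; rewrite /cofactor dvdp_mull //.
    rewrite dvdp_XsubCl -[root _ _]/(horner_eval x0 _ == 0) -det_map_mx.
    rewrite map_row' map_col'.
    have [j' ej' _] := unlift_some ne.
    apply/eqP; rewrite (expand_det_col _ j') big1 // => i _.
    by rewrite 2!mxE -ej' G0j mul0r.
  rewrite mulrC Gauss_dvdpr // coprimep_expl // coprimep_sym coprimep_XsubC.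
  rewrite rootE /cofactor hornerM mulf_neq0 //.
    by rewrite horner_exp hornerN hornerC expf_neq0 // oppr_eq0 oner_eq0.
  by rewrite -[_.[_]]/(horner_eval x0 _) -det_map_mx map_row' map_col'.
(* Otherwise the kernel of G0 contains a second direction u, and c G c^T / (X - x0) evaluated at x0
   is a quadratic form on the plane spanned by e_i0 and u. Over an algebraically closed field it has
   an isotropic vector. *)
have /eqP/det0P[u' u'nz u'G] := cof0.
pose u : 'rV[F]_k := \row_j (if unlift i0 j is Some j' then u' 0 j' else 0).
have ui0 : u 0 i0 = 0 by rewrite mxE unlift_none.
have ul j : u 0 (lift i0 j) = u' 0 j by rewrite mxE liftK.
have unz : u != 0.
  have /rV0Pn[j uj] := u'nz; apply/rV0Pn; exists (lift i0 j); by rewrite ul.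
have uG : u *m G0 = 0.
  apply/rowP => j; rewrite !mxE; case: (unliftP i0 j) => [j'|] ->; last first.
    by apply: big1 => l _; rewrite G0j mulr0.
  move/rowP/(_ j'): u'G; rewrite !mxE => e; rewrite -[RHS]e.
  rewrite (bigD1_ord i0) //= ui0 mul0r add0r.
  by apply: eq_bigr => l _; rewrite ul !mxE.
pose e0 : 'rV[F]_k := delta_mx 0 i0.
have e0G : e0 *m G0 = 0 by rewrite -rowE.
have div_vec (g : 'rV[F]_k) : g *m G0 = 0 ->
    exists h : 'rV[{poly F}]_k, cmx g *m G = pi *: h.
  move=> gG; have /dvd_eval_mx dvd : map_mx (horner_eval x0) (cmx g *m G) = 0.
    by rewrite map_mxM eval_polyC_mx.
  exists (map_mx (fun p => p %/ pi) (cmx g *m G)).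
  by apply/rowP => j; rewrite [RHS]mxE [X in _ * X]mxE mulrC divpK.
have [h1 eh1] := div_vec _ e0G; have [h2 eh2] := div_vec _ uG.
pose q11 := ((map_mx (horner_eval x0) h1) *m e0^T) 0 0.
pose q12 := ((map_mx (horner_eval x0) h1) *m u^T) 0 0.
pose q21 := ((map_mx (horner_eval x0) h2) *m e0^T) 0 0.
pose q22 := ((map_mx (horner_eval x0) h2) *m u^T) 0 0.
have isoP (a b : F) : a *: e0 + b *: u != 0 ->
    a * a * q11 + a * b * q12 + b * a * q21 + b * b * q22 = 0 ->
    isotropic_at G x0 (a *: e0 + b *: u).
  move=> nz eq0; set g := a *: e0 + b *: u.
  have eg : cmx g *m G = pi *: (a%:P *: h1 + b%:P *: h2).
    rewrite /g map_mxD !map_mxZ mulmxDl -!scalemxAl eh1 eh2 scalerDr.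
    by rewrite !scalerA ![_ * pi]mulrC.
  split=> // [j|]; first by rewrite eg mxE dvdp_mulr.
  rewrite eg -scalemxAl mxE expr2 dvdp_mul //.
  suff h : forall i j : 'I_1, pi %| ((a%:P *: h1 + b%:P *: h2) *m (cmx g)^T) i j by apply: h.
  apply/dvd_eval_mx; rewrite map_mxM -map_trmx eval_polyC_mx map_mxD !map_mxZ /=.
  rewrite /horner_eval !hornerC; apply/matrixP => i j; rewrite !ord1 [RHS]mxE -[RHS]eq0.
  rewrite /g linearD !linearZ /= mulmxDr !mulmxDl -!scalemxAr -!scalemxAl.
  rewrite /q11 /q12 /q21 /q22 !mxE; ring.
have [q0|q_nz] := eqVneq q11 0.
  exists (1 *: e0 + 0 *: u); apply: isoP; last by rewrite q0; ring.
  rewrite scale1r scale0r addr0; apply/rV0Pn; exists i0.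
  by rewrite mxE !eqxx oner_eq0.
pose p := q11 *: 'X^2 + ((q12 + q21) *: 'X + q22%:P).
have szp : size p = 3.
  rewrite size_polyDl size_scale // size_polyXn //.
  rewrite (leq_ltn_trans (size_polyD _ _)) // gtn_max size_polyC.
  rewrite (leq_ltn_trans (size_scale_leq _ _)) ?size_polyX //.
  by case: (_ != 0).
have [a] : exists a, root p a by apply/closed_rootP; rewrite szp.
rewrite rootE /p !hornerE => /eqP pa.
exists (a *: e0 + 1 *: u); apply: isoP; last by rewrite -[RHS]pa /=; ring.
have [->|a0] := eqVneq a 0; first by rewrite scale0r add0r scale1r.
apply/rV0Pn; exists i0; rewrite mxE scale1r ui0 addr0 !mxE !eqxx mulr1 //.
Qed.

End Improvement.

(** * Removing double zeros of det D *)

Section Descent.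
Variable F : closedFieldType.

Lemma size_leq_sub (p : {poly F}) s d :
  (p != 0 -> (size p + s <= d.+1)%N) <-> (size p <= d.+1 - s)%N.
Proof.
rewrite -size_poly_gt0; split=> [h|h p0]; last by lia.
by case: posnP h => [->//|p0] /(_ isT); lia.
Qed.

Lemma dvd_sym_mx k (G : 'M[{poly F}]_k) pi i0 : pi != 0 ->
  G^T = G -> (forall j, pi %| G i0 j) -> pi ^+ 2 %| G i0 i0 ->
  exists D' : 'M[{poly F}]_k, forall i j,
    G i j = pi ^+ ((i == i0) + (j == i0)) * D' i j.
Proof.
move=> pi0 symG dG d2G.
exists (\matrix_(i, j) (G i j %/ pi ^+ ((i == i0) + (j == i0)))) => i j.
rewrite mxE mulrC divpK //; have [->|ni] := eqVneq i i0.
  by have [->|nj] := eqVneq j i0.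
have [->|nj] := eqVneq j i0; last exact: dvd1p.
by rewrite -symG mxE.
Qed.

(** In the basis where c replaces e_i0, row and column i0 of the form are divisible by X - x0, and
    the diagonal entry by its square. Moving one factor from D into row i0 of V leaves P unchanged
    and raises v_i0 by one. *)
Lemma sym_fact_improve d n k (v : 'I_k -> nat) (V : 'M[{poly F}]_(k, n)) D P x0 :
  sym_fact d v V D P -> ('X - x0%:P) ^+ 2 %| \det D ->
  exists v' (V' : 'M[{poly F}]_(k, n)) D',
    sym_fact d v' V' D' P /\ (\sum_i v' i = (\sum_i v i).+1)%N.
Proof.
case=> eP symD hV hD nzD dvd2; pose pi := 'X - x0%:P.
have pi0 : pi != 0 by rewrite polyXsubC_eq0.
have [c0 [c0nz c0D c0Dc]] := isotropic_exists symD dvd2.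
have /rV0Pn[i1 ci1] := c0nz.
(* Minimality of v_i0 on the support of c keeps all degree bounds under the change of basis: row i0
   of V is subtracted only from rows with v_i >= v_i0. *)
have [i0 ci0 imin] := @arg_minnP _ i1 (fun i => c0 0 i != 0) v ci1.
have [c ec] : exists c, c = (c0 0 i0)^-1 *: c0 by eexists.
have c1 : c 0 i0 = 1 by rewrite ec mxE mulVf.
have vmin j : c 0 j != 0 -> (v i0 <= v j)%N.
  by rewrite ec mxE mulf_eq0 negb_or => /andP[_ /imin].
have cD j : pi %| (cmx c *m D) 0 j.
  by rewrite ec map_mxZ -scalemxAl mxE dvdp_mull.
have cDc : pi ^+ 2 %| (cmx c *m D *m (cmx c)^T) 0 0.
  by rewrite ec map_mxZ -!scalemxAl linearZ /= -scalemxAr 2!mxE !dvdp_mull.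
have := shear_inv c1 (-1); rewrite opprK => ST.
have TS := mulmx1C ST.
set T := shear c i0 1 in ST TS; set S := shear c i0 (-1) in ST TS.
have [G eG] : exists G, G = cmx T *m D *m (cmx T)^T by eexists.
have symG : G^T = G by rewrite eG !trmx_mul trmxK symD mulmxA.
have rowT : row i0 T = c.
  by apply/rowP => j; rewrite mxE shearE eqxx mulr1 mul1r eq_sym addrCA subrr addr0.
have rowT' i : i != i0 -> row i T = delta_mx 0 i.
  move=> ne; apply/rowP => j; rewrite mxE shearE (negPf ne) mulr0 mul0r addr0.
  by rewrite mxE eqxx eq_sym.
have rowTD i : row i (cmx T *m D) = if i == i0 then cmx c *m D else row i D.
  rewrite row_mul -map_row; case: eqVneq => [->|/rowT' ->]; first by rewrite rowT.
  by rewrite (map_delta_mx polyC) -rowE.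
have GE i j : G i j = if j == i0 then (row i (cmx T *m D) *m (cmx c)^T) 0 0
    else (cmx T *m D) i j.
  have -> : G i j = (row i (cmx T *m D) *m (cmx (row j T))^T) 0 0.
    by rewrite eG !mxE; apply: eq_bigr => l _; rewrite !mxE.
  case: eqVneq => [->|/rowT' ->]; first by rewrite rowT.
  by rewrite (map_delta_mx polyC) trmx_delta -colE !mxE.
have dG j : pi %| G i0 j.
  rewrite -symG mxE GE eqxx rowTD; case: eqVneq => [_|ne].
    by rewrite (dvdp_trans _ cDc) // dvdp_exp.
  have -> : (row j D *m (cmx c)^T) 0 0 = (cmx c *m D) 0 j.
    by rewrite -{1}symD !mxE; apply: eq_bigr => l _; rewrite !mxE mulrC.
  exact: cD.
have d2G : pi ^+ 2 %| G i0 i0 by rewrite GE eqxx rowTD eqxx.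
have [D' eD'] := dvd_sym_mx pi0 symG dG d2G.
pose Del : 'M[{poly F}]_k := diag_mx (\row_i pi ^+ (i == i0)).
have eGD : G = Del *m D' *m Del.
  apply/matrixP => i j; rewrite eD' mul_mx_diag mul_diag_mx !mxE exprD.
  by rewrite mulrAC.
have STc : cmx S *m cmx T = 1%:M by rewrite -map_mxM ST map_mx1.
have TSc : (cmx T)^T *m (cmx S)^T = 1%:M by rewrite -trmx_mul STc trmx1.
have eD : D = cmx S *m G *m (cmx S)^T.
  by rewrite eG !mulmxA STc mul1mx -mulmxA TSc mulmx1.
exists (fun i => v i + (i == i0))%N, (Del *m ((cmx S)^T *m V)), D'; split; last first.
  have e1 : (\sum_(i < k) (i == i0) = 1)%N.
    by rewrite (bigD1 i0) //= eqxx big1 // => i /negPf->.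
  by rewrite big_split /= e1 addn1.
split.
- by rewrite eP eD eGD !trmx_mul trmxK tr_diag_mx !mulmxA.
- apply/matrixP => i j; rewrite mxE.
  apply: (mulfI (expf_neq0 ((i == i0) + (j == i0)) pi0)).
  by rewrite -eD' -symG mxE eD' addnC.
- move=> i j; rewrite mul_diag_mx mxE [X in X * _]mxE.
  have sz : (size (((cmx S)^T *m V)%R i j) <= (v i).+1)%N.
    rewrite mxE; apply: size_sum_le => l _; rewrite 2!mxE shearE.
    have [->|ne] := eqVneq l i0; last first.
      rewrite mulr0 mul0r addr0; have [->|nl] := eqVneq l i; first by rewrite mul1r.
      by rewrite polyC0 mul0r size_poly0.
    rewrite mulr1 mulN1r opprB.
    have [->|ne] := eqVneq i i0; first by rewrite c1 subrr addr0 mul1r hV.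
    rewrite add0r sub0r.
    have [->|ci] := eqVneq (c 0 i) 0; first by rewrite oppr0 polyC0 mul0r size_poly0.
    rewrite size_Cmul ?oppr_eq0 // (leq_trans (hV _ _)) // ltnS; exact: vmin.
  case: (i == i0); last by rewrite expr0 mul1r addn0.
  rewrite expr1 mulrC (leq_trans (size_polyMleq _ _)) // size_XsubC !addn2 addn1; exact: sz.
- have hD' a b : (size (D a b) <= d.+1 - (v a + v b))%N by apply/size_leq_sub/hD.
  have hC (l b : 'I_k) (p : {poly F}) : (size p <= d.+1 - (v l + v b))%N ->
      (size ((c 0 l)%:P * p)%R <= d.+1 - (v i0 + v b))%N.
    have [->|cl] := eqVneq (c 0 l) 0; first by rewrite polyC0 mul0r size_poly0.
    by move=> h; rewrite size_Cmul // (leq_trans h) // leq_sub2l // leq_add2r vmin.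
  have hTD i j : (size ((cmx T *m D) i j)%R <= d.+1 - (v i + v j))%N.
    have -> : (cmx T *m D) i j = row i (cmx T *m D) 0 j by rewrite [RHS]mxE.
    rewrite rowTD; case: eqVneq => [->|_]; last by rewrite mxE.
    by rewrite mxE; apply: size_sum_le => l _; rewrite mxE; apply: hC.
  have hG i j : (size (G i j) <= d.+1 - (v i + v j))%N.
    rewrite GE; case: eqVneq => [->|_]; last exact: hTD.
    rewrite mxE; apply: size_sum_le => l _; rewrite mxE mulrC 2!mxE addnC.
    by apply: hC; rewrite addnC; apply: hTD.
  move=> i j Dnz; have /size_leq_sub := hG i j; rewrite eD'.
  have pim : pi ^+ ((i == i0) + (j == i0)) \is monic by rewrite monic_exp ?monicXsubC.
  rewrite mulf_neq0 ?expf_neq0 // => /(_ isT).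
  rewrite size_monicM // size_exp_XsubC; lia.
- apply: contraNneq nzD => D'0.
  by rewrite eD eGD !det_mulmx D'0 !(mulr0, mul0r).
Qed.

Lemma mprevK d n (P : 'M[{poly F}]_n) :
  (forall i j, (size (P i j) <= d.+1)%N) -> mprev d (mprev d P) = P.
Proof.
move=> szP; apply/matrixP => i j; rewrite mxE -/(hrevp d _) mxE -/(hrevp d _).
exact: hrevpK.
Qed.

(** Each improvement raises sum v_i, and 2 sum v_i <= k d by [det_degree], so the process stops. *)
Lemma sym_fact_squarefree d n k (v : 'I_k -> nat) (V : 'M[{poly F}]_(k, n)) D P :
  sym_fact d v V D P ->
  exists v' (V' : 'M[{poly F}]_(k, n)) D', [/\ sym_fact d v' V' D' P,
    forall x, ~~ (('X - x%:P) ^+ 2 %| \det D')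
    & ~~ (('X - 0%:P) ^+ 2 %| \det (drev d v' D'))].
Proof.
have [s] := ubnP (k * d - \sum_i v i)%N; elim: s v V D => // s IH v V D lts fP.
have next (v' : 'I_k -> nat) : (\sum_i v' i = (\sum_i v i).+1)%N ->
    (2 * (\sum_i v' i) <= k * d)%N -> (k * d - \sum_i v' i < s)%N.
  move=> ->; move: lts; move: (\sum_i v i)%N (k * d)%N => a b; clear; lia.
have le_deg v0 (V0 : 'M[{poly F}]_(k, n)) D0 P0 : sym_fact d v0 V0 D0 P0 -> (2 * (\sum_i v0 i) <= k * d)%N.
  by case=> _ _ _ hD nz; rewrite -(det_degree hD nz) leq_addl.
have [[x dvdx]|nx] := pselect (exists x, ('X - x%:P) ^+ 2 %| \det D).
  have [v' [V' [D' [fP' ev]]]] := sym_fact_improve fP dvdx.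
  by apply: (IH v' V' D') => //; exact: next _ ev (le_deg _ _ _ _ fP').
have [dvd0|n0] := boolP (('X - 0%:P) ^+ 2 %| \det (drev d v D)); last first.
  exists v, V, D; split=> // x; apply/negP => dvdx; apply: nx; by exists x.
(* A double zero at infinity is improved as a double zero at 0 of the reversal, and reversing again
   returns to P. *)
have [v' [V' [D' [fP' ev]]]] := sym_fact_improve (sym_fact_rev fP) dvd0.
have := sym_fact_rev fP'; rewrite mprevK; last exact: size_sym_fact fP.
move=> fP''; apply: (IH v' (vrev v' V') (drev d v' D')) => //.
exact: next _ ev (le_deg _ _ _ _ fP').
Qed.

(** Zero rows of V paired with an identity block bring polynomials of smaller rank under the same
    scheme. As a form of grade d the identity block has all its zeros at infinity. *)
Lemma sym_fact_pad d n k m (v : 'I_k -> nat) (V : 'M[{poly F}]_(k, n)) D P :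
  sym_fact d v V D P -> exists v' (V' : 'M[{poly F}]_(m + k, n)) D',
    sym_fact d v' V' D' P.
Proof.
case=> eP symD hV hD nz.
exists (fun i => match fintype.split i with inl _ => 0%N | inr j => v j end), (col_mx 0 V),
  (block_mx 1%:M 0 0 D); split.
- rewrite tr_col_mx mul_row_block mul_row_col !(mulmx0, mul0mx, trmx0, add0r, addr0).
  exact: eP.
- by rewrite tr_block_mx !trmx0 trmx1 symD.
- by move=> i j; rewrite mxE; case: splitP => l _; rewrite ?hV // mxE size_poly0.
- move=> i j; rewrite !mxE; case: splitP => i' _; rewrite !mxE; case: splitP => j' _ //.
  + by rewrite mxE mulrb; case: (i' == j'); rewrite ?eqxx ?size_poly1.
  + by rewrite mxE eqxx.
  + by rewrite mxE eqxx.
  + exact: hD.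
- by rewrite det_lblock det1 mul1r.
Qed.

Theorem sym_fact_padded d n r (P : 'M[{poly F}]_n) :
  P^T = P -> (forall i j, (size (P i j) <= d.+1)%N) -> (mprank P <= r)%N ->
  exists v (V : 'M[{poly F}]_(r, n)) D, sym_fact d v V D P.
Proof.
move=> symP szP le_r; have [V [D fP]] := sym_fact_exists symP szP.
by rewrite -(subnK le_r); apply: sym_fact_pad fP.
Qed.

End Descent.

(** * Toeplitz matrices and balanced minimal indices *)

Lemma size_mul_bound (A : nzRingType) (p q : {poly A}) a b :
  (size p <= a)%N -> (size q <= b.+1)%N -> (size (p * q)%R <= a + b)%N.
Proof.
have [->|p0] := eqVneq p 0; first by rewrite mul0r size_poly0.
rewrite -size_poly_gt0 in p0; have := size_polyMleq p q; lia.
Qed.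

Section Toeplitz.
Variable F : closedFieldType.
Variables (n K : nat).

(** [dec] and [enc] identify polynomial row vectors with entries of degree < K with constant
    vectors; the pairs (entry, exponent) are numbered by [enum_rank], since matrices are indexed by
    ordinals. *)
Definition dec (xi : 'rV[F]_#|{: 'I_n * 'I_K}|) : 'rV[{poly F}]_n :=
  \row_j \sum_(u < K) xi 0 (enum_rank (j, u)) *: 'X^u.

Definition enc (x : 'rV[{poly F}]_n) : 'rV[F]_#|{: 'I_n * 'I_K}| :=
  \row_(s < #|{: 'I_n * 'I_K}|) (x 0 (enum_val s).1)`_(enum_val s).2.

Definition small m (G : 'M[{poly F}]_(m, n)) := forall i j, (size (G i j) <= K)%N.

Lemma dec_poly xi j : dec xi 0 j =
  \poly_(u < K) (if insub u is Some u' then xi 0 (enum_rank (j, u')) else 0).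
Proof.
rewrite mxE poly_def; apply: eq_bigr => u _.
by rewrite insubT //= => h; congr (xi _ (enum_rank (_, _)) *: _); apply: val_inj.
Qed.

Lemma small_dec xi : small (dec xi).
Proof. by move=> i j; rewrite ord1 dec_poly size_poly. Qed.

Lemma coef_dec xi j (u : 'I_K) : (dec xi 0 j)`_u = xi 0 (enum_rank (j, u)).
Proof.
rewrite dec_poly coef_poly ltn_ord insubT // => h.
by congr (xi _ (enum_rank (_, _))); apply: val_inj.
Qed.

Lemma encK x : small x -> dec (enc x) = x.
Proof.
move=> sx; apply/rowP => j; apply/polyP => u.
have [ltu|geu] := ltnP u K; last first.
  by rewrite !nth_default // ?(leq_trans _ geu) ?small_dec // sx.
by rewrite -[u]/(val (Ordinal ltu)) coef_dec mxE enum_rankK.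
Qed.

Lemma decK xi : enc (dec xi) = xi.
Proof.
apply/rowP => s; rewrite mxE coef_dec -surjective_pairing enum_valK //.
Qed.

Lemma dec_mul m (c : 'rV[F]_m) (M : 'M[F]_(m, #|{: 'I_n * 'I_K}|)) :
  dec (c *m M) = cmx c *m \matrix_i dec (row i M).
Proof.
apply/rowP => j; apply/polyP => u.
rewrite [in RHS]mxE coef_sum; have [ltu|geu] := ltnP u K; last first.
  rewrite nth_default ?(leq_trans _ geu) ?small_dec // big1 // => i _.
  by rewrite 2!mxE coefCM nth_default ?mulr0 // (leq_trans _ geu) // small_dec.
rewrite -[u]/(val (Ordinal ltu)) coef_dec mxE; apply: eq_bigr => i _.
by rewrite 2!mxE coefCM coef_dec mxE.
Qed.

Section Map.
Variables (r : nat) (v : 'I_r -> nat) (V : 'M[{poly F}]_(r, n)).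
Notation tgt := {i : 'I_r & 'I_(K + v i)}.

(** The convolution (Sylvester) matrix of x |-> x V^T on vectors of degree < K. Component i of the
    image has size at most K + v_i, whence the dependent index type of the columns. *)
Definition toep : 'M[F]_(#|{: 'I_n * 'I_K}|, #|{: tgt}|) :=
  \matrix_(s < #|{: 'I_n * 'I_K}|, t < #|{: tgt}|) ('X^((enum_val s).2) * V (tag (enum_val t)) (enum_val s).1)`_(tagged (enum_val t)).

Lemma card_src : #|{: 'I_n * 'I_K}| = (n * K)%N.
Proof. by rewrite card_prod !card_ord. Qed.

Lemma card_tgt : #|{: tgt}| = (r * K + \sum_i v i)%N.
Proof.
rewrite card_tagged sumnE big_map big_enum /=.
under eq_bigr do rewrite card_ord.
by rewrite big_split /= sum_nat_const card_ord.
Qed.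

Lemma mul_toep xi (t : tgt) :
  (xi *m toep) 0 (enum_rank t) = ((dec xi *m V^T) 0 (tag t))`_(tagged t).
Proof.
rewrite !mxE coef_sum (reindex _ (onW_bij _ (enum_rank_bij _))) /=.
rewrite (eq_bigr (fun p : 'I_n * 'I_K => (fun j u => xi 0 (enum_rank (j, u)) *
  ('X^u * V (tag t) j)`_(tagged t)) p.1 p.2)) => [|[j u] _]; last first.
  by rewrite !mxE !enum_rankK.
rewrite -(pair_bigA _ (fun j u => xi 0 (enum_rank (j, u)) *
  ('X^u * V (tag t) j)`_(tagged t))) /=.
apply: eq_bigr => j _; rewrite 2!mxE big_distrl coef_sum /=.
by apply: eq_bigr => u _; rewrite -scalerAl coefZ.
Qed.

Hypothesis hV : forall i j, (size (V i j) <= (v i).+1)%N.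

Lemma small_mul_tr m (G : 'M[{poly F}]_(m, n)) i l : small G ->
  (size ((G *m V^T) i l)%R <= K + v l)%N.
Proof.
move=> sG; rewrite mxE; apply: size_sum_le => j _; rewrite mxE.
exact: size_mul_bound.
Qed.

Lemma mul_toep_eq0 xi : (xi *m toep == 0) = (dec xi *m V^T == 0).
Proof.
apply/eqP/eqP => h.
  apply/rowP => l; rewrite [RHS]mxE; apply/polyP => t; rewrite coef0.
  have [lt|ge] := ltnP t (K + v l); last first.
    by rewrite nth_default // (leq_trans _ ge) // small_mul_tr //; apply: small_dec.
  have := mul_toep xi (Tagged (fun l => 'I_(K + v l)) (Ordinal lt)) => /= <-.
  by rewrite h mxE.
apply/rowP => t; rewrite -[t]enum_valK mul_toep h !mxE coef0 //.
Qed.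

(** Independence over the constants F only, weaker than independence over F(x). *)
Definition poly_indep m (G : 'M[{poly F}]_(m, n)) :=
  forall c : 'rV[F]_m, cmx c *m G = 0 -> c = 0.

Lemma toep_kernel_basis m : m = (n * K - \rank toep)%N ->
  exists G : 'M[{poly F}]_(m, n),
  [/\ small G, G *m V^T = 0, poly_indep G
    & forall x : 'rV[{poly F}]_n, small x -> x *m V^T = 0 -> exists c, x = cmx c *m G].
Proof.
have rk : \rank (kermx toep) = (n * K - \rank toep)%N.
  by rewrite mxrank_ker; congr (_ - _)%N; apply: card_src.
rewrite -rk => {rk} ->; pose M := row_base (kermx toep).
have MT : M *m toep = 0 by apply/sub_kermxP; rewrite eq_row_base.
exists (\matrix_i dec (row i M)); split.
- by move=> i j; rewrite mxE; apply: small_dec.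
- apply/row_matrixP => i; rewrite row_mul rowK row0; apply/eqP.
  by rewrite -mul_toep_eq0 -row_mul MT row0.
- move=> c; rewrite -dec_mul => e.
  have /eqP : c *m M = 0 by rewrite -[c *m M]decK e; apply/rowP => s; rewrite !mxE coef0.
  by rewrite mulmx_free_eq0 ?row_base_free // => /eqP.
- move=> x sx xV; have : (enc x <= M)%MS.
    by rewrite eq_row_base sub_kermx mul_toep_eq0 encK // xV.
  by case/submxP => c ec; exists c; rewrite -dec_mul -ec encK.
Qed.

Lemma toep_rank_le m (G : 'M[{poly F}]_(m, n)) :
  small G -> G *m V^T = 0 -> poly_indep G -> (\rank toep + m <= n * K)%N.
Proof.
move=> sG GV iG; pose M := \matrix_i enc (row i G).
have eG : \matrix_i dec (row i M) = G.
  apply/row_matrixP => i; rewrite !rowK encK // => k j; rewrite mxE; exact: sG.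
have fM : row_free M.
  rewrite -kermx_eq0; apply: contraT => /rowV0Pn[c /sub_kermxP cM].
  rewrite (iG c) ?eqxx // -eG -dec_mul cM.
  by apply/rowP => j; rewrite !mxE big1 // => u _; rewrite mxE scale0r.
have : (M <= kermx toep)%MS.
  apply/row_subP => i; rewrite sub_kermx mul_toep_eq0 rowK encK.
    by rewrite -row_mul GV row0.
  by move=> k j; rewrite mxE.
move/mxrankS; rewrite (eqP fM) mxrank_ker.
by have := rank_leq_row toep; have := card_src; lia.
Qed.

Lemma toep_full_surj : row_full toep ->
  forall y : 'rV[{poly F}]_r, (forall l, (size (y 0 l)%R <= K + v l)%N) ->
  exists x, small x /\ x *m V^T = y.
Proof.
move=> full y sy.
pose eta : 'rV[F]_#|{: tgt}| := \row_(t < #|{: tgt}|) (y 0 (tag (enum_val t)))`_(tagged (enum_val t)).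
have /submxP[xi exi] : (eta <= toep)%MS by apply: submx_full.
exists (dec xi); split; first exact: small_dec.
apply/rowP => l; apply/polyP => t.
have [lt|ge] := ltnP t (K + v l); last first.
  rewrite !nth_default ?(leq_trans (sy l)) // (leq_trans _ ge) //.
  by rewrite small_mul_tr //; apply: small_dec.
have := mul_toep xi (Tagged (fun l => 'I_(K + v l)) (Ordinal lt)) => /= <-.
by rewrite -exi mxE enum_rankK.
Qed.

Lemma surj_toep_full :
  (forall y : 'rV[{poly F}]_r, (forall l, (size (y 0 l)%R <= K + v l)%N) ->
  exists x, small x /\ x *m V^T = y) -> row_full toep.
Proof.
move=> surj; rewrite -sub1mx; apply/row_subP => t0.
rewrite row1; have [p ep] : exists p : tgt, enum_rank p = t0.
  by exists (enum_val t0); rewrite enum_valK.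
pose y : 'rV[{poly F}]_r := \row_l (if l == tag p then 'X^(tagged p) else 0).
have [|x [sx xV]] := surj y.
  move=> l; rewrite mxE; case: eqP => [->|_]; last by rewrite size_poly0.
  by rewrite size_polyXn.
apply/submxP; exists (enc x); apply/rowP => t; rewrite -[t]enum_valK.
move: (enum_val t) => q; rewrite mul_toep encK // xV !mxE -ep eqxx /=.
rewrite (inj_eq enum_rank_inj); case: p q {ep x sx xV y} => [l u] [l' u'] /=.
have [e|ne] := eqVneq l' l; last first.
  rewrite coef0; case: eqP => // e; have := congr1 tag e => /= e'.
  by rewrite e' eqxx in ne.
subst l'; rewrite coefXn.
suff -> : (Tagged (fun i => 'I_(K + v i)) u' == Tagged (fun i => 'I_(K + v i)) u) = (u' == u :> nat) by [].
by rewrite eq_Tagged.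
Qed.

Lemma inj_toep_free :
  (forall x : 'rV[{poly F}]_n, small x -> x *m V^T = 0 -> x = 0) -> row_free toep.
Proof.
move=> inj; rewrite -kermx_eq0; apply: contraT => /rowV0Pn[xi].
rewrite sub_kermx mul_toep_eq0 => /eqP /(inj _ (small_dec _)) e.
by rewrite -[xi]decK e; case/eqP; apply/rowP => s; rewrite !mxE coef0.
Qed.

Lemma toep_free_inj : row_free toep ->
  forall x : 'rV[{poly F}]_n, small x -> x *m V^T = 0 -> x = 0.
Proof.
move=> fr x sx xV; have : enc x *m toep == 0 by rewrite mul_toep_eq0 encK // xV.
rewrite mulmx_free_eq0 // => /eqP e; rewrite -[x]encK // e.
by apply/rowP => j; rewrite !mxE big1 // => u _; rewrite mxE scale0r.
Qed.

End Map.
End Toeplitz.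

(** * Balanced minimal indices from Toeplitz ranks *)

Section BalancedIndices.
Variable F : closedFieldType.

Lemma eval_free n m (B : 'M[{poly F}]_(m, n)) x0 :
  row_free (map_mx (horner_eval x0) B) -> row_free (mpfrac B).
Proof.
case/row_freeP => W BW; have nz : \det (B *m cmx W) != 0.
  apply: contra_eq_neq BW => d0; apply: contraTneq (oner_neq0 F) => e.
  rewrite -(det1 F m) -e -[W](eval_polyC_mx _ x0) -map_mxM det_map_mx d0 rmorph0 eqxx //.
have u : mpfrac B *m map_mx (@tofrac {poly F}) (cmx W) \in unitmx.
  by rewrite -map_mxM unitmxE det_map_mx unitfE tofrac_eq0.
by rewrite -row_leq_rank -{1}(mxrank_unit u) mxrankM_maxl.
Qed.

Lemma polyC_mx_eq0 m k (A : 'M[F]_(m, k)) : cmx A = 0 -> A = 0.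
Proof.
move/matrixP => e; apply/matrixP => i j; have := e i j.
by rewrite !mxE => /polyC_inj.
Qed.

Lemma divX_mx m n K (A : 'M[{poly F}]_(m, n)) :
  map_mx (horner_eval 0) A = 0 -> small K.+1 A ->
  exists A', A = 'X *: A' /\ small K A'.
Proof.
move=> A0 sA; exists (map_mx (drop_poly 1) A).
have e i j : A i j = 'X * drop_poly 1 (A i j).
  rewrite -{1}(poly_take_drop 1 (A i j)) expr1 mulrC.
  suff -> : take_poly 1 (A i j) = 0 by rewrite add0r.
  apply/polyP => t; rewrite coef_take_poly coef0; case: ltnP => //.
  rewrite ltnS leqn0 => /eqP ->; rewrite -horner_coef0.
  by move/matrixP/(_ i j): A0; rewrite !mxE.
split; first by apply/matrixP => i j; rewrite !mxE -e.
by move=> i j; rewrite mxE size_drop_poly; have := sA i j; lia.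
Qed.

Lemma small_cmx_mul n m k K (C : 'M[F]_(k, m)) (G : 'M[{poly F}]_(m, n)) :
  small K G -> small K (cmx C *m G).
Proof.
move=> sG i j; rewrite mxE; apply: size_sum_le => l _; rewrite mxE.
have [->|c0] := eqVneq (C i l) 0; first by rewrite mul0r size_poly0.
by rewrite size_Cmul.
Qed.

Lemma scaleX_eq0 m n (A : 'M[{poly F}]_(m, n)) : 'X *: A = 0 -> A = 0.
Proof.
move/matrixP => e; apply/matrixP => i j; have := e i j; rewrite !mxE => /eqP.
by rewrite mulf_eq0 polyX_eq0 => /eqP.
Qed.

Section Kernel.
Variables (n r : nat) (V : 'M[{poly F}]_(r, n)).

(** A constant combination of the rows vanishing at 0 is X times a kernel vector of smaller degree,
    which is 0 by hypothesis. With [eval_free], independence over F thus becomes independence over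
    F(x). *)
Lemma eval0_free K m (G : 'M[{poly F}]_(m, n)) :
  (forall x : 'rV_n, small K x -> x *m V^T = 0 -> x = 0) ->
  small K.+1 G -> G *m V^T = 0 -> poly_indep G ->
  row_free (map_mx (horner_eval 0) G).
Proof.
move=> inj sG GV iG; rewrite -kermx_eq0; apply: contraT.
case/rowV0Pn=> c /sub_kermxP cG; rewrite (iG c) ?eqxx //.
have [|x [ex sx]] := @divX_mx _ _ K (cmx c *m G) _ (small_cmx_mul c sG).
  by rewrite map_mxM eval_polyC_mx.
rewrite ex (inj x) ?scaler0 //; apply: scaleX_eq0.
by rewrite scalemxAl -ex -mulmxA GV mulmx0.
Qed.

Lemma frac_indep m (G : 'M[{poly F}]_(m, n)) : row_free (mpfrac G) -> poly_indep G.
Proof.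
move=> fG c e; have : mpfrac (cmx c) *m mpfrac G = 0 by rewrite -map_mxM e map_mx0.
move/eqP; rewrite mulmx_free_eq0 // => /eqP e'.
apply: polyC_mx_eq0; apply: (@mpfrac_inj F 1 m); rewrite e'.
by rewrite /mpfrac map_mx0.
Qed.

Variable (v : 'I_r -> nat).
Hypothesis hV : forall i j, (size (V i j) <= (v i).+1)%N.

(** Split a target as y0 + X y1 with y0 constant, and solve for both parts; K > 0 leaves room for
    constants. *)
Lemma surj_step K : (0 < K)%N -> row_full (toep K v V) -> row_full (toep K.+1 v V).
Proof.
move=> K0 full; apply: surj_toep_full => y sy.
pose y0 : 'rV[{poly F}]_r := map_mx (take_poly 1) y.
pose y1 : 'rV[{poly F}]_r := map_mx (drop_poly 1) y.
have ey : y = y0 + 'X *: y1.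
  by apply/rowP => l; rewrite !mxE mulrC -[LHS](poly_take_drop 1) expr1.
have [|x0 [sx0 ex0]] := toep_full_surj hV full (y := y0).
  by move=> l; rewrite mxE (leq_trans (size_take_poly _ _)) //; lia.
have [|x1 [sx1 ex1]] := toep_full_surj hV full (y := y1).
  by move=> l; rewrite mxE size_drop_poly; have := sy l; lia.
exists (x0 + 'X *: x1); split; last by rewrite mulmxDl -scalemxAl ex0 ex1.
move=> i j; rewrite !mxE (leq_trans (size_polyD _ _)) // geq_max.
rewrite (leq_trans (sx0 i j)) //= (leq_trans (size_polyMleq _ _)) // size_polyX.
exact: sx1.
Qed.

Variable (Q : 'M[{poly F}]_n).
Hypothesis kerQ : forall k (x : 'M[{poly F}]_(k, n)),
  (mpfrac x <= kermx (mpfrac Q))%MS = (x *m V^T == 0).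
Hypothesis rankQ : mprank Q = r.
Hypothesis ltrn : (r < n)%N.

Let a := (\sum_i v i)%N.
Let q := (n - r)%N.
Let alpha := (a %/ q)%N.
Let s := (a %% q)%N.
Let m := (q - s)%N.

Hypothesis inj_alpha : row_free (toep alpha v V).
Hypothesis full_alpha : row_full (toep alpha.+1 v V).

Let q0 : (0 < q)%N. Proof. by rewrite subn_gt0. Qed.
Let ea : a = (alpha * q + s)%N. Proof. exact: divn_eq. Qed.
Let lts : (s < q)%N. Proof. by rewrite ltn_mod. Qed.

Let rank_full K : row_full (toep K v V) -> \rank (toep K v V) = (r * K + a)%N.
Proof. by move/eqP => ->; apply: card_tgt. Qed.

Let nulls K : (n * K - (r * K + a) = q * K - a)%N.
Proof. by rewrite subnDA -mulnBl. Qed.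

Let null1 : (n * alpha.+1 - \rank (toep alpha.+1 v V) = m)%N.
Proof. rewrite rank_full // nulls /m ea; nia. Qed.

(** Injectivity at alpha excludes basis vectors of degree below alpha, and the nullity m at alpha +
    1 allows at most m of degree alpha; the others cost at least one more each. This certifies
    minimality below. *)
Lemma sum_degrees_ge (B : 'M[{poly F}]_(m + s, n)) :
  poly_basis (kermx (mpfrac Q)) B ->
  [/\ forall i, (alpha <= row_degree B i)%N,
      (#|[pred i | row_degree B i <= alpha]| <= m)%N
    & ((m + s) * alpha + s <= \sum_i row_degree B i)%N].
Proof.
case=> fB eB.
have BV : B *m V^T = 0 by apply/eqP; rewrite -kerQ eB.
have lb i : (alpha <= row_degree B i)%N.
  rewrite leqNgt; apply/negP => lt; have r0 : row i B = 0.
    apply: (toep_free_inj hV inj_alpha); last by rewrite -row_mul BV row0.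
    move=> k j; rewrite mxE; have := size_row_degree B i j; lia.
  have := fB; rewrite -kermx_eq0 => /eqP k0.
  have : (delta_mx 0 i : 'rV_(m + s)) *m mpfrac B = 0.
    rewrite -rowE; apply/rowP => j; move/rowP/(_ j): r0; rewrite !mxE => ->.
    by rewrite tofrac0.
  move/eqP; rewrite mulmx_free_eq0 // => /eqP/rowP/(_ i)/eqP.
  by rewrite !mxE !eqxx oner_eq0.
pose I := [pred i | row_degree B i <= alpha]%N.
have cI : (#|I| <= m)%N.
  pose g : 'I_#|I| -> 'I_(m + s) := enum_val.
  suff h : (\rank (toep alpha.+1 v V) + #|I| <= n * alpha.+1)%N by have := null1; lia.
  apply: (@toep_rank_le _ _ alpha.+1 _ v V hV _ (rowsub g B)).
  - move=> i j; rewrite mxE (leq_trans (size_row_degree _ _ _)) // ltnS.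
    exact: (enum_valP i).
  - by rewrite mul_rowsub_mx BV; apply/matrixP => i j; rewrite !mxE.
  - apply: frac_indep; have -> : mpfrac (rowsub g B) = rowsub g (mpfrac B).
      by apply/matrixP => i j; rewrite !mxE.
    by apply: row_free_rowsub fB; apply: enum_val_inj.
split=> //.
have -> : ((m + s) * alpha = \sum_(i < m + s) alpha)%N by rewrite sum_nat_const card_ord.
apply: (@leq_trans (\sum_(i < m + s) (alpha + (i \notin I)))%N); last first.
  apply: leq_sum => i _; rewrite inE -ltnNge; have := lb i; case: ltnP => /=; lia.
rewrite big_split leq_add2l /=.
have -> : (\sum_(i < m + s) (i \notin I) = #|[predC I]|)%N.
  by rewrite -sum1_card [RHS]big_mkcond; apply: eq_bigr => i _; rewrite !inE; case: leqP.
by rewrite -(leq_add2l #|I|) cardC card_ord leq_add2r.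
Qed.

(** A basis meeting the lower bound of [sum_degrees_ge] is assembled from all m kernel vectors of
    degree <= alpha and s of degree <= alpha + 1, chosen so that the values at 0 are independent. *)
Lemma balanced_left_indices :
  left_minimal_indices Q (nseq s alpha.+1 ++ nseq m alpha).
Proof.
have inj := toep_free_inj hV inj_alpha.
have full2 := surj_step (ltn0Sn _) full_alpha.
have [G1 [sG1 G1V iG1 spG1]] := toep_kernel_basis hV (esym null1).
have [m2 em2] : exists m2, m2 = (n * alpha.+2 - \rank (toep alpha.+2 v V))%N by eexists.
have [G2 [sG2 G2V iG2 spG2]] := toep_kernel_basis hV em2.
have em2' : m2 = (q * alpha.+2 - a)%N by rewrite em2 rank_full // nulls.
pose A := map_mx (horner_eval 0) G1; pose B0 := map_mx (horner_eval 0) G2.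
have fA : row_free A by apply: eval0_free inj sG1 G1V iG1.
(* Combinations of G2 vanishing at 0 are X times kernel vectors of degree <= alpha, so they span at
   most m dimensions, and m2 - m = q. *)
have rB0 : (q <= \rank B0)%N.
  pose k0 := \rank (kermx B0); pose C := row_base (kermx B0).
  have CB : C *m B0 = 0 by apply/sub_kermxP; rewrite eq_row_base.
  have [||Y [eY sY]] := @divX_mx _ _ alpha.+1 (cmx C *m G2).
  - by rewrite map_mxM eval_polyC_mx.
  - exact: small_cmx_mul.
  have YV : Y *m V^T = 0.
    by apply: scaleX_eq0; rewrite scalemxAl -eY -mulmxA G2V mulmx0.
  have iY : poly_indep Y.
    move=> c cY; have /iG2 : cmx (c *m C) *m G2 = 0.
      by rewrite map_mxM -mulmxA eY -scalemxAr cY scaler0.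
    by move/eqP; rewrite mulmx_free_eq0 ?row_base_free // => /eqP.
  have := toep_rank_le hV sY YV iY; rewrite mxrank_ker => h.
  have := rank_leq_row B0; have := null1; move: h em2' lts ea; rewrite /m.
  move: (\rank B0) (\rank (toep _ _ _)) => rb rt; nia.
have sAB : (A <= B0)%MS.
  apply/row_subP => i; have [||c ec] := spG2 (row i G1).
  - by move=> k j; rewrite mxE (leq_trans (sG1 _ _)).
  - by rewrite -row_mul G1V row0.
  have -> : row i A = c *m B0.
    by rewrite -[c](eval_polyC_mx _ 0) -map_mxM -ec; apply/rowP => j; rewrite !mxE.
  exact: submxMl.
have rD : (s <= \rank (B0 :\: A)%MS)%N.
  have e := mxrank_cap_compl B0 A.
  have : (\rank (B0 :&: A)%MS <= m)%N by rewrite -[X in (_ <= X)%N](eqP fA) mxrankS ?capmxSr.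
  move: e lts rB0; rewrite /m; lia.
(* The s further vectors come from a complement of A in the row space of B0. *)
pose g (u : 'I_s) : 'I_(\rank (B0 :\: A)%MS) := widen_ord rD u.
pose C := rowsub g (row_base (B0 :\: A)%MS).
have fC : row_free C.
  apply: row_free_rowsub (row_base_free _) => u u' /(congr1 val) h; exact: val_inj.
have sC : (C <= B0 :\: A)%MS.
  by apply/row_subP => u; rewrite row_rowsub -(eq_row_base (B0 :\: A)%MS) row_sub.
have /submxP[E eC] : (C <= B0)%MS by apply: submx_trans sC (diffmxSl _ _).
pose B : 'M[{poly F}]_(m + s, n) := col_mx G1 (cmx E *m G2).
have fB : row_free (mpfrac B).
  apply: (@eval_free _ _ _ 0); rewrite map_col_mx -/A map_mxM eval_polyC_mx -eC.
  rewrite -row_leq_rank -addsmxE mxrank_disjoint_sum.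
    by rewrite (eqP fA) (eqP fC).
  apply/eqP; rewrite -submx0 -(capmx_diff B0 A) capmxC.
  by rewrite capmxS.
have BV : B *m V^T = 0 by rewrite mul_col_mx G1V -mulmxA G2V mulmx0 col_mx0.
have bB : poly_basis (kermx (mpfrac Q)) B.
  have sub : (mpfrac B <= kermx (mpfrac Q))%MS by rewrite kerQ BV.
  split=> //; apply/eqmxP; rewrite -(mxrank_leqif_eq sub) (eqP fB).
  rewrite mxrank_ker -/(mprank Q) rankQ /m subnK //; exact: ltnW.
have [lb cI sum_ge] := sum_degrees_ge bB.
have ub1 i : (row_degree B (lshift s i) <= alpha)%N.
  by rewrite row_degree_le; apply/forallP => j; rewrite col_mxEu sG1.
have ub2 i : (row_degree B (rshift m i) <= alpha.+1)%N.
  rewrite row_degree_le; apply/forallP => j; rewrite col_mxEd.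
  exact: small_cmx_mul.
have d1 i : row_degree B (lshift s i) = alpha by apply/eqP; rewrite eqn_leq ub1 lb.
have sum2 : (\sum_(i < s) row_degree B (rshift m i) = s * alpha.+1)%N.
  apply/eqP; rewrite eqn_leq; apply/andP; split.
    rewrite -[X in (_ <= X * _)%N](card_ord s) -sum_nat_const.
    by apply: leq_sum => i _; apply: ub2.
  move: sum_ge; rewrite big_split_ord /= (eq_bigr (fun=> alpha)) ?sum_nat_const ?card_ord; last by move=> i _; apply: d1.
  nia.
have d2 i : row_degree B (rshift m i) = alpha.+1.
  apply/eqP; rewrite eqn_leq ub2 ltnNge /=; apply/negP => le.
  have : (\sum_(i < s) row_degree B (rshift m i) < \sum_(i < s) alpha.+1)%N.
    rewrite (bigD1 i) //= [X in (_ < X)%N](bigD1 i) //= -addSn leq_add //.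
    by apply: leq_sum => u _; apply: ub2.
  by rewrite sum2 sum_nat_const card_ord ltnn.
exists (m + s)%N, B; split; last first.
  apply: perm_eq_count_le => t; rewrite count_codom count_cat !count_nseq.
  rewrite -sum1_card big_mkcond big_split_ord /= addnC; congr (_ + _)%N.
    rewrite (eq_bigr (fun=> (alpha <= t : nat)%N)); last by move=> i _; rewrite inE d1; case: leqP.
    by rewrite sum_nat_const card_ord mulnC.
  rewrite (eq_bigr (fun=> (alpha.+1 <= t : nat)%N)); last by move=> i _; rewrite inE d2; case: leqP.
  by rewrite sum_nat_const card_ord mulnC.
split=> // B' bB'; have [_ _] := sum_degrees_ge bB'.
apply: leq_trans; rewrite big_split_ord /= sum2.
rewrite (eq_bigr (fun=> alpha)) ?sum_nat_const ?card_ord; last by move=> i _; apply: d1.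
nia.
Qed.
End Kernel.
End BalancedIndices.

(** * Zigzag matrices *)

Section Zigzag.
Variable F : closedFieldType.

(** V and B are dual: B spans the kernel of x |-> x V^T with predictable degrees, and V has row
    degrees v while B has row degrees e. The first columns are normalized because the recursive
    construction attaches a new column through them. Only sum v = sum e constrains the degrees. *)
Record zigzag n r q (v e : nat -> nat) (V : 'M[{poly F}]_(r, n))
    (B : 'M[{poly F}]_(q, n)) : Prop := Zigzag {
  zz_V : forall i j, (size (V i j) <= (v i).+1)%N;
  zz_V0 : forall i (j : 'I_n), val j = 0%N -> V i j = 'X^(v 0%N) *+ (val i == 0%N);
  zz_B : forall i j, (size (B i j) <= (e i).+1)%N;
  zz_B0 : forall i (j : 'I_n), val j = 0%N -> B i j = 1 *+ (val i == 0%N);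
  zz_BV : B *m V^T = 0;
  zz_ker : forall K (x : 'rV_n), small K x -> x *m V^T = 0 ->
    exists c : 'rV_q, x = c *m B /\ forall j, (size (c 0 j)%R <= K - e j)%N;
  zz_surj : forall K, (forall j, (j < q)%N -> (e j <= K)%N) ->
    forall y : 'rV[{poly F}]_r, (forall i, (size (y 0 i)%R <= K + v i)%N) ->
    exists x : 'rV_n, small K x /\ x *m V^T = y
}.

Lemma zigzag_r0 q (v e : nat -> nat) : (\sum_(j < q) e j = 0)%N ->
  @zigzag q 0 q v e 0 1%:M.
Proof.
move=> /eqP; rewrite sum_nat_eq0 => /forallP e0.
have ej (j : 'I_q) : e j = 0%N by apply/eqP/e0.
split=> [[]//|[]//|i j|i j j0||K x sx _|K _ y _] //.
- by rewrite mxE mulrb; case: ifP; rewrite ?size_poly1 ?size_poly0.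
- by rewrite mxE -val_eqE /= j0.
- by rewrite trmx0 mulmx0.
- by exists x; rewrite mulmx1; split=> // j; rewrite ej subn0 sx.
- exists 0; split; first by move=> i j; rewrite mxE size_poly0.
  by apply/matrixP => i [].
Qed.

Lemma zigzag_q0 r (v e : nat -> nat) : (\sum_(i < r) v i = 0)%N ->
  @zigzag r r 0 v e 1%:M 0.
Proof.
move=> /eqP; rewrite sum_nat_eq0 => /forallP v0.
have vj (j : 'I_r) : v j = 0%N by apply/eqP/v0.
split=> [i j|i j j0|[]//|[]//||K x sx|K _ y sy] //.
- by rewrite mxE mulrb; case: ifP; rewrite ?size_poly1 ?size_poly0.
- rewrite mxE -val_eqE /= j0; case: eqP => // i0.
  have : v i = 0%N by []. by rewrite i0 => ->.
- by rewrite mul0mx.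
- by rewrite trmx1 mulmx1 => ->; exists 0; rewrite mul0mx; split=> // [[]].
- exists y; rewrite trmx1 mulmx1; split=> // i j; rewrite ord1.
  by rewrite (leq_trans (sy j)) // vj addn0.
Qed.

Definition drow n : 'rV[{poly F}]_n := \row_j (val j == 0%N)%:R.

Lemma mul_drow n k (A : 'M[{poly F}]_(k, n)) (j0 : 'I_n) : val j0 = 0%N ->
  A *m (drow n)^T = col j0 A.
Proof.
move=> j00; apply/matrixP => i l; rewrite !mxE (bigD1 j0) //= !mxE j00 mulr1.
rewrite big1 ?addr0 // => j; rewrite -val_eqE /= j00 !mxE => /negPf->.
by rewrite mulr0.
Qed.

Lemma size_drow n j : (size (drow n 0 j)%R <= 1)%N.
Proof. by rewrite mxE; case: eqP; rewrite ?size_poly1 ?size_poly0. Qed.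

(** The Euclidean step for v_0 <= e_0: a row is added to V, and the leading degree of the inner B is
    e_0 - v_0. *)
Lemma zigzag_row n r q v e V B : (v 0 <= e 0)%N -> n = (r + q.+1)%N ->
  @zigzag n r q.+1 (v \o S) (fun j => if j == 0 then e 0 - v 0 else e j)%N V B ->
  @zigzag (1 + n) (1 + r) q.+1 v e
    (block_mx ('X^(v 0))%:M (- drow n) 0 V)
    (row_mx (\col_j (val j == 0%N)%:R)
       (\matrix_(j, l) ('X^(if val j == 0 then v 0 else 0)%N * B j l))).
Proof.
move=> le_ve en Z.
have n0 : (0 < n)%N by rewrite en addnS.
pose j0 : 'I_n := Ordinal n0.
have mulV k (x0 : 'M_(k, 1)) (x' : 'M[{poly F}]_(k, n)) :
    row_mx x0 x' *m (block_mx ('X^(v 0))%:M (- drow n) 0 V)^T =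
    row_mx ('X^(v 0) *: x0 - col j0 x') (x' *m V^T).
  rewrite tr_block_mx mul_row_block trmx0 mulmx0 add0r tr_scalar_mx mul_mx_scalar.
  by rewrite linearN mulmxN (mul_drow _ (j0 := j0)).
have B0 i : B i j0 = 1 *+ (val i == 0%N) by apply: (zz_B0 Z).
split.
- move=> i j; rewrite mxE; case: splitP => i' ->; rewrite mxE; case: splitP => j' _.
  + by rewrite ord1 !mxE !ord1 eqxx size_polyXn.
  + by rewrite ord1 mxE size_polyN (leq_trans (size_drow _)).
  + by rewrite mxE size_poly0.
  + exact: (zz_V Z).
- move=> i j j00; rewrite mxE; case: splitP => i' ei; rewrite mxE; case: splitP => j' ej.
  + by rewrite !ord1 mxE /= ei ord1.
  + by move: ej; rewrite j00.
  + by rewrite mxE /= ei.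
  + by move: ej; rewrite j00.
- move=> i j; rewrite mxE; case: splitP => j' _; rewrite mxE.
    by case: eqP; rewrite ?size_poly1 ?size_poly0.
  have := zz_B Z i j'; case: eqP => [->|_] szB; last by rewrite mul1r.
  rewrite mulrC (leq_trans (size_polyMleq _ _)) // size_polyXn; lia.
- move=> i j j00; rewrite mxE; case: splitP => j' ej; first by rewrite mxE.
  by move: ej; rewrite j00.
- rewrite mulV -row_mx0; congr row_mx.
    apply/matrixP => i j; rewrite !mxE B0; case: eqP => _; last by rewrite mulr0 mul1r subrr.
    by rewrite mulr1 subrr.
  apply/row_matrixP => i; rewrite row_mul row0.
  have -> : row i (\matrix_(j, l) ('X^(if val j == 0 then v 0 else 0)%N * B j l))
      = 'X^(if val i == 0 then v 0 else 0)%N *: row i B.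
    by apply/rowP => l; rewrite !mxE.
  by rewrite -scalemxAl -row_mul (zz_BV Z) row0 scaler0.
- move=> K x; rewrite -[x](@hsubmxK _ 1 1 n); set x0 := lsubmx x; set x' := rsubmx x.
  clearbody x0 x' => sx; rewrite mulV -row_mx0 => /eq_row_mx[e0 e1].
  have sx0 : (size (x0 0 0)%R <= K)%N.
    by have := sx 0 (lshift n 0); rewrite row_mxEl.
  have [|c [ec sc]] := zz_ker Z (K := K) (x := x') _ e1.
    by move=> i j; have := sx i (rshift 1 j); rewrite row_mxEr.
  (* The new equation makes the first coefficient divisible by X^(v_0); the quotient x0 becomes the
     coefficient of the new first row of B. *)
  have c0 : c 0 0 = 'X^(v 0) * x0 0 0.
    have /matrixP/(_ 0 0) := e0; rewrite !mxE => /eqP; rewrite subr_eq0 => /eqP ->.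
    rewrite ec mxE (bigD1 0) //= B0 eqxx mulr1 big1 ?addr0 // => j.
    by rewrite -val_eqE /= B0 => /negPf ->; rewrite mulr0.
  exists (\row_j if val j == 0%N then x0 0 0 else c 0 j); split.
    rewrite mul_mx_row; congr row_mx; apply/matrixP => i j; rewrite !ord1 ?mxE.
      rewrite (bigD1 0) //= !mxE eqxx mulr1 big1 ?addr0 // => l.
      by rewrite -val_eqE /= !mxE => /negPf ->; rewrite mulr0.
    rewrite ec !mxE; apply: eq_bigr => l _; rewrite !mxE.
    case: eqP => [l0|_]; last by rewrite mul1r.
    have -> : l = 0 by apply: val_inj.
    by rewrite c0 mulrA [x0 0 0 * _]mulrC.
  move=> j; rewrite mxE; case: eqP => [j00|jn]; last by have := sc j; case: eqP.
  have -> : e j = e 0%N by rewrite j00.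
  have := sc 0; rewrite /= c0; have [->|nz] := eqVneq (x0 0 0) 0; first by rewrite size_poly0.
  rewrite mulrC size_mulXn //; move: le_ve; move: (size _) (v 0%N) (e 0%N) => sz a b; clear; lia.
- move=> K leK y sy.
  have [||x' [sx' ex']] := zz_surj Z (K := K) _ (y := rsubmx (y : 'rV_(1 + r))).
  + move=> j ltj; case: eqP => [_|_]; last exact: leK.
    by have := leK 0%N isT; lia.
  + move=> i; rewrite mxE; exact: (sy (rshift 1 i)).
  (* The part of w divisible by X^(v_0) is produced by the new column. The remainder is removed by a
     multiple of row 0 of B, which has entry 1 at j0 and does not change x' V^T. *)
  pose w := x' 0 j0 + y 0 0.
  pose c := - take_poly (v 0%N) w.
  exists (row_mx (drop_poly (v 0%N) w)%:M (x' + c *: row 0 B)); split.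
    move=> i j; rewrite ord1 mxE; case: splitP => j' _.
      rewrite ord1 mxE eqxx size_drop_poly leq_subLR addnC.
      rewrite (leq_trans (size_polyD _ _)) // geq_max (leq_trans (sx' _ _)) ?leq_addr //.
      exact: sy 0.
    rewrite !mxE (leq_trans (size_polyD _ _)) // geq_max sx' /=.
    rewrite /c mulNr size_polyN; have := zz_B Z 0 j'; have := leK 0%N isT => /= h1 h2.
    rewrite (leq_trans (size_mul_bound (size_take_poly _ _) h2)) //; lia.
  rewrite mulV -[RHS](@hsubmxK _ 1 1 r); congr row_mx; last first.
    by rewrite mulmxDl ex' -scalemxAl -row_mul (zz_BV Z) row0 scaler0 addr0.
  apply/matrixP => i j; rewrite !ord1 !mxE B0 !eqxx /= mulr1 mulr1n.
  have -> : y 0 (lshift r 0) = y 0 0 by congr (y _ _); apply: val_inj.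
  have ew := poly_take_drop (v 0%N) w.
  have -> : y 0 0 = w - x' 0 j0 by rewrite /w addrC addKr.
  transitivity (take_poly (v 0%N) w + drop_poly (v 0%N) w * 'X^(v 0%N) - x' 0 j0).
    by rewrite /c; ring.
  by rewrite ew.
Qed.

(** The Euclidean step for e_0 <= v_0, with the roles of V and B exchanged: a row is added to B and
    the inner V has leading degree v_0 - e_0. *)
Lemma zigzag_col n r q v e V B : (e 0 <= v 0)%N -> n = (r.+1 + q)%N ->
  @zigzag n r.+1 q (fun i => if i == 0 then v 0 - e 0 else v i)%N (e \o S) V B ->
  @zigzag (1 + n) r.+1 (1 + q) v e
    (row_mx (\col_i ('X^(v 0) *+ (val i == 0)%N)) V)
    (block_mx 1%:M (- 'X^(e 0) *: drow n) 0 B).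
Proof.
move=> le_ev en Z.
have n0 : (0 < n)%N by rewrite en addSn.
pose j0 : 'I_n := Ordinal n0.
set v' := fun i => _ in Z.
pose h : 'cV[{poly F}]_r.+1 := \col_i ('X^(v 0) *+ (val i == 0)%N).
have mulV k (x0 : 'M_(k, 1)) (x' : 'M[{poly F}]_(k, n)) :
    row_mx x0 x' *m (row_mx h V)^T = x0 *m h^T + x' *m V^T.
  by rewrite tr_row_mx mul_row_col.
have V0 : drow n *m V^T = \row_i ('X^(v' 0%N) *+ (val i == 0%N)).
  rewrite -[drow n]trmxK -trmx_mul (mul_drow _ (j0 := j0)) //.
  by apply/rowP => i; rewrite !mxE (zz_V0 Z).
have eX : 'X^(e 0%N) *: (drow n *m V^T) = h^T.
  apply/rowP => i; rewrite V0 !mxE mulrnAr -exprD /v' /= subnKC //.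
split.
- move=> i j; rewrite mxE; case: splitP => j' _.
    by rewrite mxE mulrb; case: eqP => [->|_]; rewrite ?size_polyXn ?size_poly0.
  have := zz_V Z i j'; rewrite /v'; case: eqP => [->|_] szV //.
  by rewrite (leq_trans szV) // ltnS leq_subr.
- move=> i j jz; rewrite mxE; case: splitP => j' ej; first by rewrite mxE.
  by move: ej; rewrite jz.
- move=> i j; rewrite mxE; case: splitP => i' ->; rewrite mxE; case: splitP => j' _.
  + by rewrite !ord1 mxE eqxx size_poly1.
  + rewrite ord1 mxE mulNr size_polyN mulrC mxE mulrC.
    by rewrite mulr_natr mulrb; case: ifP; rewrite ?size_polyXn ?size_poly0.
  + by rewrite mxE size_poly0.
  + exact: (zz_B Z).
- move=> i j jz; rewrite mxE; case: splitP => i' ei; rewrite mxE; case: splitP => j' ej.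
  + by rewrite !ord1 mxE /= ei ord1.
  + by move: ej; rewrite jz.
  + by rewrite mxE /= ei.
  + by move: ej; rewrite jz.
- rewrite block_mxEv mul_col_mx !mulV mul0mx mul1mx (zz_BV Z) addr0.
  by rewrite scaleNr mulNmx -scalemxAl eX subrr col_mx0.
- move=> K x; rewrite -[x](@hsubmxK _ 1 1 n); set x0 := lsubmx x; set x' := rsubmx x.
  clearbody x0 x' => sx; rewrite mulV => e0.
  have sx' : small K x' by move=> i j; have := sx i (rshift 1 j); rewrite row_mxEr.
  have ex0 : x0 = (x0 0 0)%:M by apply: mx11_scalar.
  have szx0 : (size (x0 0 0)%R <= K - e 0%N)%N.
    have := size_mul_bound; have hz := small_mul_tr (zz_V Z) (0 : 'I_1) 0 sx'.
    have /rowP/(_ 0) := e0; rewrite !mxE big_ord1 !mxE /= mulr1n => /eqP.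
    rewrite addr_eq0 => /eqP ez _; have := hz; rewrite mxE -size_polyN -ez.
    have [->|nz] := eqVneq (x0 0 0) 0; first by rewrite size_poly0.
    rewrite size_mulXn // /v' /=; move: le_ev; move: (size _) (v 0%N) (e 0%N) => sz b a; clear; lia.
  have [||c [ec sc]] := zz_ker Z (K := K) (x := x' + ('X^(e 0%N) * x0 0 0) *: drow n).
  + move=> i j; rewrite ord1 mxE (leq_trans (size_polyD _ _)) // geq_max sx' mxE /=.
    have [->|nz] := eqVneq (x0 0 0) 0; first by rewrite mulr0 mul0r size_poly0.
    rewrite (leq_trans (size_mul_bound (leqnn _) (size_drow j))) // addn0.
    have nz1 := nz; rewrite -size_poly_gt0 in nz1; move: szx0 nz1; rewrite mulrC size_mulXn //.
    by move: (size _) (e 0%N) => sz a; clear; lia.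
  + rewrite mulmxDl -scalemxAl mulrC -scalerA eX addrC -e0; congr (_ + _).
    by rewrite {2}ex0 mul_scalar_mx.
  exists (row_mx x0 c); split.
    rewrite mul_row_block mulmx1 mulmx0 addr0 -ec; congr row_mx.
    rewrite [x0 *m _](_ : _ = - ((x0 0 0 * 'X^(e 0%N)) *: drow n)).
      by rewrite addrCA [_ * x0 0 0]mulrC addNr addr0.
    by rewrite {1}ex0 mul_scalar_mx scalerA mulrN scaleNr.
  move=> j; rewrite mxE; case: splitP => j' ->; first by rewrite !ord1.
  exact: sc.
(* The inner matrix reaches degrees below t in the first component; the part of y_0 above t is x0
   X^(v_0), where x0 has size at most K because e_0 <= K. *)
- move=> K leK y sy; pose t := (K + v 0 - e 0)%N.
  have le0 : (e 0 <= K)%N by apply: leK.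
  pose x0 := drop_poly t (y 0 0) * 'X^(K - e 0).
  have ex0 : y 0 0 = take_poly t (y 0 0) + x0 * 'X^(v 0).
    rewrite -{1}(poly_take_drop t (y 0 0)) /x0 -mulrA -exprD.
    by congr (_ + _ * 'X^_); rewrite /t addnBAC.
  pose y' : 'rV[{poly F}]_r.+1 := \row_i (if i == 0 then take_poly t (y 0 0) else y 0 i).
  have [||x' [sx' ex']] := zz_surj Z (K := K) _ (y := y').
  + by move=> j ltj; apply: (leK j.+1).
  + move=> i; rewrite mxE /v' -[i == 0]val_eqE /=; case: eqP => [_|_]; last exact: sy.
    by rewrite (leq_trans (size_take_poly _ _)) // /t; lia.
  exists (row_mx x0%:M x'); split.
    move=> i j; rewrite ord1 mxE; case: splitP => j' _; last exact: sx'.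
    rewrite ord1 mxE eqxx /x0 mulr1n.
    have := size_drop_poly t (y 0 0); have := sy 0.
    have [->|nz] := eqVneq (drop_poly t (y 0 0)) 0; first by rewrite mul0r size_poly0.
    rewrite size_mulXn // => hh ->; move: hh le_ev le0; rewrite /t /=; move: (size _) (v 0%N) (e 0%N) => sz b a; clear; lia.
  rewrite mulV ex' mul_scalar_mx; apply/rowP => i; rewrite !mxE -val_eqE /=.
  case: eqP => [i0|_]; last by rewrite mulr0n mulr0 add0r.
  have -> : i = 0 by apply: val_inj.
by rewrite [RHS]ex0 mulr1n addrC.
Qed.

Theorem zigzag_exists n r q (v e : nat -> nat) : n = (r + q)%N ->
  (\sum_(i < r) v i = \sum_(j < q) e j)%N ->
  exists V B, @zigzag n r q v e V B.
Proof.
have shift g k : (\sum_(i < k.+1) g (i : nat) = g 0 + \sum_(i < k) g i.+1)%N.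
  by rewrite big_ord_recl; congr (_ + _)%N; apply: eq_bigr => i _; rewrite lift0.
elim: n r q v e => [|n IH] [|r] [|q] v e //= en es.
- by exists 0, 1%:M; apply: zigzag_r0; rewrite -es big_ord0.
- rewrite add0n in en; case: en => en; subst n.
  by exists 0, 1%:M; apply: zigzag_r0; rewrite -es big_ord0.
- rewrite addn0 in en; case: en => en; subst n.
  by exists 1%:M, 0; apply: zigzag_q0; rewrite es big_ord0.
have [le|lt] := leqP (v 0%N) (e 0%N).
  have en' : n = (r + q.+1)%N by lia.
  have [|V [B Z]] := IH r q.+1 (v \o S) (fun j => if j == 0 then e 0 - v 0 else e j)%N en'.
    move: es; rewrite (shift v) (shift e).
    rewrite (shift (fun j => if j == 0 then e 0 - v 0 else e j)%N) /=; lia.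
  by do 2 eexists; apply: zigzag_row Z.
have en' : n = (r.+1 + q)%N by lia.
have [|V [B Z]] := IH r.+1 q (fun i => if i == 0 then v 0 - e 0 else v i)%N (e \o S) en'.
  move: es; rewrite (shift v) (shift e).
  rewrite (shift (fun i => if i == 0 then v 0 - e 0 else v i)%N) /=; lia.
by do 2 eexists; apply: zigzag_col Z => //; apply: ltnW.
Qed.

End Zigzag.

(** * Generic eigenstructures *)

Section Eigenstructure.
Variable F : closedFieldType.

Lemma mup_dvd (p q : {poly F}) mu : q != 0 -> p %| q -> (mup mu p <= mup mu q)%N.
Proof.
move=> q0 dvd; rewrite mup_geq // (dvdp_trans _ dvd) //.
by rewrite -mup_geq //; apply: contraNneq q0 => p0; rewrite p0 dvd0p in dvd.
Qed.

Lemma mup_eqp (p q : {poly F}) mu : p != 0 -> q != 0 -> p %= q -> mup mu p = mup mu q.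
Proof.
by move=> p0 q0 /andP[pq qp]; apply/eqP; rewrite eqn_leq !mup_dvd.
Qed.

Lemma mup_full_roots (p : {poly F}) rs mu : uniq rs -> all (root p) rs ->
  size p = (size rs).+1 -> mup mu p = (mu \in rs).
Proof.
move=> urs prs sz; have p0 : p != 0 by rewrite -size_poly_gt0 sz.
have lc : ~~ root (lead_coef p)%:P mu by rewrite rootC lead_coef_eq0.
rewrite {1}(all_roots_prod_XsubC sz prs) ?uniq_rootsE // -mul_polyC.
by rewrite mupMr // mu_prod_XsubC count_uniq_mem.
Qed.

Section Toep.
Variables (n r : nat) (v : 'I_r -> nat) (V : 'M[{poly F}]_(r, n)).
Hypothesis hV : forall i j, (size (V i j) <= (v i).+1)%N.

Lemma toep_full_inv K : (0 < K)%N -> row_full (toep K v V) ->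
  exists L : 'M[{poly F}]_(r, n), V *m L^T = 1%:M.
Proof.
move=> K0 full; have surj i : exists x : 'rV[{poly F}]_n, x *m V^T = delta_mx 0 i.
  have [|x [_ ex]] := toep_full_surj hV full (y := delta_mx 0 i); last by exists x.
  move=> l; rewrite mxE eqxx /=; case: eqP => _; rewrite ?size_poly1 ?size_poly0 //; lia.
have /fin_all_exists[x hx] := surj.
exists (\matrix_i x i); rewrite -[V]trmxK -trmx_mul -[RHS]trmx1; congr trmx.
by apply/row_matrixP => i; rewrite row_mul rowK hx row1.
Qed.

(** Reversing source, V and target at their grades conjugates one convolution map into the other, so
    V is also left prime at infinity. *)
Lemma toep_full_rev K : row_full (toep K.+1 v V) -> row_full (toep K.+1 v (vrev v V)).
Proof.
move=> full; apply: surj_toep_full => y sy.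
have [|x [sx ex]] := toep_full_surj hV full (y := \row_i hrevp (K + v i) (y 0 i)).
  by move=> l; rewrite mxE (leq_trans (size_hrevp _ _)) // addSn.
exists (map_mx (hrevp K) x); split.
  by move=> i j; rewrite mxE size_hrevp.
apply/rowP => l; rewrite -[RHS](@hrevpK _ (K + v l)); last first.
  by have := sy l; rewrite addSn.
move/rowP/(_ l): ex; rewrite [RHS]mxE => <-; apply: eq_poly_nz => z z0.
rewrite horner_hrevp //; last first.
  by have := small_mul_tr hV (0 : 'I_1) l sx; rewrite addSn.
rewrite !mxE !horner_sum mulr_sumr; apply: eq_bigr => j _.
rewrite !mxE !hornerM (horner_hrevp (sx 0 j) z0) (horner_hrevp (hV l j) z0).
by rewrite exprD; ring.
Qed.

End Toep.

Section Fact.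
Variables (n r d : nat) (v : 'I_r -> nat) (V L : 'M[{poly F}]_(r, n)) (D : 'M[{poly F}]_r).
Variable Q : 'M[{poly F}]_n.
Hypothesis fQ : sym_fact d v V D Q.
Hypothesis VL : V *m L^T = 1%:M.

Lemma sym_fact_extract : D = L *m Q *m L^T.
Proof.
have LV : L *m V^T = 1%:M by rewrite -[L]trmxK -trmx_mul VL trmx1.
by rewrite (sf_eq fQ) !mulmxA LV mul1mx -mulmxA VL mulmx1.
Qed.

Lemma sym_fact_rank : mprank Q = r.
Proof.
apply/eqP; rewrite eqn_leq; apply/andP; split.
  rewrite /mprank /mpfrac (sf_eq fQ) !map_mxM.
  by rewrite (leq_trans (mxrankM_maxr _ _)) // rank_leq_row.
have u : map_mx (@tofrac {poly F}) D \in unitmx.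
  by rewrite unitmxE det_map_mx unitfE tofrac_eq0 (sf_det fQ).
rewrite -[X in (X <= _)%N](mxrank_unit u) sym_fact_extract !map_mxM.
by rewrite (leq_trans (mxrankM_maxl _ _)) // mxrankM_maxr.
Qed.

Lemma sym_fact_ker k (x : 'M[{poly F}]_(k, n)) :
  (mpfrac x <= kermx (mpfrac Q))%MS = (x *m V^T == 0).
Proof.
rewrite sub_kermx -map_mxM; have -> : (map_mx (@tofrac {poly F}) (x *m Q) == 0) = (x *m Q == 0).
  apply/eqP/eqP => [e|->]; last by rewrite map_mx0.
  by apply: (@mpfrac_inj F k n); rewrite /mpfrac e map_mx0.
apply/eqP/eqP => [e|e]; last by rewrite (sf_eq fQ) !mulmxA e !mul0mx.
have := congr1 (fun M => M *m L^T *m \adj D) e.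
rewrite !mul0mx (sf_eq fQ) -!mulmxA (mulmxA V) VL mul1mx mul_mx_adj.
rewrite mulmxA mul_mx_scalar => /matrixP e'; apply/matrixP => i j.
have := e' i j; rewrite [LHS]mxE [RHS]mxE => /eqP.
by rewrite mulf_eq0 (negPf (sf_det fQ)) /= [RHS]mxE => /eqP.
Qed.

Lemma smith_exists : exists ps, [/\ invariant_polynomials Q ps, size ps = r
  & forall mu, mup mu (\prod_(p <- ps) p) = mup mu (\det D)].
Proof.
have [ps [szps mps sps [U [W [uU uW e]]]]] := smith_form Q.
have ips : invariant_polynomials Q ps by split=> //; exists U, W.
have szr : size ps = r by rewrite -(mprank_smith ips) sym_fact_rank.
exists ps; split=> // mu; apply: mup_eqp; last 1 first.
- rewrite /eqp (det_dvd_smith_prod (sf_eq fQ) szr ips).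
  by rewrite (smith_prod_dvd_det (sf_eq fQ) VL szr ips).
- by rewrite monic_neq0 // monic_prod_seq.
- exact: sf_det fQ.
Qed.

End Fact.

(** The Toeplitz conditions give the minimal indices and right inverses of V and of its reversal, so
    the elementary divisors are those of det D. The zero count leaves room only for the exhibited
    simple zeros. *)
Lemma generic_eigenstructure n r d (v : 'I_r -> nat) (V : 'M[{poly F}]_(r, n))
    D (Q : 'M[{poly F}]_n) rs (b : bool) (a := (\sum_i v i)%N)
    (alpha := (a %/ (n - r))%N) (s := (a %% (n - r))%N) :
  (r < n)%N -> sym_fact d v V D Q ->
  row_free (toep alpha v V) -> row_full (toep alpha.+1 v V) ->
  uniq rs -> all (root (\det D)) rs -> (b -> root (\det (drev d v D)) 0) ->
  (r * d <= size rs + b + 2 * a)%N ->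
  let idx := nseq s alpha.+1 ++ nseq (n - r - s) alpha in
  has_eigenstructure d Q (Eigenstructure (simple_divisors rs b) idx idx)
  /\ (size rs + b + 2 * a = r * d)%N.
Proof.
move=> ltrn fQ inj full urs prs qb le_deg idx.
have hV := sf_V fQ; have [L VL] := toep_full_inv hV (ltn0Sn _) full.
have fQ' := sym_fact_rev fQ; have full' := toep_full_rev hV full.
have [L' VL'] := toep_full_inv (sf_V fQ') (ltn0Sn _) full'.
have p0 := sf_det fQ; have q0 := sf_det fQ'.
have deg := det_degree (sf_D fQ) p0; rewrite -/a in deg.
have szrs : (size rs < size (\det D))%N by apply: max_poly_roots.
have leb : (b <= mup 0 (\det (drev d v D)))%N.
  by case: (b) qb => // /(_ isT); rewrite -dvdp_XsubCl XsubC_dvd.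
(* deg det D is at least [size rs], the order at infinity at least [b], and [deg] fixes their sum:
   both are equalities. *)
have szD : size (\det D) = (size rs).+1.
  by move: deg le_deg szrs leb; move: (size (\det D)) (mup _ _) (size rs) (nat_of_bool b); clear; lia.
have mupD : mup 0 (\det (drev d v D)) = b.
  by move: deg le_deg szrs leb; move: (size (\det D)) (mup _ _) (size rs) (nat_of_bool b); clear; lia.
split; last by rewrite -deg szD mupD /= [(_ + 2 * a)%N]addnC addnC.
have [ps [ips szps eps]] := smith_exists fQ VL.
have [qs [iqs szqs eqs]] := smith_exists fQ' VL'.
have lmi : left_minimal_indices Q idx.
  exact: balanced_left_indices hV _ (sym_fact_ker fQ VL) (sym_fact_rank fQ VL) ltrn inj full.
have symQ : Q^T = Q.
  by rewrite (sf_eq fQ) !trmx_mul trmxK (sf_sym fQ) mulmxA.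
split; [rewrite [es_divisors _]/= | exact: lmi | rewrite /right_minimal_indices symQ; exact: lmi].
apply: (simple_elementary_divisors ips iqs) => // [mu|].
  by rewrite eps; apply: mup_full_roots.
by rewrite eqs.
Qed.

Lemma balanced_pattern n r (v : 'I_r -> nat) (a := (\sum_i v i)%N)
    (alpha := (a %/ (n - r))%N) : (r < n)%N ->
  exists V : 'M[{poly F}]_(r, n),
  [/\ forall i j, (size (V i j) <= (v i).+1)%N,
    row_free (toep alpha v V) & row_full (toep alpha.+1 v V)].
Proof.
move=> ltrn; pose q := (n - r)%N; pose s := (a %% q)%N.
have q0 : (0 < q)%N by rewrite subn_gt0.
have en : n = (r + q)%N by rewrite subnKC // ltnW.
have lts : (s < q)%N by rewrite ltn_mod.
pose v' (i : nat) := if insub i is Some i' then v i' else 0%N.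
have ev (i : 'I_r) : v' i = v i.
  by rewrite /v' insubT //= => h; congr v; apply: val_inj.
(* The balanced distribution of a over q kernel degrees: s of them are alpha + 1, the rest alpha. *)
pose e (j : nat) := (alpha + (j < s))%N.
have sume : (\sum_(j < q) e j = a)%N.
  rewrite big_split /= sum_nat_const card_ord [RHS](divn_eq a q) mulnC.
  congr (_ + _)%N; rewrite -(big_mkord xpredT (fun j => (j < s : nat)%N)).
  rewrite (big_cat_nat _ (n := s)) //=; last exact: ltnW.
  rewrite (eq_big_nat _ _ (F2 := fun=> 1%N)); last by move=> j /andP[_ ->].
  rewrite sum_nat_const_nat subn0 muln1 [X in (_ + X)%N]big_nat_cond big1 ?addn0 //.
  by move=> j /andP[/andP[le _] _]; rewrite ltnNge le.
have [|V [B Z]] := @zigzag_exists F n r q v' e en.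
  by rewrite sume; apply: eq_bigr.
exists V.
have hV i j : (size (V i j) <= (v i).+1)%N by rewrite -ev; apply: (zz_V Z).
split=> //.
  apply: inj_toep_free => // x sx /(zz_ker Z sx)[c [-> sc]].
  suff -> : c = 0 by rewrite mul0mx.
  apply/rowP => j; rewrite mxE; apply/eqP; rewrite -size_poly_eq0 -leqn0.
  by rewrite (leq_trans (sc j)) // leqn0 subn_eq0 leq_addr.
apply: surj_toep_full => // y sy; apply: (zz_surj Z) => [j _|i].
  by rewrite /e; case: (_ < _)%N; rewrite ?addn1 ?addn0 ?leqnSn.
by rewrite ev; apply: sy.
Qed.

End Eigenstructure.

(** * Algebraic input for openness *)

Section Openness.
Variable F : closedFieldType.

Section Indices.
Variables (n d q alpha s : nat) (P : 'M[{poly F}]_n) (l : seq nat).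
Hypothesis hP : forall i j, (size (P i j) <= d.+1)%N.
Hypothesis symP : P^T = P.
Hypothesis minP : left_minimal_indices P l.
Hypothesis perm_l : perm_eq l (nseq s alpha.+1 ++ nseq (q - s) alpha).

Lemma balanced_rank : (s <= q)%N -> (q <= n)%N -> mprank P = (n - q)%N.
Proof.
move=> le_sq le_qn; have [k [B [[bB _] el]]] := minP.
have ek := poly_basis_rank bB; rewrite mxrank_ker in ek.
have := perm_size el; rewrite (perm_size perm_l) size_cat !size_nseq size_map size_enum_ord.
rewrite subnKC // => qk; have := rank_leq_row (mpfrac P); rewrite -/(mprank P).
by move: ek; rewrite -/(mprank P) -qk; lia.
Qed.

Lemma balanced_toep_free : row_free (toep alpha (fun _ : 'I_n => d) P).
Proof.
have [k [B [mB el]]] := minP.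
have lb i : (alpha <= row_degree B i)%N.
  have : row_degree B i \in l.
    by rewrite (perm_mem el); apply/mapP; exists i; rewrite ?mem_enum.
  rewrite (perm_mem perm_l) mem_cat !mem_nseq.
  by case/orP=> /andP[_ /eqP ->]; rewrite ?leqnSn.
apply: inj_toep_free => // x sx; rewrite symP => xP.
apply: contraTeq (leqnn alpha) => x0; rewrite -ltnNge.
have [[_ eB] _] := mB.
have /submxP[c ec] : (mpfrac x <= mpfrac B)%MS.
  by rewrite eB sub_kermx -map_mxM xP map_mx0.
have c0 : c != 0.
  apply: contraNneq x0 => c0; apply/eqP; apply: (@mpfrac_inj F 1 n).
  by rewrite ec c0 mul0mx /mpfrac map_mx0.
have /rV0Pn[i ci] := c0; have [j lt] := exchange mB ec ci.
by rewrite (leq_ltn_trans (lb i)) // (leq_trans lt) // sx.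
Qed.

Lemma balanced_toep_nullity :
  (n * alpha.+1 <= \rank (toep alpha.+1 (fun _ : 'I_n => d) P) + (q - s))%N.
Proof.
have hV : forall i j, (size (P i j) <= ((fun _ : 'I_n => d) i).+1)%N by [].
have [m' em'] : exists m', m' = (n * alpha.+1 - \rank (toep alpha.+1 (fun _ : 'I_n => d) P))%N by eexists.
have [G [sG GV iG _]] := toep_kernel_basis hV em'.
have fG := eval_free (eval0_free (toep_free_inj hV balanced_toep_free) sG GV iG).
have [k [B [mB el]]] := minP.
have := count_degrees_le (A := kermx (mpfrac P)) (B' := G) alpha mB fG.
have -> : #|[pred i | row_degree G i <= alpha]%N| = m'.
  rewrite (eq_card (B := predT)) ?card_ord // => i; rewrite !inE row_degree_le.
  by apply/forallP => j; apply: sG.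
have -> : #|[pred i | row_degree B i <= alpha]%N| = (q - s)%N.
  rewrite -(count_codom (row_degree B) (fun e => e <= alpha)%N) -(seq.permP el) (seq.permP perm_l).
  by rewrite count_cat !count_nseq ltnn leqnn mul1n.
have -> : (mpfrac G <= kermx (mpfrac P))%MS.
  have GP : G *m P = 0 by rewrite -[X in G *m X]symP.
  by rewrite sub_kermx -map_mxM GP map_mx0.
by move=> /(_ isT); rewrite em'; lia.
Qed.

End Indices.

(** Since x V^T = 0 implies x P = 0, the kernels of the Toeplitz matrices of V are no larger than
    those of P. The column count r (alpha + 1) + sum v_i then bounds sum v_i below, with equality
    exactly when the rank is full. *)
Lemma sym_fact_near n d r (v : 'I_r -> nat) (V : 'M[{poly F}]_(r, n)) D
    (P : 'M[{poly F}]_n) alpha m :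
  sym_fact d v V D P ->
  row_free (toep alpha (fun _ : 'I_n => d) P) ->
  (n * alpha.+1 <= \rank (toep alpha.+1 (fun _ : 'I_n => d) P) + m)%N ->
  [/\ row_free (toep alpha v V),
      (n * alpha.+1 <= r * alpha.+1 + \sum_i v i + m)%N
    & (n * alpha.+1 = r * alpha.+1 + \sum_i v i + m)%N -> row_full (toep alpha.+1 v V)].
Proof.
move=> fP freeP nullP; have hV := sf_V fP.
have hP : forall i j, (size (P i j) <= ((fun _ : 'I_n => d) i).+1)%N := size_sym_fact fP.
have symP : P^T = P.
  by rewrite (sf_eq fP) !trmx_mul trmxK (sf_sym fP) mulmxA.
have kerP k (x : 'M[{poly F}]_(k, n)) : x *m V^T = 0 -> x *m P^T = 0.
  by move=> xV; rewrite symP (sf_eq fP) !mulmxA xV !mul0mx.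
have free : row_free (toep alpha v V).
  apply: inj_toep_free => // x sx /kerP; exact: toep_free_inj hP freeP x sx.
have [m' em'] : exists m', m' = (n * alpha.+1 - \rank (toep alpha.+1 v V))%N by eexists.
have [G [sG GV iG _]] := toep_kernel_basis hV em'.
have := toep_rank_le hP sG (kerP _ _ GV) iG.
have := rank_leq_row (toep alpha.+1 v V); rewrite [X in (_ <= X)%N]card_src => le1 le2.
have := rank_leq_col (toep alpha.+1 v V); rewrite [X in (_ <= X)%N]card_tgt => le3.
split=> //; first by move: em' le1 le2 le3 nullP; lia.
move=> e; rewrite /row_full [X in _ == X]card_tgt eqn_leq le3 /=.
have {}e := eq_leq (esym e).
move: em' le1 le2 le3 nullP e; rewrite !mulnS; clear.
move: (\sum_i v i)%N => sv; lia.
Qed.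

(** On the line WA + t WC both determinants are nonzero polynomials in t, so some t avoids the roots
    of both. *)
Lemma common_complement r n (A C : 'M[F]_(r, n)) : row_free A -> row_free C ->
  exists W : 'M[F]_(n, r), \det (A *m W) != 0 /\ \det (C *m W) != 0.
Proof.
move=> /row_freeP[WA AA] /row_freeP[WC CC].
pose p1 := \det (1%:M + 'X *: cmx (A *m WC)).
pose p2 := \det (cmx (C *m WA) + 'X%:M).
have p10 : p1 != 0.
  apply: contraTneq (oner_neq0 F) => /(congr1 (horner_eval 0)).
  rewrite -det_map_mx map_mxD map_mx1 map_mxZ eval_polyC_mx rmorph0 /=.
  by rewrite /horner_eval hornerX scale0r addr0 det1 => ->; rewrite eqxx.
have p20 : p2 != 0.
  have -> : p2 = char_poly (- (C *m WA)).
    rewrite /p2 /char_poly /char_poly_mx; congr (\det _).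
    by rewrite map_mxN opprK addrC.
  by rewrite monic_neq0 // char_poly_monic.
have /closed_nonrootP[t] : p1 * p2 != 0 by rewrite mulf_neq0.
rewrite rootM negb_or => /andP[t1 t2]; exists (WA + t *: WC); split.
  move: t1; rewrite rootE -[_.[_]]/(horner_eval t _) -det_map_mx map_mxD map_mx1 map_mxZ.
  by rewrite eval_polyC_mx /= /horner_eval hornerX mulmxDr AA -scalemxAr.
move: t2; rewrite rootE -[_.[_]]/(horner_eval t _) -det_map_mx map_mxD map_scalar_mx.
by rewrite eval_polyC_mx /= /horner_eval hornerX mulmxDr -scalemxAr CC scalemx1.
Qed.

Lemma simple_rootP (g : {poly F}) mu : g != 0 -> mup mu g = 1%N ->
  root g mu /\ g^`().[mu] != 0.
Proof.
move=> g0 mg; have dvd1 : 'X - mu%:P %| g by rewrite XsubC_dvd // mg.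
split; first by rewrite -dvdp_XsubCl.
have eg : g = g %/ ('X - mu%:P) * ('X - mu%:P) by rewrite divpK.
rewrite eg derivM derivXsubC mulr1 hornerD hornerM hornerXsubC subrr mulr0 add0r.
rewrite -rootE -dvdp_XsubCl; apply/negP => dvd.
have : (2 <= mup mu g)%N by rewrite mup_geq // eg expr2 dvdp_mul2r ?polyXsubC_eq0.
by rewrite mg.
Qed.

Lemma eval_unitmx n (U : 'M[{poly F}]_n) x : U \in unitmx ->
  map_mx (horner_eval x) U \in unitmx.
Proof. by rewrite !unitmxE det_map_mx => /(rmorph_unit (horner_eval x)). Qed.

(** Through the Smith form, det(W^T P W) is the product of the invariant polynomials times two outer
    determinants, which a suitable constant W keeps nonzero at mu. *)
Lemma compression_simple_root n r (P : 'M[{poly F}]_n) ps mu :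
  invariant_polynomials P ps -> size ps = r -> mup mu (\prod_(p <- ps) p) = 1%N ->
  exists W : 'M[F]_(n, r),
    let g := \det ((cmx W)^T *m P *m cmx W) in root g mu /\ g^`().[mu] != 0.
Proof.
move=> ips szr m1; subst r; have [szps mps _ [U [U' [uU uU' e]]]] := ips.
pose E := pinj {poly F} (size ps) n.
have eE x : map_mx (horner_eval x) E = pinj F (size ps) n.
  by apply/matrixP => i j; rewrite !mxE rmorph_nat.
have fE : row_free (pinj F (size ps) n).
  by apply/row_freeP; exists (pinj F (size ps) n)^T; rewrite pinj_mul_tr.
pose A := E *m (invmx U)^T; pose C := E *m invmx U'.
have fA : row_free (map_mx (horner_eval mu) A).
  rewrite map_mxM eE /row_free mxrankMfree //.
  by rewrite row_free_unit -map_trmx unitmx_tr eval_unitmx // unitmx_inv.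
have fC : row_free (map_mx (horner_eval mu) C).
  by rewrite map_mxM eE /row_free mxrankMfree // row_free_unit eval_unitmx // unitmx_inv.
have [W [AW CW]] := common_complement fA fC; exists W => g.
have eg : g = \det (A *m cmx W) * (\prod_(p <- ps) p) * \det (C *m cmx W).
  have -> : \det (A *m cmx W) = \det ((cmx W)^T *m invmx U *m E^T).
    by rewrite -det_tr /A !trmx_mul trmxK mulmxA.
  have -> : C *m cmx W = E *m (invmx U' *m cmx W) by rewrite mulmxA.
  rewrite -det_through_smith // /g; congr (\det _).
  by rewrite /smith_diag -e !mulmxA mulmxKV // -!mulmxA mulKVmx // mulVmx // mulmx1 //.
have nrA : ~~ root (\det (A *m cmx W)) mu.
  by rewrite rootE -[_.[_]]/(horner_eval mu _) -det_map_mx map_mxM eval_polyC_mx.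
have nrC : ~~ root (\det (C *m cmx W)) mu.
  by rewrite rootE -[_.[_]]/(horner_eval mu _) -det_map_mx map_mxM eval_polyC_mx.
have nz (p : {poly F}) x : ~~ root p x -> p != 0 by apply: contraNneq => ->; rewrite root0.
apply: simple_rootP; last by rewrite eg mupMl // mupMr.
by rewrite eg !mulf_neq0 ?(nz _ _ nrA) ?(nz _ _ nrC) // monic_neq0 // monic_prod_seq.
Qed.

End Openness.

(** * Perturbation *)

Import ComplexField.Normc.

Section PolyNorm.
Variable R : realType.
Notation C := R[i].
Implicit Types (p q : {poly C}) (w : R).

Lemma normc_ge0 (x : C) : 0 <= normc x.
Proof. by rewrite /normc; case: x => a b; rewrite sqrtr_ge0. Qed.

Lemma normc_gt0 (x : C) : x != 0 -> 0 < normc x.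
Proof.
by move=> x0; rewrite lt_neqAle normc_ge0 andbT eq_sym; apply: contraNneq x0 => /eq0_normc ->.
Qed.

Lemma le_normcB (x y : C) : normc (x - y) <= normc x + normc y.
Proof. by rewrite (le_trans (le_normcD _ _)) // normcN. Qed.

Lemma normcB_ge (x y : C) : normc x - normc (y - x) <= normc y.
Proof.
by have := le_normcB y (y - x); rewrite subKr lerBlDr.
Qed.

(** Weighted l1 norm of the coefficients: submultiplicative, and for w >= 0 an upper bound for |p|
    on the disk of radius w. *)
Definition pnorm w p : R := \sum_(k < size p) normc p`_k * w ^+ k.

Lemma pnorm_wide w p n : (size p <= n)%N -> pnorm w p = \sum_(k < n) normc p`_k * w ^+ k.
Proof.
move=> le; rewrite /pnorm -!(big_mkord xpredT (fun k => normc p`_k * w ^+ k)).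
rewrite (big_cat_nat _ (n := size p) (p := n)) //= [X in _ = _ + X]big_nat_cond.
rewrite [X in _ = _ + X]big1 ?addr0 // => k /andP[/andP[lek _] _].
by rewrite nth_default // normc0 mul0r.
Qed.

Lemma pnorm_ge0 w p : 0 <= w -> 0 <= pnorm w p.
Proof. by move=> w0; apply: sumr_ge0 => k _; rewrite mulr_ge0 ?normc_ge0 ?exprn_ge0. Qed.

Lemma pnorm0 w : pnorm w 0 = 0.
Proof. by rewrite /pnorm size_poly0 big_ord0. Qed.

Lemma pnormC w (c : C) : pnorm w c%:P = normc c.
Proof. by rewrite (@pnorm_wide _ _ 1) ?size_polyC_leq1 // big_ord1 coefC expr0 mulr1. Qed.

Lemma pnormD w p q : 0 <= w -> pnorm w (p + q) <= pnorm w p + pnorm w q.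
Proof.
move=> w0; pose n := maxn (size p) (size q).
rewrite !(@pnorm_wide _ _ n) ?leq_maxl ?leq_maxr ?size_polyD // -big_split /=.
by apply: ler_sum => k _; rewrite coefD -mulrDl ler_wpM2r ?exprn_ge0 ?le_normcD.
Qed.

Lemma pnormZ w (c : C) p : pnorm w (c *: p) = normc c * pnorm w p.
Proof.
rewrite (@pnorm_wide _ _ (size p)) ?size_scale_leq // mulr_sumr.
by apply: eq_bigr => k _; rewrite coefZ normcM mulrA.
Qed.

Lemma pnormMXaddC w p (c : C) : pnorm w (p * 'X + c%:P) = w * pnorm w p + normc c.
Proof.
rewrite (@pnorm_wide _ _ (size p).+1); last first.
  rewrite (leq_trans (size_polyD _ _)) // geq_max (leq_trans (size_polyC_leq1 _)) // andbT.
  by rewrite (leq_trans (size_polyMleq _ _)) // size_polyX addn2.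
rewrite big_ord_recl addrC expr0 mulr1 coefD coefMX coefC /= add0r; congr (_ + _).
rewrite /pnorm mulr_sumr; apply: eq_bigr => k _; rewrite coefD coefMX coefC /=.
by rewrite addr0 exprS mulrCA.
Qed.

Lemma pnormM w p q : 0 <= w -> pnorm w (p * q) <= pnorm w p * pnorm w q.
Proof.
move=> w0; elim/poly_ind: p => [|p c IH]; first by rewrite mul0r pnorm0 mul0r.
rewrite pnormMXaddC mulrDl mulrDl mulrAC mul_polyC.
rewrite (le_trans (pnormD _ _ w0)) // pnormZ lerD2r -[_ * 'X]addr0 -polyC0 pnormMXaddC.
by rewrite normc0 addr0 -mulrA ler_wpM2l.
Qed.

Lemma horner_pnorm w p (z : C) : normc z <= w -> normc p.[z] <= pnorm w p.
Proof.
move=> zw; have w0 := le_trans (normc_ge0 z) zw.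
elim/poly_ind: p => [|p c IH]; first by rewrite horner0 normc0 pnorm0.
rewrite pnormMXaddC hornerMXaddC (le_trans (le_normcD _ _)) // lerD2r normcM mulrC.
by rewrite ler_pM ?normc_ge0.
Qed.

Lemma pnorm_mono w w' p : 0 <= w -> w <= w' -> pnorm w p <= pnorm w' p.
Proof.
move=> w0 le; apply: ler_sum => k _; rewrite ler_wpM2l ?normc_ge0 //.
by rewrite lerXn2r // nnegrE // (le_trans w0).
Qed.

Lemma deriv_pnorm w p (z : C) : 1 <= w -> normc z <= w ->
  normc p^`().[z] <= pnorm (2 * w) p.
Proof.
move=> w1 zw; have w0 : 0 <= w by lra.
have ww : 0 <= 2 * w by lra.
elim/poly_ind: p => [|p c IH]; first by rewrite deriv0 horner0 normc0 pnorm_ge0.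
rewrite derivD derivM derivX derivC addr0 mulr1 hornerD hornerMX pnormMXaddC.
have h1 : normc p.[z] <= pnorm (2 * w) p.
  rewrite (le_trans (horner_pnorm _ zw)) // pnorm_mono //; lra.
rewrite (le_trans (le_normcD _ _)) // normcM.
have := normc_ge0 c; have : normc p^`().[z] * normc z <= pnorm (2 * w) p * w.
  by rewrite ler_pM ?normc_ge0.
have : pnorm (2 * w) p <= pnorm (2 * w) p * w by rewrite ler_peMr ?pnorm_ge0.
lra.
Qed.

(** The bound |h'/h| = |sum 1/(mu - z)| <= deg h / rho, cleared of denominators. It replaces
    Rouche's theorem as the source of nearby roots. *)
Lemma log_deriv_bound (h : {poly C}) (mu : C) rho : 0 < rho ->
  (forall z, root h z -> rho <= normc (z - mu)) ->
  rho * normc h^`().[mu] <= (size h).-1%:R * normc h.[mu].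
Proof.
move=> rho0; have [->|h0 far] := eqVneq h 0.
  by rewrite deriv0 !horner0 normc0 !mulr0.
have [rs eh] := closed_field_poly_normal h.
have lc0 : lead_coef h != 0 by rewrite lead_coef_eq0.
have szh : size h = (size rs).+1.
  by rewrite eh size_scale // size_prod_XsubC.
have {}far z : z \in rs -> rho <= normc (z - mu).
  by move=> zrs; apply: far; rewrite eh rootZ // root_prod_XsubC.
rewrite szh /= eh derivZ !hornerZ !normcM mulrCA [X in _ <= X]mulrCA.
rewrite ler_wpM2l ?normc_ge0 //.
elim: rs far {eh szh} => [|z rs IH] far.
  by rewrite big_nil derivC horner0 normc0 mulr0 mul0r.
have {}IH := IH (fun x xrs => far x (@mem_behead _ (z :: rs) x xrs)).
have hz : rho <= normc (mu - z) by rewrite -normcN opprB far ?mem_head.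
rewrite big_cons derivM derivXsubC mul1r hornerD !hornerM !hornerXsubC.
set p := \prod_(_ <- _) _; rewrite -/p in IH.
have := le_normcD p.[mu] ((mu - z) * p^`().[mu]); rewrite !normcM /= -natr1.
have := normc_ge0 p.[mu]; move: IH hz; move: (normc (mu - z)) (normc p.[mu]) (normc p^`().[mu]).
move: (normc (_ + _)) ((size rs)%:R : R) => X N a b e IH ha b0 hX.
have : rho * X <= rho * (b + a * e) by rewrite ler_pM2l.
have : a * (rho * e) <= a * (N * b) by rewrite ler_wpM2l // (le_trans (ltW rho0)).
have : rho * b <= a * b by rewrite ler_wpM2r.
nra.
Qed.

End PolyNorm.

(** * Continuity and semicontinuity near a fixed polynomial *)

Section Perturbation.
Variable R : realType.
Notation C := R[i].
Variables (n d : nat) (P : 'M[{poly C}]_n).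
Hypothesis hP : forall i j, (size (P i j) <= d.+1)%N.

Definition close (delta : R) (P' : 'M[{poly C}]_n) : Prop :=
  (forall i j, (size (P' i j) <= d.+1)%N) /\
  (forall i j k, normc ((P' i j)`_k - (P i j)`_k) < delta).

Definition nearby (Q : 'M[{poly C}]_n -> Prop) : Prop :=
  exists delta, 0 < delta /\ forall P', close delta P' -> Q P'.

Lemma nearby_and Q1 Q2 : nearby Q1 -> nearby Q2 -> nearby (fun P' => Q1 P' /\ Q2 P').
Proof.
move=> [d1 [d1p h1]] [d2 [d2p h2]]; exists (Num.min d1 d2).
split; first by rewrite lt_min d1p.
move=> P' [sz cl]; split; [apply: h1 | apply: h2]; split=> // i j k.
  by have := cl i j k; rewrite lt_min => /andP[].
by have := cl i j k; rewrite lt_min => /andP[].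
Qed.

Lemma nearby_mono (Q1 Q2 : 'M[{poly C}]_n -> Prop) :
  (forall P', Q1 P' -> Q2 P') -> nearby Q1 -> nearby Q2.
Proof. by move=> h [e [e0 h1]]; exists e; split=> // P' /h1/h. Qed.

Lemma nearby_all (T : eqType) (s : seq T) (Q : T -> 'M[{poly C}]_n -> Prop) :
  (forall x, x \in s -> nearby (Q x)) ->
  nearby (fun P' => forall x, x \in s -> Q x P').
Proof.
elim: s => [|x s IH] h; first by exists 1; split=> // P' _ x; rewrite in_nil.
have h1 := h x (mem_head _ _).
have h2 : nearby (fun P' => forall x, x \in s -> Q x P').
  by apply: IH => y ys; apply: h; rewrite in_cons ys orbT.
apply: nearby_mono (nearby_and h1 h2) => P' [q1 q2] y.
by rewrite in_cons => /orP[/eqP->|/q2].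
Qed.

(** Continuity at the fixed P only, for every weight w at once. *)
Definition pcont (f : 'M[{poly C}]_n -> {poly C}) : Prop :=
  forall w e, 0 <= w -> 0 < e -> nearby (fun P' => pnorm w (f P' - f P) < e).

Lemma pcont_ext f g : (forall P', f P' = g P') -> pcont f -> pcont g.
Proof.
move=> e h w eps w0 eps0; apply: nearby_mono (h w eps w0 eps0) => P'.
by rewrite !e.
Qed.

Lemma pcont_cst c : pcont (fun _ => c).
Proof. by move=> w e w0 e0; exists 1; split=> // P' _; rewrite subrr pnorm0. Qed.

Lemma pcontD f g : pcont f -> pcont g -> pcont (fun P' => f P' + g P').
Proof.
move=> hf hg w e w0 e0; have e2 : 0 < e / 2 by lra.
apply: nearby_mono (nearby_and (hf w _ w0 e2) (hg w _ w0 e2)) => P' [h1 h2].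
rewrite opprD addrACA (le_lt_trans (pnormD _ _ w0)) //; lra.
Qed.

Lemma pcontM f g : pcont f -> pcont g -> pcont (fun P' => f P' * g P').
Proof.
move=> hf hg w e w0 e0.
pose a := pnorm w (f P); pose b := pnorm w (g P).
have a0 : 0 <= a by apply: pnorm_ge0. have b0 : 0 <= b by apply: pnorm_ge0.
pose e1 := e / (2 * (b + 1)); pose e2 := Num.min 1 (e / (2 * (a + 1))).
have e10 : 0 < e1 by rewrite divr_gt0 //; lra.
have e20 : 0 < e2 by rewrite lt_min ltr01 divr_gt0 //; lra.
apply: nearby_mono (nearby_and (hf w _ w0 e10) (hg w _ w0 e20)) => P' [h1 h2].
have -> : f P' * g P' - f P * g P = (f P' - f P) * (g P + (g P' - g P)) + f P * (g P' - g P) by ring.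
rewrite (le_lt_trans (pnormD _ _ w0)) //.
have := pnormM (f P) (g P' - g P) w0.
have := pnormM (f P' - f P) (g P + (g P' - g P)) w0.
have := pnormD (g P) (g P' - g P) w0; rewrite -/a -/b.
have := pnorm_ge0 (f P' - f P) w0; have := pnorm_ge0 (g P' - g P) w0.
move: h1 h2; rewrite lt_min => h1 /andP[h2 h3].
move: h1 h2 h3.
move: (pnorm w (f P' - f P)) (pnorm w (g P' - g P)) (pnorm w (g P + _)) => x y z h1 h2 h3.
move: (pnorm _ _) (pnorm _ _) => s t y0 x0 hz hs ht.
have {}h1 : x * (b + 1) < e / 2.
  by have : x * (2 * (b + 1)) < e; [rewrite -ltr_pdivlMr //; lra | lra].
have {}h3 : y * (a + 1) < e / 2.
  by have : y * (2 * (a + 1)) < e; [rewrite -ltr_pdivlMr //; lra | lra].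
have : x * z <= x * (b + 1) by rewrite ler_wpM2l //; lra.
have : a * y <= y * (a + 1) by lra.
lra.
Qed.

Lemma pcont_sum (I : Type) (s : seq I) (F : I -> 'M[{poly C}]_n -> {poly C}) :
  (forall i, pcont (F i)) -> pcont (fun P' => \sum_(i <- s) F i P').
Proof.
move=> h; elim: s => [|i s IH].
  by apply: pcont_ext (pcont_cst 0) => P'; rewrite big_nil.
by apply: pcont_ext (pcontD (h i) IH) => P'; rewrite big_cons.
Qed.

Lemma pcont_prod (I : Type) (s : seq I) (F : I -> 'M[{poly C}]_n -> {poly C}) :
  (forall i, pcont (F i)) -> pcont (fun P' => \prod_(i <- s) F i P').
Proof.
move=> h; elim: s => [|i s IH].
  by apply: pcont_ext (pcont_cst 1) => P'; rewrite big_nil.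
by apply: pcont_ext (pcontM (h i) IH) => P'; rewrite big_cons.
Qed.

Lemma pcont_mulmx a b c (F : 'M[{poly C}]_n -> 'M[{poly C}]_(a, b))
    (G : 'M[{poly C}]_n -> 'M[{poly C}]_(b, c)) :
  (forall i j, pcont (fun P' => F P' i j)) -> (forall i j, pcont (fun P' => G P' i j)) ->
  forall i j, pcont (fun P' => (F P' *m G P') i j).
Proof.
move=> hF hG i j; apply: (@pcont_ext (fun P' => \sum_k F P' i k * G P' k j)).
  by move=> P'; rewrite mxE.
by apply: pcont_sum => k; apply: pcontM.
Qed.

Lemma pcont_det a (F : 'M[{poly C}]_n -> 'M[{poly C}]_a) :
  (forall i j, pcont (fun P' => F P' i j)) -> pcont (fun P' => \det (F P')).
Proof.
move=> hF; apply: pcont_sum => s; apply: pcontM; first exact: pcont_cst.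
exact: pcont_prod.
Qed.

Lemma pcont_coef i j k : pcont (fun P' => ((P' i j)`_k)%:P).
Proof.
move=> w e w0 e0; exists e; split=> // P' [_ cl].
by rewrite -polyCB pnormC cl.
Qed.

Lemma pcont_poly N i j (g : nat -> nat) : pcont (fun P' => \poly_(k < N) (P' i j)`_(g k)).
Proof.
apply: (@pcont_ext (fun P' => \sum_(k < N) ((P' i j)`_(g k))%:P * 'X^k)).
  by move=> P'; rewrite poly_def; apply: eq_bigr => k _; rewrite mul_polyC.
apply: pcont_sum => k; apply: pcontM; [exact: pcont_coef | exact: pcont_cst].
Qed.

Lemma pcont_rev i j : pcont (fun P' => mprev d P' i j).
Proof. by apply: pcont_ext (pcont_poly d.+1 i j (fun k => d - k)%N) => P'; rewrite mxE. Qed.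

(* [close] bounds every coefficient but not the degree: the grade condition turns the *)
(* entry into a fixed finite sum of its coefficients.                                 *)
Lemma pcont_entry i j : pcont (fun P' => P' i j).
Proof.
move=> w e w0 e0; have [dl [dl0 h]] := pcont_poly d.+1 i j id w0 e0.
have trunc (P' : 'M[{poly C}]_n) : (size (P' i j) <= d.+1)%N ->
    \poly_(k < d.+1) (P' i j)`_k = P' i j.
  move=> sz; apply/polyP => k; rewrite coef_poly; case: ltnP => // le.
  by rewrite nth_default // (leq_trans sz).
by exists dl; split=> // P' [sz cl]; have := h P' (conj sz cl); rewrite !trunc.
Qed.

Lemma nearby_neq0 f z : pcont f -> (f P).[z] != 0 -> nearby (fun P' => (f P').[z] != 0).
Proof.
move=> hf nz; have nz' := normc_gt0 nz.
apply: nearby_mono (hf (normc z) _ (normc_ge0 z) nz') => P' lt.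
apply: contraTneq lt => e0; rewrite -leNgt.
rewrite (le_trans _ (horner_pnorm _ (lexx _))) //.
by rewrite hornerD e0 add0r hornerN normcN.
Qed.

(** Lower semicontinuity of rank: fixed matrices L, W with L F(P) W = 1 have det(L F(P') W) nonzero
    nearby. *)
Lemma nearby_rank a b (F : 'M[{poly C}]_n -> 'M[C]_(a, b)) :
  (forall i j, pcont (fun P' => (F P' i j)%:P)) ->
  nearby (fun P' => (\rank (F P) <= \rank (F P'))%N).
Proof.
move=> hF; set k := \rank (F P).
have [L [W LW]] : exists L W, L *m F P *m W = 1%:M :> 'M_k.
  have /row_freeP[W0 h] := row_base_free (F P).
  have /submxP[L eL] : (row_base (F P) <= F P)%MS by rewrite eq_row_base.
  by exists L, W0; rewrite -eL.
pose f P' := \det (cmx L *m cmx (F P') *m cmx W).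
have fE P' : f P' = (\det (L *m F P' *m W))%:P.
  by rewrite /f -!map_mxM det_map_mx.
have cf : pcont f.
  apply: pcont_det => i j; apply: pcont_mulmx => {}i {}j; last exact: pcont_cst.
  apply: pcont_mulmx => {}i {}j; first exact: pcont_cst.
  by apply: pcont_ext (hF i j) => P'; rewrite mxE.
have nz : (f P).[0] != 0 by rewrite fE hornerC LW det1 oner_eq0.
apply: nearby_mono (nearby_neq0 cf nz) => P'; rewrite fE hornerC -unitfE -unitmxE => u.
rewrite -{1}(mxrank_unit u) (leq_trans (mxrankM_maxl _ _)) // mxrankM_maxr //.
Qed.

Lemma nearby_toep_rank K (v : 'I_n -> nat) :
  nearby (fun P' => (\rank (toep K v P) <= \rank (toep K v P'))%N).
Proof.
apply: nearby_rank => s t.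
apply: (@pcont_ext (fun P' => if (tagged (enum_val t) < (enum_val s).2)%N then 0 else
   ((P' (tag (enum_val t)) (enum_val s).1)`_(tagged (enum_val t) - (enum_val s).2))%:P)).
  by move=> P'; rewrite mxE coefXnM; case: ifP => // _; rewrite polyC0.
by case: (_ < _)%N; [exact: pcont_cst | exact: pcont_coef].
Qed.

(** If f(P') had no root near mu, [log_deriv_bound] would bound its derivative at mu by a multiple
    of its value there; but the value is near 0 and the derivative near a nonzero number. The root
    found is again simple. *)
Lemma nearby_simple_root f mu rho N : pcont f ->
  (forall P' : 'M[{poly C}]_n, (forall i j, (size (P' i j) <= d.+1)%N) -> (size (f P') <= N)%N) ->
  root (f P) mu -> (f P)^`().[mu] != 0 -> 0 < rho ->
  nearby (fun P' => exists z, [/\ normc (z - mu) < rho, root (f P') z & (f P')^`().[z] != 0]).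
Proof.
move=> cf szf g0 g1 rho0; set g := f P in g0 g1.
pose c := normc g^`().[mu]; have c0 : 0 < c by apply: normc_gt0.
pose w := normc mu + 1; have w1 : 1 <= w by have := normc_ge0 mu; rewrite /w; lra.
have w0 : 0 <= w by lra.
have [q eq] : exists q, g^`() = g^`().[mu]%:P + q * ('X - mu%:P).
  have : root (g^`() - g^`().[mu]%:P) mu by rewrite rootE hornerD hornerN hornerC subrr.
  by case/factor_theorem => q e; exists q; rewrite -e addrC subrK.
pose b := pnorm w q; have b0 : 0 <= b by apply: pnorm_ge0.
(* Small enough that within rho' of mu the derivative g' moves by at most c / 4. *)
pose rho' := Num.min rho (Num.min 1 (c / (4 * (b + 1)))).
have rp : 0 < rho' by rewrite !lt_min rho0 ltr01 divr_gt0 //; lra.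
have der_close z : normc (z - mu) < rho' -> normc z <= w /\ normc (g^`().[z] - g^`().[mu]) <= c / 4.
  rewrite !lt_min => /and3P[_ lt1 lt2].
  have zw : normc z <= w.
    by have := le_normcD (z - mu) mu; rewrite subrK /w; lra.
  split=> //; rewrite {1}eq hornerD hornerC addrAC subrr add0r hornerM hornerXsubC normcM.
  have := horner_pnorm q zw; rewrite -/b => hq.
  have {}lt2 : normc (z - mu) * (b + 1) < c / 4.
    have : normc (z - mu) * (4 * (b + 1)) < c by rewrite -ltr_pdivlMr //; lra.
    lra.
  have : normc q.[z] * normc (z - mu) <= b * normc (z - mu) by rewrite ler_wpM2r ?normc_ge0.
  have := normc_ge0 (z - mu); lra.
(* The first bound keeps derivatives above c / 2; the second makes N |f(P')(mu)| < rho' c / 2, the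
   contradiction with [log_deriv_bound]. *)
pose eta := Num.min (c / 4) (rho' * c / (4 * (N%:R + 1))).
have N0 : 0 <= N%:R :> R by [].
have eta0 : 0 < eta by rewrite lt_min !divr_gt0 ?mulr_gt0 //; lra.
have w20 : 0 <= 2 * w by lra.
have [dl [dl0 h]] := cf (2 * w) _ w20 eta0.
exists dl; split=> // P' cl; have lt_eta := h P' cl.
have [szP' _] := cl; have szh := szf P' szP'; set hh := f P' in szh lt_eta *.
have [eta1 eta2] : eta <= c / 4 /\ eta <= rho' * c / (4 * (N%:R + 1)).
  by rewrite /eta !ge_min !lexx orbT.
have hclose z : normc z <= w -> normc (hh.[z] - g.[z]) < eta.
  move=> zw; rewrite -hornerN -hornerD (le_lt_trans _ lt_eta) //.
  by rewrite (le_trans (horner_pnorm _ zw)) // pnorm_mono //; lra.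
have dclose z : normc z <= w -> normc (hh^`().[z] - g^`().[z]) < eta.
  move=> zw; rewrite -hornerN -hornerD -derivN -derivD (le_lt_trans _ lt_eta) //.
  exact: deriv_pnorm.
have muw : normc mu <= w by rewrite /w; lra.
have hmu : normc hh.[mu] < eta.
  by have := hclose mu muw; rewrite (rootP g0) subr0.
have dmu : c / 2 < normc hh^`().[mu].
  have := normcB_ge g^`().[mu] hh^`().[mu]; rewrite -/c; have := dclose mu muw; lra.
have [z [rz ltz]] : exists z, root hh z /\ normc (z - mu) < rho'.
  apply: contrapT => none.
  have far z : root hh z -> rho' <= normc (z - mu).
    by move=> rz; rewrite leNgt; apply/negP => lt; apply: none; exists z.
  have := log_deriv_bound rp far.
  have leN : (size hh).-1%:R <= N%:R :> R by rewrite ler_nat (leq_trans (leq_pred _) szh).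
  have : (size hh).-1%:R * normc hh.[mu] <= N%:R * normc hh.[mu].
    by rewrite ler_wpM2r ?normc_ge0.
  have : N%:R * normc hh.[mu] <= (N%:R + 1) * eta.
    have := normc_ge0 hh.[mu]; nra.
  have : (N%:R + 1) * eta <= rho' * c / 4.
    have : eta * (4 * (N%:R + 1)) <= rho' * c by rewrite -ler_pdivlMr //; lra.
    lra.
  have : rho' * (c / 2) < rho' * normc hh^`().[mu] by rewrite ltr_pM2l.
  have := mulr_gt0 rp c0; lra.
exists z; split=> //; first by move: ltz; rewrite lt_min => /andP[].
have [zw dz] := der_close z ltz.
have : 0 < normc hh^`().[z].
  have := normcB_ge g^`().[z] hh^`().[z]; have := dclose z zw.
  have := normcB_ge g^`().[mu] g^`().[z]; rewrite -/c; lra.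
by apply: contraTneq => ->; rewrite normc0 ltxx.
Qed.

End Perturbation.

(** * The distance and coefficientwise bounds *)

Section Distance.
Variable R : realType.
Notation C := R[i].

Lemma frobenius_ge0 m n (A : 'M[C]_(m, n)) : 0 <= frobenius_norm A.
Proof. exact: sqrtr_ge0. Qed.

Lemma sqrt_sum_ge (I : finType) (g : I -> R) i : 0 <= g i ->
  g i <= Num.sqrt (\sum_j g j ^+ 2).
Proof.
move=> gi0; rewrite -{1}[g i]ger0_norm // -sqrtr_sqr ler_wsqrtr //.
by rewrite (bigD1 i) //= lerDl sumr_ge0 // => j _; rewrite sqr_ge0.
Qed.

Lemma sqrt_sum_le (I : finType) (g : I -> R) : (forall i, 0 <= g i) ->
  Num.sqrt (\sum_j g j ^+ 2) <= \sum_j g j.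
Proof.
move=> g0; have s0 : 0 <= \sum_j g j by apply: sumr_ge0.
rewrite -[X in _ <= X]ger0_norm // -sqrtr_sqr ler_wsqrtr //.
rewrite expr2 mulr_suml; apply: ler_sum => i _; rewrite expr2 ler_wpM2l //.
by rewrite (bigD1 i) //= lerDl sumr_ge0.
Qed.

Lemma normc_le_frobenius m n (A : 'M[C]_(m, n)) i j : normc (A i j) <= frobenius_norm A.
Proof.
rewrite /frobenius_norm pair_big /=.
exact: (@sqrt_sum_ge _ (fun p : 'I_m * 'I_n => normc (A p.1 p.2)) (i, j)) (normc_ge0 _).
Qed.

Lemma frobenius_le m n (A : 'M[C]_(m, n)) e : (forall i j, normc (A i j) <= e) ->
  frobenius_norm A <= (m * n)%:R * e.
Proof.
move=> h; rewrite /frobenius_norm pair_big /=.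
have := @sqrt_sum_le _ (fun p : 'I_m * 'I_n => normc (A p.1 p.2)) (fun=> normc_ge0 _).
move/le_trans; apply; rewrite (le_trans (ler_sum _ (fun p _ => h p.1 p.2))) //.
by rewrite sumr_const card_prod !card_ord mulr_natl.
Qed.

Lemma coef_le_mpdist n d (P Q : 'M[{poly C}]_n) i j k : (k <= d)%N ->
  normc ((P i j)`_k - (Q i j)`_k) <= mpdist d P Q.
Proof.
rewrite -ltnS => ltk; pose k' := Ordinal ltk.
have := @sqrt_sum_ge _ (fun k : 'I_d.+1 => frobenius_norm (mpcoef k P - mpcoef k Q)) k' (frobenius_ge0 _).
apply: le_trans; have := normc_le_frobenius (mpcoef k P - mpcoef k Q) i j.
by rewrite !mxE.
Qed.

Lemma mpdist_le n d (P Q : 'M[{poly C}]_n) e :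
  (forall i j k, (k <= d)%N -> normc ((P i j)`_k - (Q i j)`_k) <= e) ->
  mpdist d P Q <= (d.+1 * (n * n))%:R * e.
Proof.
move=> h.
have := @sqrt_sum_le _ (fun k : 'I_d.+1 => frobenius_norm (mpcoef k P - mpcoef k Q)) (fun=> frobenius_ge0 _).
move/le_trans; apply.
apply: (@le_trans _ _ (\sum_(k < d.+1) (n * n)%:R * e)).
  by apply: ler_sum => k _; apply: frobenius_le => i j; rewrite !mxE h // -ltnS.
by rewrite sumr_const card_ord -[_ *+ d.+1]mulr_natl mulrA -natrM.
Qed.

End Distance.

(** * Bundles with simple eigenvalues *)

Section Bundle.
Variable F : closedFieldType.

Lemma POLsP n d (P : 'M[{poly F}]_n) :
  POLs F n d P <-> (forall i j, (size (P i j) <= d.+1)%N) /\ P^T = P.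
Proof.
split=> [[gP sP]|[szP symP]]; split.
- move=> i j; apply/leq_sizeP => k lt.
  by have /matrixP/(_ i j) := gP k lt; rewrite !mxE.
- apply/matrixP => i j; rewrite mxE; apply/polyP => k.
  by have /matrixP/(_ i j) := sP k; rewrite !mxE.
- move=> k lt; apply/matrixP => i j; rewrite !mxE nth_default //.
  by rewrite (leq_trans (szP i j)).
- by move=> k; apply/matrixP => i j; rewrite !mxE -[in LHS]symP mxE.
Qed.

Lemma sym_fact_POLs n d r (v : 'I_r -> nat) V D (P : 'M[{poly F}]_n) :
  sym_fact d v V D P -> POLs F n d P.
Proof.
move=> fP; apply/POLsP; split; first exact: size_sym_fact fP.
by rewrite (sf_eq fP) !trmx_mul trmxK (sf_sym fP) mulmxA.
Qed.

Lemma simple_eds_perm (eds eds' : seq (option F * nat)) :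
  perm_eq eds eds' -> simple_eds eds = simple_eds eds'.
Proof. by move=> pe; rewrite /simple_eds (perm_uniq pe) (perm_all _ pe). Qed.

Lemma simple_simple_divisors (zs : seq F) b : uniq zs -> simple_eds (simple_divisors zs b).
Proof.
move=> uz; have um : uniq [seq (Some z, 1%N) | z <- zs] by rewrite map_inj_uniq // => x y [].
have am : all (fun e => e.2 == 1%N) [seq (Some z, 1%N) | z <- zs].
  by rewrite all_map; apply/allP.
rewrite /simple_eds /simple_divisors; case: b => /=; last by rewrite cats0 um.
rewrite cats1 rcons_uniq all_rcons um am /= andbT andbT; apply/mapP => -[x _ //].
Qed.

Lemma simple_eds_split (eds : seq (option F * nat)) : simple_eds eds ->
  exists zs b, uniq zs /\ perm_eq eds (simple_divisors zs b).
Proof.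
move=> seds; have [ue _] := andP seds.
pose zs := undup (pmap fst eds); exists zs, ((None, 1%N) \in eds).
have uz : uniq zs by apply: undup_uniq.
split=> //; apply/allP => -[[z|] k] _ /=; rewrite count_simple_eds //.
  rewrite count_simple_divisors // mem_undup mem_pmap -mulnb.
  suff -> : (Some z \in [seq e.1 | e <- eds]) = ((Some z, 1%N) \in eds) by [].
  apply/mapP/idP => [[[x m] xe /= ->]|]; last by exists (Some z, 1%N).
  by have /andP[_ /allP/(_ _ xe)/= /eqP <-] := seds.
by rewrite count_simple_divisors_oo -mulnb.
Qed.

Lemma simple_eds_bijection (e1 e2 : seq (option F * nat)) :
  simple_eds e1 -> simple_eds e2 -> size e1 = size e2 ->
  exists f : option F -> option F,
    {in [seq e.1 | e <- e1] &, injective f} /\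
    perm_eq [seq (f e.1, e.2) | e <- e1] e2.
Proof.
move=> /andP[u1 /allP a1] /andP[u2 /allP a2] sz.
have ufst (e : seq (option F * nat)) : uniq e -> {in e, forall x, x.2 == 1%N} ->
    uniq [seq x.1 | x <- e].
  move=> ue ae; rewrite map_inj_in_uniq // => -[x k] [y l] /ae/= /eqP -> /ae/= /eqP -> /= -> //.
have uf1 := ufst _ u1 a1; have uf2 := ufst _ u2 a2.
(* Eigenvalues are matched by position; off the list [f] takes the default [None], and injectivity
   is only claimed on the list. *)
pose f x := nth None [seq e.1 | e <- e2] (index x [seq e.1 | e <- e1]).
exists f; split.
  move=> x y x1 y1 /eqP; rewrite nth_uniq ?size_map -?sz ?(size_map fst) -?index_mem //.
  - by move=> /eqP; apply: index_inj.
  - by rewrite -(size_map fst e1) index_mem.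
  - by rewrite -(size_map fst e1) index_mem.
suff -> : [seq (f e.1, e.2) | e <- e1] = e2 by [].
apply: (@eq_from_nth _ (None, 0%N)); rewrite size_map // => i lti.
rewrite (nth_map (None, 0%N)) // /f -(nth_map _ None fst) // index_uniq ?size_map //.
rewrite (nth_map (None, 0%N)) -?sz //.
have /a1/eqP -> := mem_nth (None, 0%N) lti.
rewrite sz in lti; have := mem_nth (None, 0%N) lti.
by case: (nth _ _ _) => x k /a2 /= /eqP ->.
Qed.

End Bundle.

(** * Density *)

Section Density.

Lemma bundle_generic (F : closedFieldType) n r d a (K Q : 'M[{poly F}]_n) rs (b : bool)
    (idx := (nseq (a %% (n - r)) (a %/ (n - r)).+1 ++
      nseq (n - r - a %% (n - r)) (a %/ (n - r)))%N) :
  is_K r d a K -> POLs F n d Q ->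
  has_eigenstructure d Q (Eigenstructure (simple_divisors rs b) idx idx) ->
  uniq rs -> (size rs + b + 2 * a = r * d)%N -> symmetric_bundle d K Q.
Proof.
move=> [_ _ _ [mu [szmu umu hK]]] pQ hQ urs sz; split=> //.
do 2 eexists; split; [exact: hK | exact: hQ | split=> //=].
have emu : [seq (Some x, 1%N) | x <- mu] = simple_divisors mu false by rewrite /simple_divisors cats0.
rewrite emu; apply: simple_eds_bijection; try exact: simple_simple_divisors.
rewrite !size_cat !size_map !size_nseq szmu addn0; lia.
Qed.

(** With L a left inverse of M0, L (M + t M0) = L M + t, singular only at the roots of a
    characteristic polynomial. *)
Lemma perturb_row_full (F : fieldType) m k (M M0 : 'M[F]_(m, k)) : row_full M0 ->
  exists2 p : {poly F}, p != 0 & forall t, ~~ root p t -> row_full (M + t *: M0)%R.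
Proof.
case/row_fullP=> L LM; exists (char_poly (- (L *m M))); first by rewrite monic_neq0 // char_poly_monic.
move=> t nr; have u : L *m (M + t *: M0) \in unitmx.
  move: nr; rewrite /char_poly rootE -[_.[_]]/(horner_eval t _) -det_map_mx /char_poly_mx.
  rewrite map_mxB map_scalar_mx /= /horner_eval hornerX -map_mx_comp.
  have -> : map_mx (horner_eval t \o polyC) (- (L *m M)) = - (L *m M).
    by apply/matrixP => i j; rewrite !mxE /= /horner_eval hornerC.
  by rewrite opprK addrC unitmxE unitfE mulmxDr -scalemxAr LM scalemx1.
apply/row_fullP; exists (invmx (L *m (M + t *: M0)) *m L).
by rewrite -mulmxA mulVmx.
Qed.

Lemma perturb_row_free (F : fieldType) m k (M M0 : 'M[F]_(m, k)) : row_free M0 ->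
  exists2 p : {poly F}, p != 0 & forall t, ~~ root p t -> row_free (M + t *: M0)%R.
Proof.
rewrite /row_free -mxrank_tr => /(perturb_row_full M^T)[p p0 h]; exists p => // t /h.
by rewrite /row_full -linearZ -linearD mxrank_tr.
Qed.

Lemma toep_linear (F : closedFieldType) n r K (v : 'I_r -> nat) (V V0 : 'M[{poly F}]_(r, n)) t :
  toep K v (V + t%:P *: V0) = toep K v V + t *: toep K v V0.
Proof.
apply/matrixP => i j; rewrite !mxE mulrDr coefD; congr (_ + _).
by rewrite mulrCA coefCM.
Qed.

Variable R : realType.
Notation C := R[i].

Lemma small_nonroot (p : {poly C}) (e : R) : p != 0 -> 0 < e ->
  exists t : R, [/\ 0 < t, t < e & ~~ root p t%:C%C].
Proof.
(* The candidates e / (k + 2) lie strictly below e, and [size p] of them exceed the number of roots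
   of p. *)
move=> p0 e0; pose t k : R := e / k.+2%:R.
pose s := [seq (t k)%:C%C | k <- iota 0 (size p)].
have us : uniq s.
  rewrite map_inj_uniq ?iota_uniq // => k l [] /(mulfI (lt0r_neq0 e0)) /invr_inj.
  by move/eqP; rewrite eqr_nat => /eqP[].
have : ~~ all (root p) s.
  apply/negP => h; have := max_poly_roots p0 h us.
  by rewrite size_map size_iota ltnn.
case/allPn=> x /mapP[k _ ->] nr; exists (t k); split=> //.
  by rewrite divr_gt0.
by rewrite ltr_pdivrMr // ltr_pMr // ltr1n.
Qed.

Lemma squarefree_roots (F : closedFieldType) (p : {poly F}) : p != 0 ->
  (forall x, ~~ (('X - x%:P) ^+ 2 %| p)) ->
  exists rs, [/\ uniq rs, all (root p) rs & size rs = (size p).-1].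
Proof.
move=> p0 sf; have [rs ep] := closed_field_poly_normal p.
have lc0 : lead_coef p != 0 by rewrite lead_coef_eq0.
exists rs; split.
- apply: contraT => /(uniqPn 0)[i [j [ltij ltj e]]].
  have := sf (nth 0 rs i); rewrite ep dvdpZr // => /negP[].
  rewrite (big_nth 0) big_mkord.
  have lti := ltn_trans ltij ltj.
  rewrite (bigD1 (Ordinal lti)) //= (bigD1 (Ordinal ltj)) /=; last first.
    by rewrite -val_eqE /= gtn_eqF.
  by rewrite -e expr2 mulrA dvdp_mulr.
- by apply/allP => z zrs; rewrite ep rootZ // root_prod_XsubC.
- by rewrite [in RHS]ep size_scale // size_prod_XsubC.
Qed.

Lemma pattern_perturb (F : closedFieldType) n r (v : 'I_r -> nat) (V V0 : 'M[{poly F}]_(r, n)) t :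
  (forall i j, (size (V i j) <= (v i).+1)%N) -> (forall i j, (size (V0 i j) <= (v i).+1)%N) ->
  forall i j, (size ((V + t%:P *: V0) i j)%R <= (v i).+1)%N.
Proof.
move=> hV hV0 i j; rewrite !mxE (leq_trans (size_polyD _ _)) // geq_max hV mul_polyC.
by rewrite (leq_trans (size_scale_leq _ _)).
Qed.

Theorem density n r d (K : nat -> 'M[{poly C}]_n) :
  (1 <= r <= n - 1)%N ->
  (forall a : nat, (a <= (r * d)./2)%N -> is_K r d a (K a)) ->
  forall P : 'M[{poly C}]_n, POLs_rank_le C n d r P ->
  forall eps : R, 0 < eps ->
  exists a : nat, (a <= (r * d)./2)%N /\
    exists Pa : 'M[{poly C}]_n, symmetric_bundle d (K a) Pa /\ mpdist d P Pa < eps.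
Proof.
move=> hr hK P [/POLsP[szP symP] rkP] eps eps0.
have ltrn : (r < n)%N by lia.
have [v1 [V1 [D1 fP1]]] := sym_fact_padded symP szP rkP.
have [v [V [D [fP sfD sfD0]]]] := sym_fact_squarefree fP1.
pose a := (\sum_i v i)%N.
have [V0 [hV0 free0 full0]] := balanced_pattern C v ltrn.
have [p1 p10 h1] := perturb_row_free (toep (a %/ (n - r))%N v V) free0.
have [p2 p20 h2] := perturb_row_full (toep (a %/ (n - r)).+1%N v V) full0.
(* Replacing V by V + t V0 changes P by t A1 + t^2 A2, of size at most t M coefficientwise when t <
   1. *)
have [A1 eA1] : exists A1, A1 = V^T *m D *m V0 + V0^T *m D *m V by eexists.
have [A2 eA2] : exists A2, A2 = V0^T *m D *m V0 by eexists.
pose c (i j : 'I_n) (k : 'I_d.+1) : R := normc (A1 i j)`_k + normc (A2 i j)`_k.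
have c0 i j k : 0 <= c i j k by rewrite addr_ge0 ?normc_ge0.
pose M := \sum_i \sum_j \sum_k c i j k.
have M0 : 0 <= M by do 3![apply: sumr_ge0 => ? _].
have leM i j k : c i j k <= M.
  have le1 (I : finType) (g : I -> R) x : (forall y, 0 <= g y) -> g x <= \sum_y g y.
    by move=> g0; rewrite (bigD1 x) //= lerDl sumr_ge0.
  apply: le_trans (le1 _ (fun i => \sum_j \sum_k c i j k) i _) => [|l]; last first.
    by do 2![apply: sumr_ge0 => ? _].
  apply: le_trans (le1 _ (fun j => \sum_k c i j k) j _) => [|l]; last exact: sumr_ge0.
  exact: (le1 _ (c i j)).
pose N : R := (d.+1 * (n * n))%:R.
have N0 : 0 <= N by [].
have NM0 : 0 <= N * M by rewrite mulr_ge0.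
have e0 : 0 < Num.min 1 (eps / (N * M + 1)) by rewrite lt_min ltr01 divr_gt0 //; lra.
have p12 : p1 * p2 != 0 by rewrite mulf_neq0.
have [t [t0 + nr]] := small_nonroot p12 e0; rewrite lt_min => /andP[t1 te].
pose tc : C := t%:C%C.
have {}nr : ~~ root p1 tc /\ ~~ root p2 tc by move: nr; rewrite rootM negb_or => /andP.
pose Vt := V + tc%:P *: V0; pose Q := Vt^T *m D *m Vt.
have fQ : sym_fact d v Vt D Q.
  split=> //; [exact: sf_sym fP | exact: pattern_perturb (sf_V fP) hV0 | exact: sf_D fP | exact: sf_det fP].
have freeQ : row_free (toep (a %/ (n - r))%N v Vt) by rewrite toep_linear; apply: h1; case: nr.
have fullQ : row_full (toep (a %/ (n - r)).+1%N v Vt) by rewrite toep_linear; apply: h2; case: nr.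
have eQ : Q = P + tc%:P *: A1 + (tc * tc)%:P *: A2.
  have tV : Vt^T = V^T + tc%:P *: V0^T by apply/matrixP => i j; rewrite !mxE.
  rewrite /Q tV /Vt (sf_eq fP) !mulmxDl !mulmxDr -!scalemxAl -!scalemxAr.
  rewrite scalerA -polyCM eA1 eA2 scalerDr.
  by rewrite !addrA.
have nt : normc tc = t by rewrite /tc /normc /= expr0n addr0 sqrtr_sqr gtr0_norm.
have dist : mpdist d P Q < eps.
  have h i j k : (k <= d)%N -> normc ((P i j)`_k - (Q i j)`_k) <= t * M.
    rewrite -ltnS => ltk; have := leM i j (Ordinal ltk); rewrite /c /= => le_c.
    rewrite eQ !mxE !coefD !coefCM opprD addrA opprD addrA subrr add0r -opprD normcN.
    rewrite (le_trans (le_normcD _ _)) // !normcM nt.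
    have := normc_ge0 (A1 i j)`_k; have := normc_ge0 (A2 i j)`_k; move: le_c.
    move: (normc (A1 i j)`_k) (normc (A2 i j)`_k) => x y le_c y0 x0.
    have : t * (x + y) <= t * M by rewrite ler_wpM2l // ltW.
    have : t * t * y <= t * y by rewrite ler_wpM2r // ler_piMr // ltW.
    lra.
  rewrite (le_lt_trans (mpdist_le h)) // -/N.
  have : t * (N * M + 1) < eps by rewrite -ltr_pdivlMr //; lra.
  lra.
have p0 := sf_det fP; have q0 := det_drev_neq0 (sf_D fP) p0.
have [rs [urs prs szrs]] := squarefree_roots p0 sfD.
pose b := root (\det (drev d v D)) 0.
have deg := det_degree (sf_D fP) p0; rewrite -/a in deg.
have mb : mup 0 (\det (drev d v D)) = b.
  rewrite /b -dvdp_XsubCl XsubC_dvd //.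
  have : (mup 0 (\det (drev d v D)) <= 1)%N by rewrite mup_leq.
  by case: (mup _ _) => [|[]].
have sz : (size rs + b + 2 * a = r * d)%N by rewrite szrs -mb.
have [|hQ _] := generic_eigenstructure ltrn fQ freeQ fullQ urs prs (fun h => h : b).
  by rewrite -/a sz.
have lea : (a <= (r * d)./2)%N by rewrite geq_half_double -mul2n -sz leq_addl.
exists a; split=> //; exists Q; split=> //.
exact: bundle_generic (hK a lea) (sym_fact_POLs fQ) hQ urs sz.
Qed.

End Density.

(** * Openness *)

Section BundleOpen.

Lemma bundle_data (F : closedFieldType) n r d a (K P : 'M[{poly F}]_n)
    (idx := (nseq (a %% (n - r)) (a %/ (n - r)).+1 ++
      nseq (n - r - a %% (n - r)) (a %/ (n - r)))%N) :
  is_K r d a K -> symmetric_bundle d K P ->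
  exists l zs (b : bool), [/\ left_minimal_indices P l, perm_eq l idx, uniq zs,
    elementary_divisors d P (simple_divisors zs b)
    & (size zs + b = r * d - 2 * a)%N].
Proof.
case=> [_ _ _ [mu [szmu umu [dK lK rK]]]] [_ [E1 [E2 [[dE1 lE1 rE1] [dE2 lE2 rE2]]]]].
case=> pl _ [f [injf pf]].
have emu : [seq (Some x, 1%N) | x <- mu] = simple_divisors mu false by rewrite /simple_divisors cats0.
have smu : simple_eds [seq (Some x, 1%N) | x <- mu] by rewrite emu simple_simple_divisors.
have pe := simple_eds_unique smu dK dE1.
have s1 : simple_eds (es_divisors E1) by rewrite -(simple_eds_perm pe).
have s2 : simple_eds (es_divisors E2).
  rewrite -(simple_eds_perm pf); have /andP[u1 a1] := s1.
  rewrite /simple_eds all_map; apply/andP; split; last exact: a1.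
  rewrite map_inj_in_uniq // => -[x k] [y m] xin yin /= [/injf ->].
  - by move=> ->.
  - by apply/mapP; exists (x, k).
  - by apply/mapP; exists (y, m).
have [zs [b [uz pz]]] := simple_eds_split s2.
exists (es_left E2), zs, b; split=> //.
- rewrite perm_sym; apply: perm_trans pl.
  exact: left_minimal_indices_unique lK lE1.
- have [ps [qs [h1 h2 h3 h4]]] := dE2; exists ps, qs; split=> // [x k|k].
    by rewrite -h3; apply/esym; apply: (seq.permP pz).
  by rewrite -h4; apply/esym; apply: (seq.permP pz).
have := perm_size pz; rewrite -(perm_size pf) size_map -(perm_size pe) size_map szmu.
by rewrite size_cat size_map size_nseq => ->.
Qed.

Lemma size_det_le (F : closedFieldType) r d (A : 'M[{poly F}]_r) :
  (forall i j, (size (A i j) <= d.+1)%N) -> (size (\det A) <= (r * d).+1)%N.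
Proof.
move=> hA; apply: size_sum_le => s _; rewrite size_Msign.
have prod_le (I : Type) (u : seq I) (g : I -> {poly F}) :
    (forall i, (size (g i) <= d.+1)%N) -> (size (\prod_(i <- u) g i)%R <= (size u * d).+1)%N.
  move=> hg; elim: u => [|x u IH]; first by rewrite big_nil size_poly1.
  rewrite big_cons (leq_trans (size_mul_bound (hg x) IH)) //= mulSn; lia.
have := prod_le _ (index_enum 'I_r) (fun i => A i (s i)) (fun i => hA i (s i)).
by rewrite -[index_enum _]/(index_enum _) [size (index_enum _)](_ : _ = r) // -[RHS]card_ord cardT enumT.
Qed.

Lemma size_compression (F : closedFieldType) n r d (W : 'M[F]_(n, r)) (P : 'M[{poly F}]_n) :
  (forall i j, (size (P i j) <= d.+1)%N) ->
  forall i j, (size (((cmx W)^T *m P *m cmx W) i j)%R <= d.+1)%N.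
Proof.
move=> hP i j; rewrite mxE; apply: size_sum_le => k _.
rewrite mxE mulrC mulr_sumr; apply: size_sum_le => l _; rewrite !mxE.
have hsz : forall (c : F) (p : {poly F}), (size p <= d.+1)%N -> (size (c%:P * p)%R <= d.+1)%N.
  by move=> c p h; rewrite mul_polyC (leq_trans (size_scale_leq _ _)).
by apply/hsz/hsz.
Qed.

(* The compression of V^T D V by W has determinant [det D * det (V W) ^ 2], so *)
(* that a simple root cannot come from the square.                            *)
Lemma compression_root (F : closedFieldType) n r d (v : 'I_r -> nat) V D
    (P : 'M[{poly F}]_n) (W : 'M[F]_(n, r)) z :
  sym_fact d v V D P ->
  root (\det ((cmx W)^T *m P *m cmx W)) z ->
  (\det ((cmx W)^T *m P *m cmx W))^`().[z] != 0 -> root (\det D) z.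
Proof.
move=> fP; pose g := \det (V *m cmx W).
have -> : \det ((cmx W)^T *m P *m cmx W) = g * \det D * g.
  have -> : (cmx W)^T *m P *m cmx W = (V *m cmx W)^T *m D *m (V *m cmx W).
    by rewrite (sf_eq fP) trmx_mul !mulmxA.
  by rewrite !det_mulmx det_tr.
rewrite !rootM => /orP[/orP[gz|//]|gz]; rewrite !derivM !hornerE (rootP gz).
  by rewrite !(mulr0, mul0r, addr0, add0r) eqxx.
by rewrite !(mulr0, mul0r, addr0, add0r) eqxx.
Qed.

Variable R : realType.
Notation C := R[i].

(** Disks of radius rho about distinct points of [zs] are disjoint. The last condition keeps them
    away from the inverses of points within rho of 0, so that a perturbed infinite eigenvalue cannot
    meet a perturbed finite one. *)
Lemma separating_radius (zs : seq C) : exists rho : R, [/\ 0 < rho,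
  forall z z', z \in zs -> z' \in zs -> z != z' -> 2 * rho <= normc (z - z')
  & forall z, z \in zs -> (normc z + rho) * rho < 1].
Proof.
have minpos (s : seq R) : (forall x, x \in s -> 0 < x) ->
    exists rho, 0 < rho /\ forall x, x \in s -> rho <= x.
  elim: s => [|x s IH] h; first by exists 1; split.
  have [|rho [rho0 hr]] := IH; first by move=> y ys; apply: h; rewrite in_cons ys orbT.
  exists (Num.min x rho); split; first by rewrite lt_min rho0 h ?mem_head.
  move=> y; rewrite in_cons => /orP[/eqP->|/hr le]; first by rewrite ge_min lexx.
  by rewrite ge_min le orbT.
pose s1 := [seq normc (p.1 - p.2) / 2 | p <- [seq (z, z') | z <- zs, z' <- zs] & p.1 != p.2].
pose s2 := [seq (2 * (normc z + 1))^-1 | z <- zs].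
have [|rho [rho0 hr]] := minpos (1 :: s1 ++ s2).
  move=> x; rewrite in_cons mem_cat => /orP[/eqP->//|/orP[/mapP[p]|/mapP[z _ ->]]].
    rewrite mem_filter => /andP[ne _] ->; rewrite divr_gt0 // normc_gt0 //.
    by rewrite subr_eq0.
  by rewrite invr_gt0; have := normc_ge0 z; lra.
exists rho; split=> // [z z' zin z'in ne|z zin].
  have : rho <= normc (z - z') / 2.
    apply: hr; rewrite in_cons mem_cat; apply/orP; right; apply/orP; left.
    apply/mapP; exists (z, z') => //; rewrite mem_filter ne /=.
    by apply/allpairsP; exists (z, z').
  lra.
have r1 : rho <= 1 by apply: hr; rewrite mem_head.
have : rho <= (2 * (normc z + 1))^-1.
  by apply: hr; rewrite in_cons mem_cat (map_f _ zin) !orbT.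
have n0 := normc_ge0 z; rewrite -[X in _ <= X]mul1r ler_pdivlMr; last by lra.
have : rho * rho <= rho by rewrite ler_piMr // ltW.
nra.
Qed.

(** The compressions W depend on P alone, so their simple roots persist for all P' nearby, whatever
    factorization of P' is taken; [compression_root] places them among the zeros of det D. *)
Lemma nearby_roots n r d (P : 'M[{poly C}]_n) zs (b : bool) :
  (forall i j, (size (P i j) <= d.+1)%N) -> mprank P = r -> uniq zs ->
  elementary_divisors d P (simple_divisors zs b) ->
  nearby d P (fun P' => forall (v : 'I_r -> nat) V D, sym_fact d v V D P' ->
    exists rs (b' : bool), [/\ uniq rs, all (root (\det D)) rs,
      b' -> root (\det (drev d v D)) 0 & (size rs + b' = size zs + b)%N]).
Proof.
move=> szP rkP uz ed.
have [ps [szps mps sps eps]] := smith_form P.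
have ips : invariant_polynomials P ps by split.
have [qs [szqs mqs sqs eqs]] := smith_form (mprev d P).
have iqs : invariant_polynomials (mprev d P) qs by split.
have szr : size ps = r by rewrite -(mprank_smith ips).
have szr' : size qs = r by rewrite (size_smith_rev szP ips iqs).
have [mz moo] := mup_simple_eds ed (simple_simple_divisors b uz) ips iqs.
have [rho [rho0 sep far]] := separating_radius zs.
have inE1 z : ((Some z, 1%N) \in simple_divisors zs b) = (z \in zs).
  by rewrite -[LHS]has_pred1 has_count count_simple_divisors // lt0b.
have inoo : ((None, 1%N) \in simple_divisors zs b) = b.
  by rewrite -has_pred1 has_count count_simple_divisors_oo lt0b.
have fin : nearby d P (fun P' => forall z, z \in zs -> exists z', normc (z' - z) < rho /\
    forall (v : 'I_r -> nat) V D, sym_fact d v V D P' -> root (\det D) z').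
  apply: nearby_all => z zin.
  have m1 : mup z (\prod_(p <- ps) p) = 1%N by rewrite mz inE1 zin.
  have [W [g0 g1]] := compression_simple_root ips szr m1.
  pose f (P' : 'M[{poly C}]_n) := \det ((cmx W)^T *m P' *m cmx W).
  have cf : pcont d P f.
    apply: pcont_det => i j; apply: pcont_mulmx => {}i {}j; last exact: pcont_cst.
    by apply: pcont_mulmx => {}i {}j; [exact: pcont_cst | exact: pcont_entry].
  apply: nearby_mono (nearby_simple_root (N := (r * d).+1) cf _ g0 g1 rho0) => [P' [z' [lt rz dz]]|P' sz].
    by exists z'; split=> // v V D fP; apply: compression_root fP rz dz.
  by apply: size_det_le; apply: size_compression.
have inf : nearby d P (fun P' => b -> exists z', normc z' < rho /\
    forall (v : 'I_r -> nat) V D, sym_fact d v V D P' -> root (\det (drev d v D)) z').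
  case: (b) inoo moo => [inoo moo|_ _]; last by exists 1; split.
  have m1 : mup 0 (\prod_(p <- qs) p) = 1%N by rewrite moo inoo.
  have [W [g0 g1]] := compression_simple_root iqs szr' m1.
  pose f (P' : 'M[{poly C}]_n) := \det ((cmx W)^T *m mprev d P' *m cmx W).
  have cf : pcont d P f.
    apply: pcont_det => i j; apply: pcont_mulmx => {}i {}j; last exact: pcont_cst.
    by apply: pcont_mulmx => {}i {}j; [exact: pcont_cst | exact: pcont_rev].
  apply: nearby_mono (nearby_simple_root (N := (r * d).+1) cf _ g0 g1 rho0) => [P' [z' [lt rz dz]] _|P' sz].
    exists z'; split; first by rewrite subr0 in lt.
    by move=> v V D /sym_fact_rev fP; apply: compression_root fP rz dz.
  by apply: size_det_le; apply: size_compression => i j; rewrite mxE size_poly.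
apply: nearby_mono (nearby_and fin inf) => P' [hfin hinf] v V D fP.
have /choice[c hc] : forall z, exists z', z \in zs -> normc (z' - z) < rho /\ root (\det D) z'.
  move=> z; have [zin|] := boolP (z \in zs); last by exists 0.
  by have [z' [lt h]] := hfin z zin; exists z' => _; split=> //; apply: h fP.
pose rs := [seq c z | z <- zs].
have urs : uniq rs.
  rewrite map_inj_in_uniq // => z z' zin z'in e; apply/eqP; apply: contraT => ne.
  have [h1 _] := hc z zin; have [h2 _] := hc z' z'in.
  have := sep z z' zin z'in ne.
  have := le_normcB (c z' - z') (c z - z); rewrite e.
  have -> : c z' - z' - (c z' - z) = z - z' by ring.
  rewrite e in h1; lra.
have rrs : all (root (\det D)) rs by apply/allP => _ /mapP[z zin ->]; case: (hc z zin).
have [b1|b0] := boolP b; last first.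
  by exists rs, false; rewrite size_map; split=> //; rewrite (negPf b0).
have [z' [lt /(_ _ _ _ fP) rz]] := hinf b1.
(* The perturbed infinite eigenvalue either stays at infinity or becomes the finite root 1/z', too
   large to be one of [rs]. *)
have [z0|nz] := eqVneq z' 0.
  by exists rs, true; rewrite size_map -z0; split.
exists (z'^-1 :: rs), false; split=> //=; last by rewrite size_map addn0 addn1.
  rewrite urs andbT; apply/mapP => -[z zin e].
  have [h1 _] := hc z zin; have h2 := far z zin.
  have : normc z'^-1 < normc z + rho.
    by have := le_normcD (c z - z) z; rewrite subrK -e; rewrite -e in h1; lra.
  rewrite normcV => h3; have n0 := normc_gt0 nz.
  have : 1 < (normc z + rho) * normc z' by rewrite -ltr_pdivrMr // mul1r.
  have : (normc z + rho) * normc z' <= (normc z + rho) * rho.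
    by rewrite ler_wpM2l; have := normc_ge0 z; lra.
  lra.
rewrite rrs andbT; have := det_drev nz (sf_D fP); rewrite (rootP rz) mulr0.
move/esym/eqP; rewrite mulf_eq0 expf_eq0 (negPf nz) andbF /=; exact.
Qed.

Lemma nearby_ball n d r (P : 'M[{poly C}]_n) Q : POLs C n d P -> nearby d P Q ->
  exists eps : R, 0 < eps /\ forall P', rank_ball d r P eps P' -> Q P'.
Proof.
move=> /POLsP[szP _] [dl [dl0 h]]; exists dl; split=> // P' [[/POLsP[szP' _] _] lt].
apply: h; split=> // i j k; have [le|gt] := leqP k d.
  rewrite -normcN opprB (le_lt_trans (coef_le_mpdist _ _ _ _ le)) //.
by rewrite !nth_default ?(leq_trans (szP _ _)) ?(leq_trans (szP' _ _)) // subrr normc0.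
Qed.

Lemma ball_infinite n d r (P : 'M[{poly C}]_n) (eps : R) : POLs C n d P -> P != 0 ->
  (mprank P <= r)%N -> 0 < eps -> infinite_set (rank_ball d r P eps).
Proof.
move=> pP P0 rkP eps0; have [szP symP] := (POLsP _ _).1 pP.
pose M := mpdist d P 0; pose N : R := (d.+1 * (n * n))%:R.
have M0 : 0 <= M by apply: sqrtr_ge0.
have N0 : 0 <= N by [].
have NM0 : 0 <= N * M by rewrite mulr_ge0.
pose t k : R := eps / (N * M + 1) / k.+1%:R.
have t0 k : 0 < t k by rewrite !divr_gt0 //; lra.
have te k : t k * (N * M + 1) <= eps.
  rewrite -ler_pdivlMr; last by lra.
  rewrite /t ler_piMr //; first by rewrite divr_ge0 ?ltW //; lra.
  by rewrite invf_le1 // ler1n.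
(* Distinct scalar multiples of P close to 1 stay symmetric, within the grade and of no larger
   rank. *)
pose f k : 'M[{poly C}]_n := (1 + (t k)%:C%C)%:P *: P.
have finj : injective f.
  move=> k l /matrixP e; have /matrix0Pn[i [j Pij]] := P0.
  have := e i j; rewrite !mxE => /(mulIf Pij)/polyC_inj/addrI[].
  have ne : eps / (N * M + 1) != 0 by rewrite mulf_neq0 ?invr_eq0 // gt_eqF //; lra.
  move/(mulfI ne)/invr_inj/eqP; rewrite eqr_nat => /eqP[]; exact.
have fball k : rank_ball d r P eps (f k).
  have pf : POLs C n d (f k).
    apply/POLsP; split; last by rewrite /f linearZ /= symP.
    by move=> i j; rewrite mxE mul_polyC (leq_trans (size_scale_leq _ _)).
  split; first split=> //.
    rewrite (leq_trans _ rkP) // /mprank /mpfrac map_mxZ.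
    by apply: mxrankS; apply: scalemx_sub; apply: submx_refl.
  have h i j l : (l <= d)%N -> normc ((P i j)`_l - (f k i j)`_l) <= t k * M.
    move=> le; rewrite mxE coefCM mulrDl mul1r opprD addrA subrr add0r normcN normcM.
    have -> : normc (t k)%:C%C = t k by rewrite /normc /= expr0n addr0 sqrtr_sqr gtr0_norm.
    rewrite ler_wpM2l ?(ltW (t0 k)) //.
    by have := coef_le_mpdist P 0 i j le; rewrite mxE coef0 subr0.
  rewrite /= (le_lt_trans (mpdist_le h)) // -/N.
  have := te k; have := t0 k; lra.
(* [g] is a left inverse of [f]; a finite ball would have a finite image under it, containing all of
   nat. *)
have /choice[g hg] : forall Q, exists k, (exists k', f k' = Q) -> f k = Q.
  move=> Q; have [[k' e]|none] := pselect (exists k', f k' = Q); first by exists k'.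
  by exists 0%N.
move=> fin; apply: infinite_nat.
have : finite_set (g @` rank_ball d r P eps) by apply: finite_image.
apply: sub_finite_set => k _; exists (f k); first exact: fball.
by apply: finj; apply: hg; exists k.
Qed.

Theorem bundle_open n r d a (K P : 'M[{poly C}]_n) :
  (1 <= r <= n - 1)%N -> (a <= (r * d)./2)%N -> is_K r d a K ->
  symmetric_bundle d K P ->
  exists eps : R, [/\ 0 < eps, rank_ball d r P eps `<=` symmetric_bundle d K
    & infinite_set (rank_ball d r P eps)].
Proof.
move=> hr lea hK bP; have pP : POLs C n d P by case: bP.
have ltrn : (r < n)%N by lia.
have [szP symP] := (POLsP _ _).1 pP.
have [l [zs [b [lmi pl uz ed sz]]]] := bundle_data hK bP.
pose q := (n - r)%N; pose alpha := (a %/ q)%N; pose s := (a %% q)%N.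
have q0 : (0 < q)%N by rewrite subn_gt0.
have lts : (s < q)%N by rewrite ltn_mod.
have rkP : mprank P = r.
  rewrite (balanced_rank lmi pl) ?(ltnW lts) ?leq_subr // subKn // ltnW //.
have free := balanced_toep_free szP symP lmi pl.
have null := balanced_toep_nullity szP symP lmi pl.
have P0 : P != 0.
  apply: contraTneq hr => e0; rewrite -rkP e0 /mprank /mpfrac map_mx0 mxrank0 //.
have near := nearby_and (nearby_roots szP rkP uz ed)
  (nearby_and (nearby_toep_rank d P alpha (fun=> d)) (nearby_toep_rank d P alpha.+1 (fun=> d))).
have [eps [eps0 hball]] := nearby_ball r pP near.
exists eps; split; [exact: eps0 | | by apply: ball_infinite pP P0 _ eps0; rewrite rkP].
move=> P' bP'; have [hroots [rk1 rk2]] := hball _ bP'.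
have [[pP' rkP'] _] := bP'; have [szP' symP'] := (POLsP _ _).1 pP'.
have free' : row_free (toep alpha (fun _ : 'I_n => d) P').
  by rewrite -row_leq_rank (leq_trans _ rk1) // row_leq_rank.
have null' := leq_trans null (leq_add rk2 (leqnn (q - s))).
have [v [V [D fP]]] := sym_fact_padded symP' szP' rkP'.
have [freeV le_n fullV] := sym_fact_near fP free' null'.
have [rs [b' [urs rrs qb szrs]]] := hroots v V D fP.
have deg := det_degree (sf_D fP) (sf_det fP).
have ltrs : (size rs < size (\det D))%N by apply: max_poly_roots (sf_det fP) rrs urs.
have leb : (b' <= mup 0 (\det (drev d v D)))%N.
  case: (b') qb => // /(_ isT); rewrite -dvdp_XsubCl XsubC_dvd //.
  exact: det_drev_neq0 (sf_D fP) (sf_det fP).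
have ea : a = (alpha * q + s)%N by apply: divn_eq.
have en : (n * alpha.+1 = r * alpha.+1 + q * alpha.+1)%N by rewrite -mulnDl subnKC // ltnW.
have aux (x y z t : nat) : (t < z -> z + x <= y + (z - t) -> x + t <= y)%N by clear; lia.
(* The Toeplitz ranks give >=. The r d - 2 a distinct zeros found fit among the r d - 2 sum v_i
   zeros of det D, which gives <=. *)
have esum : (\sum_i v i = a)%N.
  have ge : (a <= \sum_i v i)%N.
    rewrite [X in (X <= _)%N]ea; move: le_n; rewrite en -addnA leq_add2l mulnS [(q * alpha)%N]mulnC.
    exact: aux lts.
  have le : (2 * \sum_i v i <= 2 * a)%N.
    have le2 : (2 * a <= r * d)%N by rewrite mul2n -geq_half_double.
    move: deg ltrs leb szrs sz; move: (size (\det D)) (mup _ _) (nat_of_bool b) (nat_of_bool b') => x y z z'.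
    by move: le2; clear; lia.
  by apply/eqP; rewrite eqn_leq ge andbT -(leq_pmul2l (isT : (0 < 2)%N)).
have full' : row_full (toep alpha.+1 v V).
  apply: fullV; rewrite esum en ea -addnA; congr (_ + _)%N.
  by rewrite mulnS [(alpha * q)%N]mulnC -addnA subnKC ?(ltnW lts) // addnC.
have sz' : (r * d <= size rs + b' + 2 * \sum_i v i)%N.
  by rewrite esum szrs sz subnK // mul2n -geq_half_double.
have := @generic_eigenstructure C n r d v V D P' rs b' ltrn fP.
rewrite esum -/q -/alpha -/s => /(_ freeV full' urs rrs qb).
rewrite -esum => /(_ sz')[hP' szeq].
by move: hP' szeq; rewrite esum => hP' szeq; apply: bundle_generic hK pP' hP' urs szeq.
Qed.

End BundleOpen.

Theorem theorem7p2 (R : realType) (n r d : nat)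
    (hn : (2 <= n)%N) (hd : (1 <= d)%N) (hdodd : odd d)
    (hr : (1 <= r <= n - 1)%N)
    (K : nat -> 'M[{poly R[i]}]_n)
    (hK : forall a : nat, (a <= (r * d)./2)%N -> is_K r d a (K a)) :
  (forall P : 'M[{poly R[i]}]_n, POLs_rank_le R[i] n d r P ->
     forall eps : R, 0 < eps ->
     exists a : nat, (a <= (r * d)./2)%N /\
       exists Pa : 'M[{poly R[i]}]_n,
         symmetric_bundle d (K a) Pa /\ mpdist d P Pa < eps)
  /\
  (forall a : nat, (a <= (r * d)./2)%N ->
     forall P : 'M[{poly R[i]}]_n, symmetric_bundle d (K a) P ->
     exists eps : R,
       [/\ 0 < eps,
           rank_ball d r P eps `<=` symmetric_bundle d (K a)
         & infinite_set (rank_ball d r P eps)]).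
Proof.
split; first exact: density.
by move=> a lea P bP; apply: bundle_open hr lea (hK a lea) bP.
Qed.
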